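(* Consider the weighted recursive graph with out-degree $m\in\mathbb{N}$ and suppose that the vertex-weights have finite mean, $\mathbb{E}[W]<\infty$; denote the distribution of $W$ by $\mu$. Then, almost surely, for any $k\in\mathbb{N}_0$, as $n\to\infty$, $$\Gamma_n\to\Gamma,\qquad \Gamma_n^{(k)}\to\Gamma^{(k)},\qquad p_n(k)\to p(k),$$ where the first two convergences hold in the weak$^\star$ topology and the limits are given by $$\Gamma(\mathrm{d}x)=\frac{xm}{\mathbb{E}[W]}\mu(\mathrm{d}x),\qquad \Gamma^{(k)}(\mathrm{d}x)=\frac{\mathbb{E}[W]/m}{\mathbb{E}[W]/m+x}\Big(\frac{x}{\mathbb{E}[W]/m+x}\Big)^{k}\mu(\mathrm{d}x),$$ and $$p(k)=\int_0^\infty\frac{\mathbb{E}[W]/m}{\mathbb{E}[W]/m+x}\Big(\frac{x}{\mathbb{E}[W]/m+x}\Big)^{k}\mu(\mathrm{d}x).$$ Finally, suppose instead that the vertex-weight distribution $\mu$ is a power law with infinite mean, that is, $\mathbb{P}(W\ge x)=\ell(x)x^{-(\alpha-1)}$ for some $\alpha\in(1,2)$ and some non-negative function $\ell$ that is slowly varying at infinity, and that there exists $x_l>0$ with $\mu((x_l,\infty))=1$. Let $U_n$ be a vertex of $\mathcal{G}_n$ selected uniformly at random, let $\varepsilon>0$ and let $E_n:=\{\mathcal{Z}_n(U_n)=0\}$. Then there is a constant $C>0$ such that for all $n$ sufficiently large $$\mathbb{P}(E_n)\ge 1-Cn^{-((2-\alpha)\wedge(\alpha-1))/\alpha+\vare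psilon}.$$
   Context: Weighted recursive graph (WRG): Let $m\in\mathbb{N}=\{1,2,\dots\}$ and let $W_1,W_2,\dots$ (the vertex-weights) be i.i.d. copies of a non-negative random variable $W$ with $\mathbb{P}(W>0)=1$; set $S_n=\sum_{i=1}^nW_i$. $\mathcal{G}_1$ consists of a single vertex $1$ with weight $W_1$. For $n\ge1$, $\mathcal{G}_{n+1}$ is obtained from $\mathcal{G}_n$ by introducing a new vertex $n+1$ with weight $W_{n+1}$ and $m$ half-edges; conditionally on $\mathcal{G}_n$ (including its vertex-weights), each half-edge is connected independently to some $i\in[n]=\{1,\dots,n\}$ with probability $W_i/S_n$. Edges are directed from new to old vertices. $\mathcal{Z}_n(i)$ denotes the in-degree of vertex $i$ in $\mathcal{G}_n$, and $\mathbb{N}_0=\{0,1,2,\dots\}$. With $\delta_x$ the Dirac measure at $x$, define $$\Gamma_n:=\frac1n\sum_{i=1}^n\mathcal{Z}_n(i)\delta_{W_i},\qquad \Gamma^{(k)}_n:=\frac1n\sum_{i=1}^n\mathbf{1}_{\{\mathcal{Z}_n(i)=k\}}\delta_{W_i},\qquad p_n(k):=\Gamma_n^{(k)}([0,\infty)).$$ The weak$^\star$ topology on finite measures on $[0,\infty)$ is the one of convergence of integrals of bounded continuous functions. $x\wedge y=\min\{x,y\}$. *)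

(* Defs.v *)
From HB Require Import structures.
From mathcomp Require Import all_boot all_order all_algebra.
From mathcomp Require Import interval_inference.
From mathcomp Require Import all_classical all_reals all_analysis.

Set Implicit Arguments.
Unset Strict Implicit.
Unset Printing Implicit Defensive.

Import Order.TTheory GRing.Theory Num.Theory.
Import numFieldNormedType.Exports.

Local Open Scope classical_set_scope.
Local Open Scope ring_scope.

(* Vertices are numbered from 0: the vertex written i here is the vertex i + 1
   of the usual numbering, so that G_n has vertex set {0, ..., n - 1} and the
   vertex added to G_n is n.  [W i] is the weight of vertex i; [V i j] is the
   vertex to which the j-th half-edge of vertex i is connected.  Vertex 0 has
   no half-edges, and [V 0 j] is never used. *)

(* Laws are compared on measurable sets only: a library measure is a total
   function whose values on non-measurable sets carry no meaning. *)
Definition iid_copies (d : measure_display) (T : measurableType d)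
    (R : realType) (P : probability T R)
    (X : {RV P >-> R}) (W : nat -> {RV P >-> R}) : Prop :=
  (forall (i : nat) (B : set R), measurable B ->
     distribution P (W i) B = distribution P X B) /\
  (forall (s : seq nat) (B : nat -> set R), uniq s ->
     (forall i, measurable (B i)) ->
     P [set w | forall i, i \in s -> B i (W i w)]
     = (\prod_(i <- s) P [set w | B i (W i w)])%E).

(* The sigma-algebra of G_n together with its vertex-weights. *)
Definition graph_events (d : measure_display) (T : measurableType d)
    (R : realType) (m : nat) (W : nat -> T -> R) (V : nat -> 'I_m -> T -> nat)
    (n : nat) : set (set T) :=
  <<s [set A | (exists (i : nat) (B : set R),
                  [/\ (i < n)%N, measurable B & A = W i @^-1` B])
            \/ (exists (i : nat) (j : 'I_m) (B : set nat),
                  (0 < i < n)%N /\ A = V i j @^-1` B)] >>.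

(* [q] is a version of the conditional probability of B given F. *)
Definition is_cond_prob (d : measure_display) (T : measurableType d)
    (R : realType) (P : probability T R) (F : set (set T)) (B : set T)
    (q : T -> R) : Prop :=
  [/\ forall Y : set R, measurable Y -> F (q @^-1` Y),
      P.-integrable [set: T] (EFin \o q)
    & forall A, F A -> P (A `&` B) = (\int[P]_(w in A) (q w)%:E)%E].

Definition total_weight (T : Type) (R : realType) (W : nat -> T -> R)
    (n : nat) (w : T) : R := \sum_(i < n) W i w.

Record weighted_recursive_graph (d : measure_display) (T : measurableType d)
    (R : realType) (P : probability T R) (m : nat) (X : {RV P >-> R})
    (W : nat -> {RV P >-> R}) (V : nat -> 'I_m -> {RV P >-> nat}) : Prop := {
  wrg_weight_ge0 : forall i w, 0 <= W i w ;
  wrg_weight_iid : iid_copies X W ;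
  wrg_target : forall n j w, (0 < n)%N -> (V n j w < n)%N ;
  (* given G_n, the m half-edges of vertex n are connected independently *)
  wrg_half_edges : forall (n : nat) (t : 'I_m -> 'I_n), (0 < n)%N ->
    is_cond_prob P (graph_events W V n)
      [set w | forall j, V n j w = t j]
      (fun w => \prod_(j < m) (W (t j) w / total_weight W n w)) ;
  (* the weight of vertex n is independent of G_n and of these half-edges *)
  wrg_new_weight : forall (n : nat) (t : 'I_m -> 'I_n) (A : set T) (B : set R),
    (0 < n)%N -> graph_events W V n A -> measurable B ->
    P (A `&` [set w | forall j, V n j w = t j] `&` (W n @^-1` B))
    = (P (A `&` [set w | forall j, V n j w = t j]) * P (W n @^-1` B))%E
}.

Definition indegree (T : Type) (m : nat) (V : nat -> 'I_m -> T -> nat)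
    (n i : nat) (w : T) : nat :=
  (\sum_(1 <= k < n) \sum_(j < m) (V k j w == i))%N.

(* Measures on [0, +oo[ are represented by measures on the real line. *)
Definition Gamma_n (T : Type) (R : realType) (m : nat) (W : nat -> T -> R)
    (V : nat -> 'I_m -> T -> nat) (n : nat) (w : T) :
    {measure set R -> \bar R} :=
  mscale (n%:R^-1)%:nng
    (msum (fun i => mscale ((indegree V n i w)%:R)%:nng (\d_(W i w))) n).

Definition Gamma_nk (T : Type) (R : realType) (m : nat) (W : nat -> T -> R)
    (V : nat -> 'I_m -> T -> nat) (k n : nat) (w : T) :
    {measure set R -> \bar R} :=
  mscale (n%:R^-1)%:nng
    (msum (fun i => mscale ((indegree V n i w == k)%:R)%:nng (\d_(W i w))) n).

Definition p_n (T : Type) (R : realType) (m : nat) (W : nat -> T -> R)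
    (V : nat -> 'I_m -> T -> nat) (k n : nat) (w : T) : \bar R :=
  Gamma_nk W V k n w `[0, +oo[%classic.

Definition weak_star_cvg (R : realType)
    (M : nat -> {measure set R -> \bar R})
    (L : {measure set R -> \bar R}) : Prop :=
  forall f : R -> R,
    {within `[0, +oo[, continuous f} ->
    (exists K : R, forall x, 0 <= x -> `|f x| <= K) ->
    (fun n => \int[M n]_(x in `[0%R, +oo[) (f x)%:E)%E @ \oo
      --> (\int[L]_(x in `[0%R, +oo[) (f x)%:E)%E.

(* L(dx) = g(x) mu(dx) on [0, +oo[, and L gives no mass to ]-oo, 0[ *)
Definition has_density (R : realType)
    (mu L : {measure set R -> \bar R}) (g : R -> R) : Prop :=
  forall A : set R, measurable A ->
    L A = (\int[mu]_(x in A `&` `[0%R, +oo[) (g x)%:E)%E.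

(* The factor b/(b + x) (x/(b + x))^k of the limits; b stands for E[W]/m. *)
Definition mixed_geometric (R : realType) (b : R) (k : nat) (x : R) : R :=
  b / (b + x) * (x / (b + x)) ^+ k.

Definition slowly_varying (R : realType) (ell : R -> R) : Prop :=
  measurable_fun (`]0, +oo[%classic : set R) ell /\
  forall c : R, 0 < c -> (fun x => ell (c * x) / ell x) @ +oo --> (1 : R).

(* U n is uniform on the vertices of G_n, independently of G_n. *)
Definition uniform_vertex (d : measure_display) (T : measurableType d)
    (R : realType) (P : probability T R) (m : nat) (W : nat -> {RV P >-> R})
    (V : nat -> 'I_m -> {RV P >-> nat}) (U : nat -> {RV P >-> nat}) : Prop :=
  forall n : nat, (0 < n)%N ->
    (forall w, (U n w < n)%N) /\
    (forall (i : 'I_n) (A : set T), graph_events W V n A ->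
       P (A `&` [set w | U n w = i]) = (P A * (n%:R^-1)%:E)%E).

(* Main.v *)
Require Import Defs.
From HB Require Import structures.
From mathcomp Require Import all_boot all_order all_algebra.
From mathcomp Require Import interval_inference.
From mathcomp Require Import all_classical all_reals all_analysis.
From mathcomp Require Import measurable_realfun.
From mathcomp Require Import ring lra zify.

Set Implicit Arguments.
Unset Strict Implicit.
Unset Printing Implicit Defensive.

Import Order.TTheory GRing.Theory Num.Theory.
Import numFieldNormedType.Exports.

Local Open Scope classical_set_scope.
Local Open Scope ring_scope.

(** Finite mean.  Let S_n be the total weight of G_n and mu the mean weight;
    S_n / n tends to mu almost surely [strong_law].  For a test function f let
    N_n^k(f) be the sum of f(W_i) over the vertices i of G_n of in-degree k.
    A half-edge attached to G_n changes N_n^k(f) by a bounded amount, whose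
    conditional expectation given G_n is
    (N_n^(k-1)(x f) - N_n^k(x f)) / S_n, where x f stands for the function that
    maps x to x f(x).  The deviations from these conditional expectations are
    bounded and pairwise orthogonal, so that their partial sums are o(n) almost
    surely [edge_noise_sublinear].  Replacing S_n by n mu leaves, along almost
    every path, a linear recursion for the averages N_n^k(f) / n with an error
    o(n) [count_recursion], and the integrals against the mixture of geometric
    laws solve the limiting equation [limit_degree_sum_rec].

    The recursion for f involves x f, so it does not close.  If f vanishes
    outside [0, M), write x = M - (M - x): the term M f pulls the average back
    to its limit, and the perturbation (M - x) f is at most M |f|.  This bounds
    the upper limit of the error for f by a constant smaller than 1 times the
    one for (M - x) f / M, and iterating gives convergence
    [chained_contraction, degree_limit].  The half-edges weighted by f at their
    targets are handled by the same orthogonality [half_edge_limit].  The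
    indicators of the intervals [0, q) with q rational, together with the total
    masses, yield the convergence in the weak topology
    [weak_star_cvg_masses].

    Infinite mean.  Put a = alpha - 1, so that 0 < a < 1, and call a vertex of
    in-degree 0 isolated.  A vertex that is not isolated is heavier than x or is
    a target among the vertices of weight at most x, hence the probability that U_n is not isolated is at most P(X > x)
    plus 1/n times the expected number of half-edges with a target of weight at
    most x [isolated_vertex_bound].  The total weight of G_k is at least y
    unless all k weights are below y, so a half-edge of vertex k has such a
    target with probability at most (1 - P(X >= y))^k + k E[X; X <= x] / y
    [light_target_bound].  Since X has a regularly varying tail, P(X >= x) and
    E[X; X <= x] are, up to arbitrarily small powers of x, of the orders x^(-a)
    and x^(1-a) [tail_upper, tail_lower, truncated_growth].  Bounding the
    half-edges of the first n^(1/(2-a)) vertices by their number and taking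
    x = n^(rho/a) with rho = (1-a)/(2-a), and y just below k^(1/a) for the
    others, gives the rate n^(-rho+eps) [isolated_rate]; and rho is at least
    the smaller of 1-a and a, divided by 1+a. *)

(** * Sequences of sublinear growth *)

Section Sublinear.
Variable R : realType.
Implicit Types (u v : nat -> R) (K e : R).

Definition sublinear u := (fun n => u n / n%:R) @ \oo --> (0 : R).

Lemma sublinearP u : sublinear u <->
  forall e, 0 < e -> \forall n \near \oo, `|u n| <= e * n%:R.
Proof.
split=> [/cvgrPdist_le uo e e0|uo].
  near=> n.
  have n0 : (0 : R) < n%:R by rewrite ltr0n; near: n; exists 1%N.
  rewrite -ler_pdivrMr// -[X in _ / X]gtr0_norm// -normf_div.
  rewrite -normrN -sub0r; near: n; exact: uo.
apply/cvgrPdist_le => e e0; near=> n.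
have n0 : (0 : R) < n%:R by rewrite ltr0n; near: n; exists 1%N.
rewrite sub0r normrN normf_div [X in _ / X]gtr0_norm// ler_pdivrMr//.
by near: n; exact: uo.
Unshelve. all: by end_near. Qed.

Lemma sublinearD u v :
  sublinear u -> sublinear v -> sublinear (fun n => u n + v n).
Proof.
move=> uo vo; rewrite /sublinear -[0]addr0.
by under eq_fun do rewrite mulrDl; exact: cvgD.
Qed.

Lemma sublinearZ K u : sublinear u -> sublinear (fun n => K * u n).
Proof.
move=> uo; rewrite /sublinear -[0](mulr0 K).
by under eq_fun do rewrite -mulrA; apply: cvgM => //; exact: cvg_cst.
Qed.

Lemma sublinearN u : sublinear u -> sublinear (fun n => - u n).
Proof.
by move=> /(sublinearZ (-1)); under eq_fun do rewrite mulN1r.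
Qed.

Lemma sublinear_le u v : sublinear v ->
  (\forall n \near \oo, `|u n| <= v n) -> sublinear u.
Proof.
move=> /sublinearP vo uv; apply/sublinearP => e e0; near=> n.
apply: (@le_trans _ _ (v n)); first by near: n.
by apply: le_trans (ler_norm _) _; near: n; exact: vo.
Unshelve. all: by end_near. Qed.

Lemma sublinear_eq u v : sublinear v -> u =1 v -> sublinear u.
Proof. by move=> vo /funext ->. Qed.

Lemma sublinear_cst K : sublinear (fun=> K).
Proof.
apply/sublinearP => e e0; near=> n.
rewrite mulrC -ler_pdivrMr//; near: n; exact: nbhs_infty_ger.
Unshelve. all: by end_near. Qed.

Lemma sublinear_mean u : u @ \oo --> (0 : R) ->
  sublinear (fun n => \sum_(j < n) u j).
Proof.
move=> /cesaro u0; rewrite /sublinear -cvg_shiftS.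
rewrite (_ : (fun n => _) = arithmetic_mean u) //.
by apply/funext => n; rewrite /arithmetic_mean /series /= mulrC big_mkord.
Qed.

Lemma sublinear_sum_le u v : (forall i, 0 <= v i) ->
  (forall i, (0 < i)%N -> `|u i| <= v i) ->
  sublinear (fun n => \sum_(i < n) v i) -> sublinear (fun n => \sum_(i < n) u i).
Proof.
move=> v0 uv vo; apply: sublinear_le (sublinearD (sublinear_cst `|u 0%N|) vo) _.
apply: nearW => -[|n]; first by rewrite !big_ord0 normr0 addr0.
rewrite big_ord_recl [X in _ <= _ + X]big_ord_recl.
apply: le_trans (ler_normD _ _) _; rewrite lerD2l.
apply: le_trans (ler_norm_sum _ _ _) _; rewrite -[leLHS]add0r lerD//.
by apply: ler_sum => i _; exact: uv.
Qed.

Lemma sublinear_sum_eq u v : (forall i, (0 < i)%N -> u i = v i) ->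
  sublinear (fun n => \sum_(i < n) v i) -> sublinear (fun n => \sum_(i < n) u i).
Proof.
move=> uv vo.
have h : sublinear (fun n => \sum_(i < n) (u i - v i)).
  apply: (@sublinear_sum_le (fun i => u i - v i) (fun=> 0)) => //.
    by move=> i /uv ->; rewrite subrr normr0.
  by apply: sublinear_eq (sublinear_cst 0) _ => n; rewrite big1.
apply: sublinear_eq (sublinearD vo h) _ => n.
by rewrite -big_split /=; apply: eq_bigr => i _; rewrite addrC subrK.
Qed.

Lemma sublinear_cvg u (l : R) : sublinear (fun n => u n - n%:R * l) ->
  (fun n => u n / n%:R) @ \oo --> l.
Proof.
move=> uo; rewrite -[l]add0r.
have : (fun n => (u n - n%:R * l) / n%:R + l) @ \oo --> 0 + l.
  by apply: cvgD => //; exact: cvg_cst.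
apply: cvg_trans; apply: near_eq_cvg; near=> n.
have n0 : (n%:R : R) != 0 by rewrite pnatr_eq0 -lt0n; near: n; exists 1%N.
by rewrite /= mulrBl (mulrC n%:R) mulfK// subrK.
Unshelve. all: by end_near. Qed.

Lemma sqrt_interval (n : nat) : exists k, (k ^ 2 <= n < k.+1 ^ 2)%N.
Proof.
elim: n => [|n [k /andP[kn nk]]]; first by exists 0%N.
have [h|h] := ltnP n.+1 (k.+1 ^ 2); first by exists k; rewrite h ltnW.
by exists k.+1; rewrite h /= (leq_ltn_trans nk)// ltn_exp2r.
Qed.

(** Between the squares k^2 and (k+1)^2 a sequence with bounded increments moves
    by O(k), which is negligible against k^2. *)
Lemma sublinear_squares K u : (forall n, `|u n.+1 - u n| <= K) ->
  (fun n => u (n ^ 2)%N / (n ^ 2)%:R) @ \oo --> (0 : R) -> sublinear u.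
Proof.
move=> uK /cvgrPdist_le usq.
have K0 : 0 <= K := le_trans (normr_ge0 _) (uK 0%N).
have inc n p : `|u (n + p)%N - u n| <= K * p%:R.
  elim: p => [|p IH]; first by rewrite addn0 subrr normr0 mulr0.
  rewrite addnS -(subrK (u (n + p)%N) (u _.+1)) -addrA -natr1 mulrDr mulr1 addrC.
  by rewrite (le_trans (ler_normD _ _))// lerD.
apply/sublinearP => e e0.
have e20 : 0 < e / 2 by lra.
have [N0 _ HN0] := usq _ e20.
have [N1 _ HN1] := nbhs_infty_ger (2 * K / (e / 2)).
pose N := (maxn N0 N1).+1.
exists (N ^ 2)%N => // n /= Nn.
have [k /andP[kn nk]] := sqrt_interval n.
have Nk : (N <= k)%N.
  by rewrite -ltnS -(@ltn_exp2r _ _ 2)//; exact: leq_ltn_trans Nn nk.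
have k0 : (0 < k)%N by apply: leq_trans Nk.
have k2 : (0 : R) < (k ^ 2)%:R by rewrite ltr0n expn_gt0 k0.
have := HN0 k; rewrite /= => /(_ (leq_trans (leq_trans (leq_maxl _ _) (leqnSn _)) Nk)).
rewrite sub0r normrN normf_div [X in _ / X]gtr0_norm// ler_pdivrMr// => u1.
have := HN1 k; rewrite /= => /(_ (leq_trans (leq_trans (leq_maxr _ _) (leqnSn _)) Nk)).
rewrite ler_pdivrMr// => u2.
have := inc (k ^ 2)%N (n - k ^ 2)%N; rewrite subnKC// => u3.
have u4 : (n - k ^ 2)%:R <= 2 * k%:R :> R.
  rewrite -natrM ler_nat leq_subLR -ltnS; apply: leq_trans nk _.
  by rewrite !expnS expn0 !muln1; rewrite mulSn mulnS mul2n -addnn; lia.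
have u5 : (k ^ 2)%:R <= n%:R :> R by rewrite ler_nat.
have u6 : (k ^ 2)%:R = k%:R * k%:R :> R by rewrite -natrM mulnn.
have u7 : K * (n - k ^ 2)%:R <= K * (2 * k%:R) by rewrite ler_wpM2l.
have u8 : `|u n| <= `|u n - u (k ^ 2)%N| + `|u (k ^ 2)%N|.
  by rewrite -{1}(subrK (u (k^2)%N) (u n)) ler_normD.
have u9 : 2 * K * k%:R <= k%:R * (e / 2) * k%:R by rewrite ler_wpM2r.
nra.
Qed.

(** Let z n be B / n times the sum of the g j - x j for j < n.  Then
    (n+1) z (n+1) = (n - B) z n + B g n + o(1), so the excess of |z n| over
    B G / (1 + B), multiplied by n, does not increase once it is positive. *)
Lemma mean_contraction (B G e : R) (x g : nat -> R) : 0 < B -> 0 < e ->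
  sublinear (fun n => n%:R * x n - B * \sum_(j < n) (g j - x j)) ->
  (\forall n \near \oo, `|g n| <= G) ->
  \forall n \near \oo, `|x n| <= B / (1 + B) * G + e.
Proof.
move=> B0 e0 xo gG.
pose z n := (B * \sum_(j < n) (g j - x j)) / n%:R.
pose dl := e / 3.
have dl0 : 0 < dl by rewrite /dl; lra.
pose H := B / (1 + B) * (G + dl).
have B1 : 1 + B > 0 by lra.
have HE : (1 + B) * H = B * (G + dl) by rewrite /H; field; lra.
have xz : \forall n \near \oo, `|x n - z n| <= dl.
  move/cvgrPdist_le: xo => /(_ _ dl0); apply: filter_app; near=> n.
  have n0 : (n%:R : R) != 0 by rewrite pnatr_eq0 -lt0n; near: n; exists 1%N.
  by rewrite sub0r normrN mulrBl mulrC mulKf.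
have [N _ HN] : \forall n \near \oo,
    [/\ `|g n| <= G, `|x n - z n| <= dl, B <= n%:R & (0 < n)%N].
  near=> n; split; [by near: n|by near: n|by near: n; exact: nbhs_infty_ger|].
  by near: n; exists 1%N.
pose Q := Num.max 0 (N%:R * (`|z N| - H)).
have Q0 : 0 <= Q by rewrite /Q le_max lexx.
have step n : (N <= n)%N -> n%:R * (`|z n| - H) <= Q.
  move=> Nn; rewrite -(subnKC Nn).
  elim: (n - N)%N => [|p IH]; first by rewrite addn0 /Q le_max lexx orbT.
  move: IH; rewrite addnS; set k := (N + p)%N => IH.
  have [gk xk Bk k0] : [/\ `|g k| <= G, `|x k - z k| <= dl, B <= k%:R & (0 < k)%N].
    by apply: HN; rewrite /= leq_addr.
  have k0' : (k%:R : R) > 0 by rewrite ltr0n.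
  have zS : k.+1%:R * z k.+1 = (k%:R - B) * z k + B * (g k - (x k - z k)).
    rewrite /z big_ord_recr /= -natr1.
    set S := \sum_(j < k) _; field.
    by rewrite natr1 !pnatr_eq0 -lt0n k0.
  have : k.+1%:R * `|z k.+1| <= (k%:R - B) * `|z k| + B * (G + dl).
    rewrite -[X in X * _](@ger0_norm _ k.+1%:R)// -normrM zS.
    apply: le_trans (ler_normD _ _) _; rewrite !normrM.
    rewrite (@ger0_norm _ (k%:R - B)) ?subr_ge0// (gtr0_norm B0) lerD2l.
    rewrite ler_pM2l//; apply: le_trans (ler_normB _ _) _; exact: lerD.
  rewrite -natr1 mulrBr => h.
  have : (k%:R + 1) * `|z k.+1| - (k%:R + 1) * H <= (k%:R - B) * (`|z k| - H).
    by nra.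
  move=> /le_trans; apply.
  have [v0|v0] := leP (`|z k| - H) 0; first by nra.
  by apply: le_trans IH; apply: ler_wpM2r; [exact: ltW|lra].
near=> n.
have nN : (N <= n)%N by near: n; exists N.
have [gn xn Bn n0] := HN n nN.
have n0' : (n%:R : R) > 0 by rewrite ltr0n.
have Qn : Q <= dl * n%:R.
  rewrite mulrC -ler_pdivrMr//; near: n; exact: nbhs_infty_ger.
have zn : `|z n| - H <= dl.
  rewrite -(ler_pM2l n0'); apply: le_trans (step _ nN) _; by rewrite mulrC.
have xn' : `|x n| <= `|x n - z n| + `|z n| by rewrite -{1}(subrK (z n) (x n)) ler_normD.
have BB : B / (1 + B) * dl <= dl.
  rewrite ler_piMl// ?(ltW dl0)// ler_pdivrMr//; lra.
have -> : e = 3 * dl by rewrite /dl; lra.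
have : H = B / (1 + B) * G + B / (1 + B) * dl by rewrite /H mulrDr.
lra.
Unshelve. all: by end_near. Qed.

(** Each step of the chain gains a factor B / (1 + B) < 1 over the trivial
    bound C, and the chain is infinite. *)
Lemma chained_contraction (B C : R) (x : nat -> nat -> R) : 0 < B ->
  (forall r n, `|x r n| <= C) ->
  (forall r, sublinear (fun n =>
     n%:R * x r n - B * \sum_(j < n) (x r.+1 j - x r j))) ->
  x 0%N @ \oo --> (0 : R).
Proof.
move=> B0 xC xo.
pose rho := B / (1 + B).
have B1 : 1 + B > 0 by lra.
have rho0 : 0 <= rho by rewrite /rho divr_ge0// ltW.
have rho1 : rho < 1 by rewrite /rho ltr_pdivrMr//; lra.
have iter j r e : 0 < e -> \forall n \near \oo, `|x r n| <= rho ^+ j * C + e.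
  elim: j r e => [|j IH] r e e0.
    by near=> n; rewrite expr0 mul1r ler_wpDr// ltW.
  have e20 : 0 < e / 2 by lra.
  have := mean_contraction B0 e20 (xo r) (IH r.+1 _ e20).
  apply: filterS => n /le_trans; apply.
  rewrite -/rho exprS -mulrA mulrDr -addrA lerD2l.
  have : rho * (e / 2) <= e / 2 by rewrite ler_piMl// ltW.
  lra.
have C0 : 0 <= C := le_trans (normr_ge0 _) (xC 0%N 0%N).
have cvg0 : (fun j => rho ^+ j * C) @ \oo --> (0 : R).
  rewrite -(mul0r C); apply: cvgM; last exact: cvg_cst.
  by apply: cvg_expr; rewrite ger0_norm.
apply/cvgrPdist_le => e e0.
have e20 : 0 < e / 2 by lra.
move/cvgrPdist_le: cvg0 => /(_ _ e20) [j _ /(_ j (leqnn j))].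
rewrite /= sub0r normrN ger0_norm; last by rewrite mulr_ge0// exprn_ge0.
move=> hj; have := iter j 0%N _ e20; apply: filterS => n hn.
rewrite sub0r normrN; lra.
Unshelve. all: by end_near. Qed.

End Sublinear.

(** * Expectations of bounded functions *)

Section BoundedFunctions.
Context (d : measure_display) (T : measurableType d) (R : realType).
Implicit Types f g : T -> R.

(** Restricting to bounded functions makes every expectation finite, so that all
    the computations below take place in R. *)
Definition bounded_mfun f :=
  measurable_fun setT f /\ exists K : R, forall w, `|f w| <= K.

Lemma bounded_mfun_cst (c : R) : bounded_mfun (fun=> c).
Proof. by split; [exact: measurable_cst|exists `|c|]. Qed.

Lemma bounded_mfun_indic (A : set T) : measurable A -> bounded_mfun \1_A.
Proof.
move=> mA; split; first exact: measurable_indic.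
by exists 1 => w; rewrite indicE; case: (_ \in _); rewrite ?normr1 ?normr0.
Qed.

Lemma bounded_mfunD f g :
  bounded_mfun f -> bounded_mfun g -> bounded_mfun (fun w => f w + g w).
Proof.
move=> [mf [K fK]] [mg [L gL]]; split; first exact: measurable_funD.
by exists (K + L) => w; rewrite (le_trans (ler_normD _ _))// lerD.
Qed.

Lemma bounded_mfunM f g :
  bounded_mfun f -> bounded_mfun g -> bounded_mfun (fun w => f w * g w).
Proof.
move=> [mf [K fK]] [mg [L gL]]; split; first exact: measurable_funM.
by exists (K * L) => w; rewrite normrM ler_pM.
Qed.

Lemma bounded_mfunZ c f : bounded_mfun f -> bounded_mfun (fun w => c * f w).
Proof. by move=> bf; apply: bounded_mfunM => //; exact: bounded_mfun_cst. Qed.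

Lemma bounded_mfunN f : bounded_mfun f -> bounded_mfun (fun w => - f w).
Proof. by move=> /(bounded_mfunZ (-1)); under eq_fun do rewrite mulN1r. Qed.

Lemma bounded_mfunB f g :
  bounded_mfun f -> bounded_mfun g -> bounded_mfun (fun w => f w - g w).
Proof. by move=> bf bg; apply: bounded_mfunD => //; exact: bounded_mfunN. Qed.

Lemma bounded_mfunX n f : bounded_mfun f -> bounded_mfun (fun w => f w ^+ n).
Proof.
move=> bf; elim: n => [|n IH].
  by under eq_fun do rewrite expr0; exact: bounded_mfun_cst.
by under eq_fun do rewrite exprS; exact: bounded_mfunM.
Qed.

Lemma bounded_mfun_sum (I : Type) (r : seq I) (Q : pred I) (F : I -> T -> R) :
  (forall i, Q i -> bounded_mfun (F i)) ->
  bounded_mfun (fun w => \sum_(i <- r | Q i) F i w).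
Proof.
move=> bF; have -> : (fun w => \sum_(i <- r | Q i) F i w) = \sum_(i <- r | Q i) F i.
  by apply/funext => n; rewrite fct_sumE.
apply: (big_ind bounded_mfun) => //; first exact: bounded_mfun_cst.
by move=> ? ? ? ?; exact: bounded_mfunD.
Qed.

Lemma bounded_mfun_prod (I : Type) (r : seq I) (Q : pred I) (F : I -> T -> R) :
  (forall i, Q i -> bounded_mfun (F i)) ->
  bounded_mfun (fun w => \prod_(i <- r | Q i) F i w).
Proof.
move=> bF; elim: r => [|i r IH].
  by under eq_fun do rewrite big_nil; exact: bounded_mfun_cst.
under eq_fun do rewrite big_cons; case: (boolP (Q i)) => Qi //.
by apply: bounded_mfunM => //; exact: bF.
Qed.

End BoundedFunctions.

Lemma bounded_mfun_comp (d d' : measure_display) (T : measurableType d)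
    (T' : measurableType d') (R : realType) (X : T -> T') (f : T' -> R) :
  measurable_fun setT X -> bounded_mfun f -> bounded_mfun (fun w => f (X w)).
Proof.
move=> mX [mf [K fK]]; split; last by exists K.
exact: (measurableT_comp mf mX).
Qed.

Section Expectation.
Context (d : measure_display) (T : measurableType d) (R : realType).
Variable P : probability T R.
Implicit Types f g : T -> R.

Local Notation Ex := (Rintegral P setT).

Lemma bounded_mfun_integrable f :
  bounded_mfun f -> P.-integrable setT (EFin \o f).
Proof.
move=> [mf [K fK]]; apply: measurable_bounded_integrable => //.
  by rewrite (le_lt_trans (probability_le1 _ _))// ltry.
exists K; split; first by rewrite num_real.
by move=> x Kx w _; apply: le_trans (fK w) (ltW Kx).
Qed.

Lemma Ex_fin f : bounded_mfun f -> (\int[P]_w (f w)%:E = (Ex f)%:E)%E.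
Proof.
move=> bf; rewrite /Rintegral fineK//.
exact: integrable_fin_num (bounded_mfun_integrable bf).
Qed.

Lemma ExD f g : bounded_mfun f -> bounded_mfun g ->
  Ex (fun w => f w + g w) = Ex f + Ex g.
Proof. by move=> bf bg; apply: RintegralD => //; exact: bounded_mfun_integrable. Qed.

Lemma ExZ c f : bounded_mfun f -> Ex (fun w => c * f w) = c * Ex f.
Proof. by move=> bf; apply: RintegralZl => //; exact: bounded_mfun_integrable. Qed.

Lemma ExB f g : bounded_mfun f -> bounded_mfun g ->
  Ex (fun w => f w - g w) = Ex f - Ex g.
Proof. by move=> bf bg; apply: RintegralB => //; exact: bounded_mfun_integrable. Qed.

Lemma Ex_cst c : Ex (fun=> c) = c.
Proof.
by rewrite /Rintegral integral_cst//= (_ : _ setT = 1%E) ?mule1//; exact: probability_setT.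
Qed.

Lemma Ex_le f g : bounded_mfun f -> bounded_mfun g ->
  (forall w, f w <= g w) -> Ex f <= Ex g.
Proof.
by move=> bf bg fg; apply: le_Rintegral => //; exact: bounded_mfun_integrable.
Qed.

Lemma Ex_ge0 f : (forall w, 0 <= f w) -> 0 <= Ex f.
Proof. by move=> f0; apply: Rintegral_ge0 => w _. Qed.

Lemma Ex_norm_le f c : bounded_mfun f -> (forall w, `|f w| <= c) -> `|Ex f| <= c.
Proof.
move=> bf fc; rewrite ler_norml -{1}(Ex_cst (- c)) -{2}(Ex_cst c).
by apply/andP; split; apply: Ex_le => //; try exact: bounded_mfun_cst;
  move=> w; have := fc w; rewrite ler_norml => /andP[].
Qed.

Lemma Ex_sum (I : Type) (r : seq I) (Q : pred I) (F : I -> T -> R) :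
  (forall i, Q i -> bounded_mfun (F i)) ->
  Ex (fun w => \sum_(i <- r | Q i) F i w) = \sum_(i <- r | Q i) Ex (F i).
Proof.
move=> bF; elim: r => [|i r IH].
  by rewrite big_nil; under eq_fun do rewrite big_nil; rewrite Ex_cst.
rewrite big_cons; under eq_fun do rewrite big_cons.
case: (boolP (Q i)) => Qi //.
by rewrite ExD ?IH//; [exact: bF|exact: bounded_mfun_sum].
Qed.

Lemma Ex_indic (A : set T) : measurable A -> Ex \1_A = fine (P A).
Proof. by move=> mA; rewrite /Rintegral integral_indic// setIT. Qed.

(** Tonelli for series: a non-negative series whose integrals are summable has
    almost surely a finite sum. *)
Lemma ae_cvg0_summable (g : nat -> T -> R) (C : R) :
  (forall n, bounded_mfun (g n)) -> (forall n w, 0 <= g n w) ->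
  (forall n, \sum_(i < n) Ex (g i) <= C) ->
  {ae P, forall w, (fun n => g n w) @ \oo --> (0 : R)}.
Proof.
move=> bg g0 gC.
have g0E n w : (0 <= (g n w)%:E)%E by rewrite lee_fin.
pose G w := (\sum_(n <oo) (g n w)%:E)%E.
have mg n : measurable_fun setT (fun w => (g n w)%:E).
  by apply/measurable_EFinP; case: (bg n).
have intG : (\int[P]_w G w <= C%:E)%E.
  rewrite /G integral_nneseries//; apply: lime_le.
    by apply: is_cvg_nneseries => n _ _; exact: integral_ge0.
  near=> n; rewrite big_mkord.
  by under eq_bigr do rewrite Ex_fin//; rewrite sumEFin lee_fin.
have mG : measurable_fun setT G.
  by apply: (ge0_emeasurable_sum (P := predT)) => // n w _ _.
have iG : P.-integrable setT G.
  apply/integrableP; split => //.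
  under eq_integral do rewrite gee0_abs ?nneseries_ge0//.
  by rewrite (le_lt_trans intG)// ltry.
have := integrable_ae measurableT iG.
apply: filterS => w /(_ I) Gfin.
apply: cvg_series_cvg_0; apply: nondecreasing_is_cvgn.
  by apply: nondecreasing_series => n _ _; exact: g0.
exists (fine (G w)) => _ [n _ <-]; rewrite /series /= -lee_fin fineK//.
by rewrite -sumEFin; apply: nneseries_lim_ge.
Unshelve. all: by end_near. Qed.

End Expectation.

(** * Orthogonality and averages *)

Lemma sum_inv_squares (R : realFieldType) (n : nat) :
  \sum_(i < n) (i.+1%:R ^+ 2)^-1 <= 2 :> R.
Proof.
case: n => [|n]; first by rewrite big_ord0.
suff : \sum_(i < n.+1) (i.+1%:R ^+ 2)^-1 <= 2 - n.+1%:R^-1 :> R.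
  by move=> /le_trans; apply; rewrite gerBl invr_ge0.
elim: n => [|n IH]; first by rewrite big_ord1 expr1n invr1; lra.
rewrite big_ord_recr /=; apply: le_trans (lerD IH (lexx _)) _.
rewrite -(natr1 n.+1).
set x : R := n.+1%:R; have x0 : 0 < x by rewrite ltr0n.
rewrite -subr_ge0.
have -> : 2 - (x + 1)^-1 - (2 - x^-1 + ((x + 1) ^+ 2)^-1) = (x * (x + 1) ^+ 2)^-1.
  by field; rewrite !gt_eqF//; lra.
by rewrite invr_ge0 mulr_ge0 ?sqr_ge0 ?ltW.
Qed.

Section Orthogonality.
Context (d : measure_display) (T : measurableType d) (R : realType).
Variable P : probability T R.
Local Notation Ex := (Rintegral P setT).

Lemma Ex_sqr_sum_orthogonal (D : nat -> T -> R) (n : nat) :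
  (forall i, bounded_mfun (D i)) ->
  (forall i j, (i < j)%N -> Ex (fun w => D i w * D j w) = 0) ->
  Ex (fun w => (\sum_(i < n) D i w) ^+ 2) = \sum_(i < n) Ex (fun w => D i w ^+ 2).
Proof.
move=> bD orth.
have bS k : bounded_mfun (fun w => \sum_(i < k) D i w).
  by apply: bounded_mfun_sum => i _.
elim: n => [|n IH].
  by under eq_fun do rewrite big_ord0 expr0n /=; rewrite Ex_cst big_ord0.
under eq_fun do rewrite big_ord_recr /= sqrrD.
have bSD : bounded_mfun (fun w => (\sum_(i < n) D i w) * D n w).
  exact: bounded_mfunM.
have bS2 := bounded_mfunX 2 (bS n).
have bSD2 : bounded_mfun (fun w => (\sum_(i < n) D i w) * D n w *+ 2).
  by under eq_fun do rewrite mulr2n; exact: bounded_mfunD.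
rewrite (ExD P (bounded_mfunD bS2 bSD2) (bounded_mfunX 2 (bD n))) (ExD P bS2 bSD2).
under [X in _ + Ex X + _]eq_fun do rewrite mulr2n.
rewrite (ExD P bSD bSD).
have -> : Ex (fun w => (\sum_(i < n) D i w) * D n w) = 0.
  under eq_fun do rewrite mulr_suml.
  rewrite Ex_sum => [|i _]; last exact: bounded_mfunM (bD i) (bD n).
  by rewrite big1// => i _; exact: orth.
by rewrite !addr0 IH big_ord_recr.
Qed.

(** The second moment of the n-th partial sum is at most K^2 n, which makes the
    averages along the squares square-summable; between two squares the partial
    sums move by a negligible amount. *)
Lemma bounded_orthogonal_sublinear (D : nat -> T -> R) (K : R) :
  (forall n, measurable_fun setT (D n)) -> (forall n w, `|D n w| <= K) ->
  (forall i j, (i < j)%N -> Ex (fun w => D i w * D j w) = 0) ->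
  {ae P, forall w, sublinear (fun n => \sum_(i < n) D i w)}.
Proof.
move=> mD DK orth.
have bD n : bounded_mfun (D n) by split => //; exists K.
have K0 : 0 <= K := le_trans (normr_ge0 _) (DK 0%N point).
have bS n : bounded_mfun (fun w => \sum_(i < n) D i w).
  by apply: bounded_mfun_sum => i _.
have ES n : Ex (fun w => (\sum_(i < n) D i w) ^+ 2) <= K ^+ 2 * n%:R.
  rewrite Ex_sqr_sum_orthogonal// -[n in K ^+ 2 * n%:R]card_ord -sum1_card natr_sum.
  rewrite mulr_sumr; apply: ler_sum => i _; rewrite mulr1 -[leRHS](Ex_cst P).
  apply: Ex_le; [exact: bounded_mfunX|exact: bounded_mfun_cst|move=> w].
  by rewrite -real_normK ?num_real//; apply: lerXn2r; rewrite ?nnegrE.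
pose g n w := ((\sum_(i < n.+1 ^ 2) D i w) / (n.+1 ^ 2)%:R) ^+ 2.
have bg n : bounded_mfun (g n).
  by apply: bounded_mfunX; apply: bounded_mfunM => //; exact: bounded_mfun_cst.
have g0 n w : 0 <= g n w by exact: sqr_ge0.
have Eg n : Ex (g n) <= K ^+ 2 * (n.+1%:R ^+ 2)^-1.
  rewrite /g; under eq_fun do rewrite exprMn mulrC.
  rewrite ExZ; last exact: bounded_mfunX.
  rewrite exprVn mulrC ler_pdivrMr; last by rewrite exprn_gt0// ltr0n expn_gt0.
  apply: le_trans (ES _) _; rewrite natrX -[leRHS]mulrA ler_wpM2l ?sqr_ge0//.
  by rewrite [_ ^+ 2 ^+ 2]expr2 mulKf// expf_neq0// pnatr_eq0.
have sumg n : \sum_(i < n) Ex (g i) <= K ^+ 2 * 2.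
  apply: le_trans (_ : \sum_(i < n) K ^+ 2 * (i.+1%:R ^+ 2)^-1 <= _).
    exact: ler_sum.
  by rewrite -mulr_sumr ler_wpM2l ?sqr_ge0//; exact: sum_inv_squares.
apply: filterS (ae_cvg0_summable bg g0 sumg) => w gw.
apply: (@sublinear_squares _ K) => [n|].
  by rewrite big_ord_recr /= addrAC subrr add0r.
rewrite -cvg_shiftS; apply/cvgrPdist_le => e e0.
have e20 : 0 < e ^+ 2 by rewrite exprn_gt0.
move/cvgrPdist_le: gw => /(_ _ e20); apply: filterS => n.
rewrite !sub0r !normrN (ger0_norm (g0 _ _)) /g -real_normK ?num_real//.
by rewrite ler_pXn2r// ?nnegrE// ltW.
Qed.

Lemma count_below (z : R) (L : nat) : 0 <= z -> z < L%:R ->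
  `|z - \sum_(l < L) (l.+1%:R <= z)%R%:R| <= 1.
Proof.
move=> z0 zL.
have [k /andP[kz zk]] : exists k : nat, k%:R <= z < k.+1%:R.
  by exists (Num.truncn z); rewrite truncn_itv.
have kL : (k <= L)%N by rewrite -(ler_nat R) (le_trans kz)// ltW.
have -> : \sum_(l < L) (l.+1%:R <= z)%R%:R = k%:R :> R.
  rewrite -(subnKC kL) big_split_ord /= (eq_bigr (fun=> 1)) => [|i _].
    rewrite [X in _ + X]big1 => [|i _].
      by rewrite addr0 sumr_const card_ord.
    suff -> : ((k + i).+1%:R <= z) = false by [].
    by apply/negbTE; rewrite -ltNge (lt_le_trans zk)// ler_nat ltnS leq_addr.
  suff -> : (i.+1%:R <= z) = true by [].
  by apply: le_trans kz; rewrite ler_nat.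
rewrite ger0_norm ?subr_ge0//; move: zk; rewrite -natr1; lra.
Qed.

(** [Y] is a uniform limit of linear combinations of indicators of events that
    it determines, the averages of the indicators of {Y + K >= l / N}. *)
Lemma orthogonal_to_function (D Y : T -> R) : bounded_mfun D -> bounded_mfun Y ->
  (forall B : set R, measurable B -> Ex (fun w => D w * \1_(Y @^-1` B) w) = 0) ->
  Ex (fun w => D w * Y w) = 0.
Proof.
move=> bD bY H.
have [mD [C DC]] := bD; have [mY [K YK]] := bY.
have ED : Ex D = 0.
  have := H setT measurableT; rewrite preimage_setT indicT.
  by under eq_fun do rewrite mulr1.
have bYK : bounded_mfun (fun w => Y w + K).
  by apply: bounded_mfunD => //; exact: bounded_mfun_cst.
have EYK : Ex (fun w => D w * Y w) = Ex (fun w => D w * (Y w + K)).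
  under [in RHS]eq_fun do rewrite mulrDr (mulrC _ K).
  rewrite ExD ?ExZ ?ED ?mulr0 ?addr0//; first exact: bounded_mfunM.
  exact: bounded_mfunZ.
have C0 : 0 <= C := le_trans (normr_ge0 _) (DC point).
apply/eqP; rewrite -normr_eq0 eq_le normr_ge0 andbT.
apply/ler_addgt0Pr => e e0; rewrite add0r.
pose N := (Num.truncn (C / e)).+1.
have NC : C / e <= N%:R by rewrite ltW// /N truncnS_gt.
have N0 : (0 : R) < N%:R by rewrite ltr0n.
pose L := (Num.truncn (2 * K * N%:R)).+1.
pose B l : set R := [set y : R | l.+1%:R <= N%:R * (y + K)].
have mB l : measurable (B l).
  rewrite (_ : B l = `[l.+1%:R / N%:R - K, +oo[%classic)//.
  apply/seteqP; split => y; rewrite /B /= in_itv /= andbT.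
    by rewrite mulrC -ler_pdivrMr// lerBlDr.
  by rewrite lerBlDr ler_pdivrMr// mulrC.
pose YN w : R := N%:R^-1 * \sum_(l < L) \1_(Y @^-1` B l) w.
have mYB l : measurable (Y @^-1` B l) by rewrite -[X in measurable X]setTI; exact: mY.
have bI l : bounded_mfun (\1_(Y @^-1` B l) : T -> R) by exact: bounded_mfun_indic.
have bYN : bounded_mfun YN.
  by apply: bounded_mfunZ; apply: bounded_mfun_sum => l _; exact: bI.
have EYN : Ex (fun w => D w * YN w) = 0.
  rewrite /YN; under eq_fun do rewrite mulrCA mulr_sumr.
  rewrite ExZ; last first.
    by apply: bounded_mfun_sum => l _; apply: bounded_mfunM => //; exact: bI.
  rewrite Ex_sum => [|l _]; last by apply: bounded_mfunM => //; exact: bI.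
  by rewrite big1 ?mulr0// => l _; exact: H.
rewrite EYK -[X in `|X|]subr0 -EYN -ExB; [|exact: bounded_mfunM..].
have YNY w : `|Y w + K - YN w| <= N%:R^-1.
  have YK0 : 0 <= Y w + K by have := YK w; rewrite ler_norml => /andP[? ?]; lra.
  have YKL : N%:R * (Y w + K) < L%:R.
    apply: le_lt_trans (truncnS_gt _).
    rewrite mulrC; apply: ler_wpM2r; first exact: ltW.
    by have := YK w; rewrite ler_norml => /andP[? ?]; lra.
  have := count_below (mulr_ge0 (ltW N0) YK0) YKL.
  rewrite /YN => h.
  rewrite -(ler_pM2l N0) mulfV ?gt_eqF// -[X in X * `|_|](gtr0_norm N0) -normrM.
  rewrite mulrBr mulVKf ?gt_eqF//.
  rewrite (eq_bigr (fun l : 'I_L => (l.+1%:R <= N%:R * (Y w + K))%R%:R))// => l _.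
  by rewrite indicE /B; congr (nat_of_bool _)%:R; apply/idP/idP; rewrite inE.
apply: Ex_norm_le.
  by apply: bounded_mfunB; exact: bounded_mfunM.
move=> w; rewrite -mulrBr normrM.
apply: le_trans (ler_pM _ _ (DC w) (YNY w)) _ => //.
by rewrite ler_pdivrMr// mulrC -ler_pdivrMr.
Qed.

End Orthogonality.

(** * Independent copies *)

(** Over the n with x <= 2^n the terms are dominated by a geometric series whose
    first term is at most 1; dividing x by 2 shifts the series by one rank. *)
Lemma dyadic_sum_above (R : realFieldType) (x : R) (N : nat) : 0 <= x ->
  \sum_(n < N) (2 ^+ n)^-1 * x * (x <= 2 ^+ n)%R%:R <= 2.
Proof.
elim: N x => [|N IH] x x0; first by rewrite big_ord0.
have [x1|x1] := leP x 1.
  apply: (@le_trans _ _ (\sum_(n < N.+1) 2^-1 ^+ n)).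
    apply: ler_sum => n _; rewrite exprVn -mulrA; apply: ler_piMr.
      by rewrite invr_ge0 exprn_ge0.
    by case: (x <= _ ^+ _)%R; rewrite ?mulr1 ?mulr0.
  suff : \sum_(n < N.+1) 2^-1 ^+ n <= 2 - 2^-1 ^+ N :> R.
    by move=> /le_trans; apply; rewrite gerBl exprn_ge0// invr_ge0.
  elim: N {IH} => [|N IH]; first by rewrite big_ord1 expr0; lra.
  rewrite big_ord_recr /=; apply: le_trans (lerD IH (lexx _)) _.
  rewrite exprS; lra.
rewrite big_ord_recl /= expr0 (lt_geF x1) mulr0 add0r.
apply: le_trans (IH (x / 2) _); last by rewrite divr_ge0.
apply: ler_sum => n _; rewrite /bump /= add1n !exprS invfM.
rewrite (_ : (x / 2 <= 2 ^+ n) = (x <= 2 * 2 ^+ n)); last first.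
  by rewrite ler_pdivrMr// mulrC.
rewrite [X in _ <= X * _](_ : _ = 2^-1 / 2 ^+ n * x)//.
by rewrite [LHS]mulrCA [LHS]mulrC [X in X * _ = _]mulrC.
Qed.

Lemma dyadic_sum_below (R : realFieldType) (x : R) (N : nat) : 0 <= x ->
  \sum_(n < N) 2 ^+ n * (2 ^+ n < x)%R%:R <= 2 * x.
Proof.
move=> x0; suff : \sum_(n < N) 2 ^+ n * (2 ^+ n < x)%R%:R <= Num.max 0 (2 * x - 1).
  by move=> /le_trans; apply; rewrite ge_max mulr_ge0//= gerBl.
elim: N x x0 => [|N IH] x x0; first by rewrite big_ord0 le_max lexx.
rewrite big_ord_recl /= expr0 mul1r.
rewrite (eq_bigr (fun n : 'I_N => 2 * (2 ^+ n * (2 ^+ n < x / 2)%R%:R))); last first.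
  move=> n _; rewrite /bump /= add1n exprS -mulrA; congr (_ * (_ * _)).
  by rewrite ltr_pdivlMr// mulrC.
rewrite -mulr_sumr.
have := IH (x / 2) _; rewrite divr_ge0// => /(_ isT).
set S := \sum_(n < N) _ => hS.
have [x1|x1] := ltP 1 x.
  have : Num.max 0 (2 * (x / 2) - 1) <= x - 1.
    by rewrite ge_max; apply/andP; split; lra.
  move=> /(le_trans hS) hS'; rewrite le_max; apply/orP; right.
  rewrite mulr1n; lra.
rewrite add0r.
have -> : S = 0.
  rewrite /S big1// => n _.
  suff -> : (2 ^+ n < x / 2) = false by rewrite mulr0.
  apply/negbTE; rewrite -leNgt (@le_trans _ _ 1)//; first lra.
  by rewrite exprn_ege1// ler1n.
by rewrite mulr0 le_max lexx.
Qed.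

Section IndependentCopies.
Context (d : measure_display) (T : measurableType d) (R : realType).
Variables (P : probability T R) (X : {RV P >-> R}) (W : nat -> {RV P >-> R}).
Hypothesis iidW : iid_copies X W.
Local Notation Ex := (Rintegral P setT).

Lemma iid_copies_Ex (g : R -> R) i : bounded_mfun g ->
  Ex (fun w => g (W i w)) = Ex (fun w => g (X w)).
Proof.
move=> bg; have [mg _] := bg; rewrite /Rintegral; congr fine.
have iX Y : P.-integrable setT ((EFin \o g) \o (Y : {RV P >-> R})).
  by apply: (@bounded_mfun_integrable _ _ _ P (fun w => g (Y w))); exact: bounded_mfun_comp.
have mg' : measurable_fun setT (EFin \o g) by exact/measurable_EFinP.
have := integral_distribution mg' (iX (W i)); rewrite /= => <-.
have := integral_distribution mg' (iX X); rewrite /= => <-.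
by apply: eq_measure_integral => A mA _; exact: iidW.1.
Qed.

(** Pairwise independence is a statement on events; it passes to g(W i) and
    g(W j) one variable at a time. *)
Lemma iid_copies_orthogonal (g : R -> R) i j : bounded_mfun g -> i != j ->
  Ex (fun w => (g (W i w) - Ex (fun u => g (X u)))
               * (g (W j w) - Ex (fun u => g (X u)))) = 0.
Proof.
move=> bg ij; set c := Ex (fun u => g (X u)).
have bW k : bounded_mfun (fun w => g (W k w)) by exact: bounded_mfun_comp.
have bWc k : bounded_mfun (fun w => g (W k w) - c).
  by apply: bounded_mfunB => //; exact: bounded_mfun_cst.
have EWc k : Ex (fun w => g (W k w) - c) = 0.
  rewrite ExB//; last exact: bounded_mfun_cst.
  by rewrite Ex_cst iid_copies_Ex// subrr.
have mWB k B : measurable B -> measurable (W k @^-1` B).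
  by move=> mB; rewrite -[X in measurable X]setTI; exact: measurable_funP.
have indep k l B C : k != l -> measurable B -> measurable C ->
    Ex (fun w => (\1_(W k @^-1` B) w - fine (P (W k @^-1` B)))
                 * \1_(W l @^-1` C) w) = 0.
  move=> kl mB mC.
  have mWk := mWB k B mB; have mWl := mWB l C mC.
  have bIk : bounded_mfun (\1_(W k @^-1` B) : T -> R) by exact: bounded_mfun_indic.
  have bIl : bounded_mfun (\1_(W l @^-1` C) : T -> R) by exact: bounded_mfun_indic.
  under eq_fun do rewrite mulrBl.
  rewrite ExB; [|exact: bounded_mfunM|exact: bounded_mfunZ].
  rewrite ExZ// Ex_indic//.
  have -> : (fun w => \1_(W k @^-1` B) w * \1_(W l @^-1` C) w) =
            \1_(W k @^-1` B `&` W l @^-1` C) :> (T -> R).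
    by rewrite indicI.
  rewrite Ex_indic; last exact: measurableI.
  have klu : uniq [:: k; l] by rewrite /= inE kl.
  have mBC r : measurable (if r == k then B else C) by case: ifP.
  have := iidW.2 _ _ klu mBC.
  rewrite big_cons big_seq1 eqxx eq_sym (negbTE kl) => h.
  have -> : W k @^-1` B `&` W l @^-1` C = [set w | forall r, r \in [:: k; l] ->
      (if r == k then B else C) (W r w)].
    apply/seteqP; split => w /=.
      move=> [Bk Cl] r; rewrite !inE => /orP[/eqP ->|/eqP ->]; first by rewrite eqxx.
      by rewrite eq_sym (negbTE kl).
    move=> h'; split; first by have := h' k; rewrite inE eqxx; exact.
    by have := h' l; rewrite !inE eqxx orbT eq_sym (negbTE kl); exact.
  by rewrite h fineM ?fin_num_measure// subrr.
have preB k B : (fun w => g (W k w) - c) @^-1` B = W k @^-1` ((fun x => g x - c) @^-1` B).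
  by [].
have mgB B : measurable B -> measurable ((fun x => g x - c) @^-1` B).
  move=> mB; rewrite -[X in measurable X]setTI.
  by apply: (measurable_funB bg.1 (measurable_cst c)).
apply: orthogonal_to_function => // B mB; rewrite preB.
set C := _ @^-1` B; have mC : measurable C by exact: mgB.
set p := fine (P (W j @^-1` C)).
have bI : bounded_mfun (\1_(W j @^-1` C) : T -> R).
  by apply: bounded_mfun_indic; exact: mWB.
have bIp : bounded_mfun (fun w => \1_(W j @^-1` C) w - p).
  by apply: bounded_mfunB => //; exact: bounded_mfun_cst.
have : Ex (fun w => (\1_(W j @^-1` C) w - p) * (g (W i w) - c)) = 0.
  apply: orthogonal_to_function => // B' mB'; rewrite preB.
  by apply: indep; [rewrite eq_sym|exact: mC|exact: mgB].
under eq_fun do rewrite mulrBl.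
rewrite ExB; [|exact: bounded_mfunM|exact: bounded_mfunZ].
rewrite ExZ// EWc mulr0 subr0 => <-.
by under [in RHS]eq_fun do rewrite mulrC.
Qed.

End IndependentCopies.

(** * The strong law of large numbers *)

Section StrongLaw.
Context (d : measure_display) (T : measurableType d) (R : realType).
Variables (P : probability T R) (X : {RV P >-> R}) (W : nat -> {RV P >-> R}).
Hypothesis iidW : iid_copies X W.
Local Notation Ex := (Rintegral P setT).

Lemma bounded_strong_law (g : R -> R) : bounded_mfun g ->
  {ae P, forall w, sublinear
    (fun n => \sum_(i < n) g (W i w) - n%:R * Ex (fun u => g (X u)))}.
Proof.
move=> bg; set c := Ex _.
have [mg [K gK]] := bg.
have bW i : bounded_mfun (fun w => g (W i w) - c).
  by apply: bounded_mfunB; [exact: bounded_mfun_comp|exact: bounded_mfun_cst].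
have := @bounded_orthogonal_sublinear _ _ _ P (fun i w => g (W i w) - c) (K + `|c|)
  (fun i => (bW i).1).
have DK n w : `|g (W n w) - c| <= K + `|c|.
  by apply: le_trans (ler_normB _ _) _; rewrite lerD2r.
move=> /(_ DK) h; apply: filterS (h _) => [w|i j ij].
  move=> /sublinear_eq; apply => n.
  by rewrite mulr_natl sumrB sumr_const card_ord.
by apply: (iid_copies_orthogonal iidW bg); rewrite ltn_eqF.
Qed.

Section CrudeBound.
Variable h : R -> R.
Hypothesis mh : measurable_fun setT h.
Hypothesis h0 : forall x, 0 <= h x.
Hypothesis hX : P.-integrable setT (EFin \o (fun w => h (X w))).

Let c := Ex (fun w => h (X w)).
(* truncation at level 2^n, and the indicator of the values that it changes *)
Let t (n : nat) (x : R) : R := h x * (h x <= 2 ^+ n)%R%:R.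
Let s (n : nat) (x : R) : R := (2 ^+ n < h x)%R%:R.

Let bt n : bounded_mfun (t n).
Proof.
split; last first.
  exists (2 ^+ n) => x; rewrite /t; case: (boolP (h x <= 2 ^+ n)) => hx.
    by rewrite mulr1 ger0_norm.
  by rewrite mulr0 normr0 exprn_ge0.
apply: measurable_funM => //.
rewrite (_ : (fun x => _) = \1_(h @^-1` `]-oo, 2 ^+ n]%classic)).
  apply: measurable_indic; rewrite -[X in measurable X]setTI.
  by apply: mh => //; exact: measurable_itv.
apply/funext => x; rewrite indicE; congr (nat_of_bool _)%:R.
by apply/idP/idP; rewrite inE /= in_itv.
Qed.

Let bs n : bounded_mfun (s n).
Proof.
rewrite /s (_ : (fun x => _) = \1_(h @^-1` `]2 ^+ n, +oo[%classic)).
  apply: bounded_mfun_indic.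
  by rewrite -[X in measurable X]setTI; apply: mh => //; exact: measurable_itv.
apply/funext => x; rewrite indicE; congr (nat_of_bool _)%:R.
by apply/idP/idP; rewrite inE /= in_itv /= andbT.
Qed.

Let t0 n x : 0 <= t n x.
Proof. by rewrite /t mulr_ge0// ler0n. Qed.

Let Ex_le_c (f : R -> R) k : 0 <= k -> bounded_mfun f ->
  (forall x, f x <= k * h x) -> Ex (fun w => f (X w)) <= k * c.
Proof.
move=> k0 bf fh; rewrite -RintegralZl//; apply: le_Rintegral => //.
- by apply: (@bounded_mfun_integrable _ _ _ P (fun w => f (X w))); exact: bounded_mfun_comp.
- exact: (integrableZl measurableT k hX).
Qed.

(** Truncating at 2^n the 2^n first variables costs finitely many errors, and
    leaves variances small enough for the dyadic averages to converge. *)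
Lemma dyadic_mean_le :
  {ae P, forall w, forall e, 0 < e ->
    \forall n \near \oo, \sum_(i < 2 ^ n) h (W i w) <= 2 ^+ n * (c + e)}.
Proof.
pose D n i w := t n (W i w) - Ex (fun u => t n (X u)).
have bD n i : bounded_mfun (D n i).
  by apply: bounded_mfunB; [exact: bounded_mfun_comp|exact: bounded_mfun_cst].
pose g1 n w := ((\sum_(i < 2 ^ n) D n i w) / 2 ^+ n) ^+ 2.
pose g2 n w := \sum_(i < 2 ^ n) s n (W i w).
have bg1 n : bounded_mfun (g1 n).
  apply: bounded_mfunX; apply: bounded_mfunM; last exact: bounded_mfun_cst.
  by apply: bounded_mfun_sum => i _.
have bg2 n : bounded_mfun (g2 n).
  by apply: bounded_mfun_sum => i _; exact: bounded_mfun_comp.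
have btX n : bounded_mfun (fun u => t n (X u)) by exact: bounded_mfun_comp.
have Eg1 n : Ex (g1 n) <= (2 ^+ n)^-1 * Ex (fun u => t n (X u) ^+ 2).
  rewrite /g1; under eq_fun do rewrite exprMn mulrC.
  rewrite ExZ; last by apply: bounded_mfunX; apply: bounded_mfun_sum => i _.
  rewrite Ex_sqr_sum_orthogonal//; last first.
    by move=> i j ij; apply: (iid_copies_orthogonal iidW (bt n)); rewrite ltn_eqF.
  have : \sum_(i < 2 ^ n) Ex (fun w => D n i w ^+ 2) <=
      2 ^+ n * Ex (fun u => t n (X u) ^+ 2).
    rewrite -natrX -[n in n%:R * _]card_ord -sum1_card natr_sum mulr_suml.
    apply: ler_sum => i _; rewrite mul1r.
    have bt2 : bounded_mfun (fun x => t n x ^+ 2) by exact: bounded_mfunX.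
    rewrite -(iid_copies_Ex iidW i bt2).
    set e := Ex (fun u => t n (X u)).
    have -> : Ex (fun w => D n i w ^+ 2) =
        Ex (fun w => t n (W i w) ^+ 2) - e ^+ 2.
      have -> : (fun w => D n i w ^+ 2) =
          (fun w => (t n (W i w) ^+ 2 + e ^+ 2) - 2 * e * t n (W i w)).
        by apply/funext => w; rewrite /D -/e; ring.
      have btW : bounded_mfun (fun w => t n (W i w)) by exact: bounded_mfun_comp.
      have btW2 : bounded_mfun (fun w => t n (W i w) ^+ 2) by exact: bounded_mfunX.
      rewrite ExB; [|by apply: bounded_mfunD => //; exact: bounded_mfun_cst
                    |exact: bounded_mfunZ].
      rewrite ExD//; last exact: bounded_mfun_cst.
      by rewrite Ex_cst ExZ// (iid_copies_Ex iidW i (bt n)) -/e; ring.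
    by rewrite gerBl sqr_ge0.
  move=> hs; have p2 : (2 ^+ n : R) != 0 by rewrite expf_neq0// pnatr_eq0.
  apply: le_trans (ler_wpM2l (sqr_ge0 _) hs) _.
  by rewrite expr2 -mulrA mulKf.
have sum1 N : \sum_(n < N) Ex (g1 n) <= 2 * c.
  apply: le_trans (_ : \sum_(n < N) (2 ^+ n)^-1 * Ex (fun u => t n (X u) ^+ 2) <= _).
    exact: ler_sum.
  have bt2 n : bounded_mfun (fun x => (2 ^+ n)^-1 * t n x ^+ 2).
    by apply: bounded_mfunZ; exact: bounded_mfunX.
  rewrite (eq_bigr (fun n : 'I_N => Ex (fun u => (2 ^+ n)^-1 * t n (X u) ^+ 2))).
    rewrite -Ex_sum => [|n _]; last by apply: bounded_mfunZ; exact: bounded_mfunX.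
    apply: (Ex_le_c (f := fun x => \sum_(n < N) (2 ^+ n)^-1 * t n x ^+ 2)) => //.
      by apply: bounded_mfun_sum => n _.
    move=> x; rewrite mulrC; apply: le_trans (ler_wpM2l (h0 x) (dyadic_sum_above N (h0 x))).
    rewrite mulr_sumr; apply: ler_sum => n _; rewrite /t; case: (h x <= _)%R.
      by rewrite !mulr1 expr2 mulrCA.
    by rewrite !mulr0 expr0n /= mulr0.
  by move=> n _; rewrite ExZ//; exact: bounded_mfunX.
have sum2 N : \sum_(n < N) Ex (g2 n) <= 2 * c.
  rewrite (eq_bigr (fun n : 'I_N => Ex (fun u => 2 ^+ n * s n (X u)))); last first.
    move=> n _; rewrite /g2 Ex_sum => [|i _]; last exact: bounded_mfun_comp.
    rewrite ExZ; last exact: bounded_mfun_comp.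
    rewrite (eq_bigr (fun=> Ex (fun u => s n (X u)))).
      by rewrite sumr_const card_ord -[LHS]mulr_natl natrX.
    by move=> i _; rewrite (iid_copies_Ex iidW i (bs n)).
  rewrite -Ex_sum => [|n _]; last by apply: bounded_mfunZ; exact: bounded_mfun_comp.
  apply: (Ex_le_c (f := fun x => \sum_(n < N) 2 ^+ n * s n x)) => //.
    by apply: bounded_mfun_sum => n _; exact: bounded_mfunZ.
  by move=> x; exact: dyadic_sum_below.
have g10 n w : 0 <= g1 n w by exact: sqr_ge0.
have g20 n w : 0 <= g2 n w by apply: sumr_ge0 => i _; rewrite ler0n.
have := ae_cvg0_summable bg2 g20 sum2.
have := ae_cvg0_summable bg1 g10 sum1.
apply: filterS2 => w /cvgrPdist_le g1w /cvgrPdist_le g2w e e0.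
have e20 : 0 < e ^+ 2 by rewrite exprn_gt0.
near=> n.
have p2 : (0 : R) < 2 ^+ n by rewrite exprn_gt0.
have hb : forall i : 'I_(2 ^ n), h (W i w) <= 2 ^+ n.
  move=> i; rewrite leNgt; apply/negP => hi.
  have : `|0 - g2 n w| <= 2^-1 by near: n; exact: g2w.
  rewrite sub0r normrN ger0_norm// /g2 (bigD1 i)//= {1}/s hi.
  apply/negP; rewrite -ltNge; apply: (@lt_le_trans _ _ 1); first lra.
  by rewrite lerDl; apply: sumr_ge0 => j _; rewrite ler0n.
have : `|0 - g1 n w| <= e ^+ 2 by near: n; exact: g1w.
rewrite sub0r normrN ger0_norm// /g1 -real_normK ?num_real//.
rewrite ler_pXn2r// ?nnegrE ?(ltW e0)// => hg.
rewrite (eq_bigr (fun i : 'I_(2 ^ n) => t n (W i w))); last first.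
  by move=> i _; rewrite /t hb mulr1.
have := le_trans (ler_norm _) hg; rewrite ler_pdivrMr// /D.
rewrite sumrB sumr_const card_ord -[Ex _ *+ _]mulr_natl natrX lerBlDr mulrC => /le_trans; apply.
rewrite -mulrDr ler_pM2l// addrC lerD2r -[leRHS]mul1r.
apply: Ex_le_c => // x; rewrite mul1r /t; case: (h x <= _)%R; by rewrite ?mulr1 ?mulr0.
Unshelve. all: by end_near. Qed.

(** A block of indices between two powers of 2 is filled up to the larger one,
    which costs the factor 2. *)
Lemma mean_crude_bound :
  {ae P, forall w, forall e, 0 < e ->
    \forall n \near \oo, \sum_(i < n) h (W i w) <= n%:R * (2 * (c + e))}.
Proof.
apply: filterS dyadic_mean_le => w hw e e0.
have [N _ HN] := hw _ e0.
exists (2 ^ N)%N => // n /= Nn.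
have n0 : (0 < n)%N by apply: leq_trans Nn; rewrite expn_gt0.
pose k := trunc_log 2 n.
have /andP[kn nk] : (2 ^ k <= n < 2 ^ k.+1)%N by exact: trunc_log_bounds.
have Nk : (N <= k.+1)%N.
  by rewrite -(@leq_exp2l 2)//; apply: leq_trans Nn (ltnW nk).
have := HN k.+1 Nk; rewrite /= => hk.
apply: (@le_trans _ _ (\sum_(i < 2 ^ k.+1) h (W i w))).
  rewrite -(subnKC (ltnW nk)) big_split_ord /= lerDl.
  by apply: sumr_ge0 => i _.
apply: le_trans hk _; rewrite mulrA; apply: ler_wpM2r.
  by rewrite addr_ge0 ?(ltW e0)//; apply: Ex_ge0.
by rewrite exprSr ler_wpM2r// -natrX ler_nat.
Qed.

End CrudeBound.

Hypothesis X0 : forall w, 0 <= X w.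
Hypothesis EX : ('E_P[X] < +oo)%E.

Lemma expectation_integrable : P.-integrable setT (EFin \o X).
Proof.
apply/integrableP; split; first by apply/measurable_EFinP; exact: measurable_funP.
move: EX; rewrite expectation_def; apply: le_lt_trans.
by rewrite le_eqVlt; apply/orP; left; apply/eqP; apply: eq_integral => w _ /=; rewrite ger0_norm.
Qed.

Let mu := fine 'E_P[X].

Lemma expectation_Ex : mu = Ex X.
Proof. by rewrite /mu expectation_def. Qed.

Lemma bounded_mfun_truncation (M : R) : bounded_mfun (fun x : R => Num.min (Num.max 0 x) M).
Proof.
split.
  apply: measurable_minr; last exact: measurable_cst.
  by apply: measurable_maxr; [exact: measurable_cst|exact: measurable_id].
exists `|M| => x; rewrite /Num.min; case: ifPn => h; last by [].
by rewrite ger0_norm ?le_max ?lexx// (le_trans (ltW h))// ler_norm.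
Qed.

Lemma truncated_mean_cvg e : 0 < e ->
  exists M : R, mu - Ex (fun w => Num.min (Num.max 0 (X w)) M) <= e.
Proof.
move=> e0.
have mX : measurable_fun setT X by exact: measurable_funP.
have := @dominated_cvg _ _ _ P setT measurableT
  (fun n w => (Num.min (Num.max 0 (X w)) n%:R)%:E) (EFin \o X) (EFin \o X).
have h1 (n : nat) : measurable_fun setT (fun w => (Num.min (Num.max 0 (X w)) n%:R)%:E).
  apply/measurable_EFinP.
  by apply: (bounded_mfun_comp mX (bounded_mfun_truncation n%:R)).1.
have h2 w : setT w -> (fun n => (Num.min (Num.max 0 (X w)) n%:R)%:E) @ \oo --> (EFin \o X) w.
  move=> _; apply: cvg_near_cst; near=> n.
  rewrite /= (max_idPr (X0 w)) min_l//; near: n; exact: nbhs_infty_ger.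
have h3 w : setT w -> (EFin \o X) w \is a fin_num by [].
have h4 (n : nat) w : setT w -> (`|(Num.min (Num.max 0 (X w)) n%:R)%:E| <= (EFin \o X) w)%E.
  by move=> _ /=; rewrite (max_idPr (X0 w)) lee_fin ger0_norm ?le_min ?X0//= ge_min lexx.
have muE : (\int[P]_w (EFin \o X) w = mu%:E)%E.
  rewrite /mu expectation_def fineK//.
  exact: (integrable_fin_num measurableT expectation_integrable).
move=> /(_ h1 h2 h3 expectation_integrable h4); rewrite muE => /fine_cvgP [_].
move=> /cvgrPdist_le /(_ _ e0) [n _ /(_ n (leqnn n))].
by move=> /(le_trans (ler_norm _)) hn; exists n%:R.
Unshelve. all: by end_near. Qed.

(** Truncation at a fixed level handles all but an arbitrarily small mean, for
    which losing a factor 2 does not matter. *)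
Theorem strong_law (W0 : forall i w, 0 <= W i w) :
  {ae P, forall w, sublinear (fun n => \sum_(i < n) W i w - n%:R * mu)}.
Proof.
pose r M (x : R) := Num.max 0 x - Num.min (Num.max 0 x) M.
have mr M : measurable_fun setT (r M).
  apply: measurable_funB; last by case: (bounded_mfun_truncation M).
  by apply: measurable_maxr; [exact: measurable_cst|exact: measurable_id].
have r0 M x : 0 <= r M x by rewrite /r subr_ge0 ge_min lexx.
have mX : measurable_fun setT X by exact: measurable_funP.
have btX M : bounded_mfun (fun w => Num.min (Num.max 0 (X w)) M).
  exact: bounded_mfun_comp mX (bounded_mfun_truncation M).
have rXE M : (fun w => r M (X w)) = (fun w => X w - Num.min (Num.max 0 (X w)) M).
  by apply/funext => w; rewrite /r (max_idPr (X0 w)).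
have rX M : P.-integrable setT (EFin \o (fun w => r M (X w))).
  rewrite rXE (_ : _ \o _ = ((EFin \o X) \-
    (EFin \o (fun w => Num.min (Num.max 0%R (X w)) M)))%E)//.
  by apply: integrableB => //; [exact: expectation_integrable|exact: bounded_mfun_integrable].
have ErX M : Ex (fun w => r M (X w)) = mu - Ex (fun w => Num.min (Num.max 0 (X w)) M).
  rewrite rXE RintegralB ?expectation_Ex//; first exact: expectation_integrable.
  exact: bounded_mfun_integrable.
have aek (k : nat) : {ae P, forall w, \forall n \near \oo,
    `|\sum_(i < n) W i w - n%:R * mu| <= n%:R * k.+1%:R^-1}.
  (* 2 dl + 2 dl from the crude bound, dl from the truncated averages and dl
     from the truncated mean add up to 6 dl *)
  pose dl : R := k.+1%:R^-1 / 6.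
  have k0 : (0 : R) < k.+1%:R^-1 by rewrite invr_gt0 ltr0n.
  have dl0 : 0 < dl by rewrite /dl divr_gt0.
  have [M HM] := truncated_mean_cvg dl0.
  have := mean_crude_bound (mr M) (r0 M) (rX M).
  have := bounded_strong_law (bounded_mfun_truncation M).
  apply: filterS2 => w /sublinearP /(_ _ dl0) h1 /(_ _ dl0) h2.
  move: h1 h2; apply: filterS2 => n; rewrite ErX.
  set m := Ex _ in HM *; set S := \sum_(i < n) W i w => h1.
  set S1 := \sum_(i < n) Num.min _ _ in h1 *.
  have -> : \sum_(i < n) r M (W i w) = S - S1.
    rewrite /S /S1 -sumrB; apply: eq_bigr => i _.
    by rewrite /r (max_idPr (W0 i w)).
  move=> h2.
  have SS1 : 0 <= S - S1.
    rewrite /S /S1 -sumrB; apply: sumr_ge0 => i _.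
    by rewrite (max_idPr (W0 i w)) subr_ge0 ge_min lexx.
  have m0 : 0 <= mu - m by rewrite -ErX; apply: Ex_ge0.
  have n0 : (0 : R) <= n%:R by [].
  have h3 : n%:R * (2 * (mu - m + dl)) <= n%:R * (4 * dl) by rewrite ler_wpM2l//; lra.
  have h4 : n%:R * (mu - m) <= n%:R * dl by rewrite ler_wpM2l.
  have h5 : 0 <= n%:R * (mu - m) by rewrite mulr_ge0.
  have -> : k.+1%:R^-1 = 6 * dl by rewrite /dl mulrC mulfVK// pnatr_eq0.
  move: h1; rewrite !ler_norml => /andP[h1 h1'].
  by apply/andP; split; nra.
have := ae_foralln aek; apply: filterS => w hw; apply/sublinearP => e e0.
have [k _ /(_ k (leqnn k)) hk] := nbhs_infty_ger e^-1.
apply: filterS (hw k) => n /le_trans; apply; rewrite mulrC ler_wpM2r//.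
rewrite invf_ple ?posrE// (le_trans hk)// ler_nat//.
Qed.

End StrongLaw.

(** * Conditional expectations given the graph *)

Section Marginals.
Variables (R : realType) (m n : nat) (p : 'I_n -> R).

(** The m half-edges choose independently with the weights p: sums over all
    choices factor over the half-edges. *)
Lemma sum_choices_prod (G : 'I_m -> 'I_n -> R) :
  \sum_(t : {ffun 'I_m -> 'I_n}) (\prod_(j < m) p (t j)) * \prod_(j < m) G j (t j)
  = \prod_(j < m) \sum_(i < n) p i * G j i.
Proof.
rewrite bigA_distr_bigA /=; apply: eq_bigr => t _.
by rewrite -big_split.
Qed.

Lemma sum_choices : \sum_(t : {ffun 'I_m -> 'I_n}) (\prod_(j < m) p (t j))
  = (\sum_(i < n) p i) ^+ m.
Proof. by rewrite -(bigA_distr_bigA (fun=> p)) prodr_const card_ord. Qed.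

Hypothesis p1 : \sum_(i < n) p i = 1.

Lemma sum_choices_one (g : 'I_n -> R) (j : 'I_m) :
  \sum_(t : {ffun 'I_m -> 'I_n}) (\prod_(l < m) p (t l)) * g (t j)
  = \sum_(i < n) p i * g i.
Proof.
rewrite (eq_bigr (fun t : {ffun 'I_m -> 'I_n} => (\prod_(l < m) p (t l)) *
    \prod_(l < m) (if l == j then g (t l) else 1))); last first.
  by move=> t _; rewrite -big_mkcond big_pred1_eq.
rewrite (sum_choices_prod (fun l x => if l == j then g x else 1)) (bigD1 j)//= eqxx.
rewrite [X in _ * X]big1 ?mulr1// => l lj.
by rewrite (negbTE lj) -[RHS]p1; apply: eq_bigr => i _; rewrite mulr1.
Qed.

Lemma sum_choices_two (g : 'I_n -> R) (j k : 'I_m) : j != k ->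
  \sum_(t : {ffun 'I_m -> 'I_n}) (\prod_(l < m) p (t l)) *
    (g (t j) * (t j == t k)%:R)
  = \sum_(i < n) p i ^+ 2 * g i.
Proof.
move=> jk.
rewrite (eq_bigr (fun t : {ffun 'I_m -> 'I_n} => \sum_(i < n) g i * ((\prod_(l < m) p (t l)) *
    \prod_(l < m) (if (l == j) || (l == k) then (t l == i)%:R else 1)))); last first.
  move=> t _; rewrite (bigD1 (t j))//= [X in _ + X]big1 => [|i itj].
    rewrite addr0 mulrCA; congr (_ * (_ * _)).
    rewrite (bigD1 j)//= eqxx /= eqxx mul1r (bigD1 k)/= ?(eq_sym k)//.
    rewrite eqxx orbT eq_sym big1 ?mulr1// => l /andP[lj lk].
    by rewrite (negbTE lj) (negbTE lk).
  by rewrite [X in _ * (_ * X)](bigD1 j)//= eqxx /= eq_sym (negbTE itj) mul0r !mulr0.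
rewrite exchange_big /=; apply: eq_bigr => i _.
rewrite -mulr_sumr mulrC; congr (_ * _).
rewrite (sum_choices_prod (fun l x => if (l == j) || (l == k) then (x == i)%:R else 1)).
have pi : \sum_(x < n) p x * (x == i)%:R = p i.
  rewrite (bigD1 i)//= eqxx mulr1 big1 ?addr0// => x xi.
  by rewrite (negbTE xi) mulr0.
rewrite (bigD1 j)//= eqxx /= pi (bigD1 k)/= ?(eq_sym k)// eqxx orbT pi mulrA expr2.
rewrite big1 ?mulr1// => l /andP[lj lk]; rewrite (negbTE lj) (negbTE lk) /=.
by rewrite -[RHS]p1; apply: eq_bigr => x _; rewrite mulr1.
Qed.

End Marginals.

Section GraphMartingale.
Context (d : measure_display) (T : measurableType d) (R : realType).
Variables (P : probability T R) (m : nat) (X : {RV P >-> R}).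
Variables (W : nat -> {RV P >-> R}) (V : nat -> 'I_m -> {RV P >-> nat}).
Hypothesis G_wrg : weighted_recursive_graph X W V.
Local Notation Ex := (Rintegral P setT).

Definition graph_generators (n : nat) : set (set T) :=
  [set A | (exists (i : nat) (B : set R),
                  [/\ (i < n)%N, measurable B & A = W i @^-1` B])
            \/ (exists (i : nat) (j : 'I_m) (B : set nat),
                  (0 < i < n)%N /\ A = V i j @^-1` B)].

(** Measurability for the sigma-algebra of G_n and its weights, phrased through
    the generated measurable structure so that measurability lemmas apply. *)
Definition graph_measurable (n : nat) (f : T -> R) :=
  measurable_fun [set: g_sigma_algebraType (graph_generators n)]
    (f : g_sigma_algebraType (graph_generators n) -> R).

Lemma graph_measurableE n f : graph_measurable n f <->
  forall B : set R, measurable B -> graph_events W V n (f @^-1` B).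
Proof.
split=> [mf B mB|h _ B mB]; last by rewrite setTI; exact: h.
by have := mf measurableT B mB; rewrite setTI.
Qed.

Lemma graph_events_measurable n A : graph_events W V n A -> measurable A.
Proof.
apply: smallest_sub; first exact: sigma_algebra_measurable.
move=> B [[i [C [_ mC ->]]]|[i [j [C [_ ->]]]]].
  by rewrite -[X in measurable X]setTI; exact: measurable_funP.
by rewrite -[X in measurable X]setTI; exact: measurable_funP.
Qed.

Lemma graph_events_le n n' : (n <= n')%N ->
  graph_events W V n `<=` graph_events W V n'.
Proof.
move=> nn'; apply: sub_sigma_algebra2 => B.
move=> [[i [C [ni mC ->]]]|[i [j [C [/andP[i0 ni] ->]]]]].
  by left; exists i, C; split => //; exact: leq_trans ni nn'.
by right; exists i, j, C; rewrite i0 (leq_trans ni nn').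
Qed.

Lemma graph_measurable_measurable n f : graph_measurable n f -> measurable_fun setT f.
Proof.
move=> /graph_measurableE mf _ B mB; rewrite setTI.
exact: graph_events_measurable (mf B mB).
Qed.

Lemma graph_measurable_le n n' f : (n <= n')%N ->
  graph_measurable n f -> graph_measurable n' f.
Proof.
move=> nn' /graph_measurableE mf; apply/graph_measurableE => B mB.
exact: graph_events_le nn' _ (mf B mB).
Qed.

Lemma graph_measurable_weight n i : (i < n)%N -> graph_measurable n (W i).
Proof.
move=> ni; apply/graph_measurableE => B mB.
by apply: sub_sigma_algebra; left; exists i, B.
Qed.

Lemma graph_measurable_edge n i j k : (0 < i < n)%N ->
  graph_measurable n (fun w => (V i j w == k)%:R).
Proof.
move=> ni.
have mA : @measurable _ (g_sigma_algebraType (graph_generators n)) [set w | V i j w = k].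
  apply: sub_sigma_algebra; right; exists i, j, [set k]; split => //.
rewrite /graph_measurable (_ : (fun w => _) = \1_[set w | V i j w = k]).
  exact: measurable_indic.
by apply/funext => w; rewrite indicE; congr (nat_of_bool _)%:R; apply/eqP/idP; rewrite inE.
Qed.

Lemma graph_measurable_sum n (I : Type) (r : seq I) (Q : pred I) (f : I -> T -> R) :
  (forall i, Q i -> graph_measurable n (f i)) ->
  graph_measurable n (fun w => \sum_(i <- r | Q i) f i w).
Proof.
move=> mf; elim: r => [|i r IH].
  by rewrite /graph_measurable; under eq_fun do rewrite big_nil; exact: measurable_cst.
rewrite /graph_measurable; under eq_fun do rewrite big_cons.
case: (boolP (Q i)) => Qi //; apply: measurable_funD => //; exact: mf.
Qed.

Lemma graph_measurable_prod n (I : Type) (r : seq I) (f : I -> T -> R) :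
  (forall i, graph_measurable n (f i)) ->
  graph_measurable n (fun w => \prod_(i <- r) f i w).
Proof.
move=> mf; elim: r => [|i r IH].
  by rewrite /graph_measurable; under eq_fun do rewrite big_nil; exact: measurable_cst.
rewrite /graph_measurable; under eq_fun do rewrite big_cons.
by apply: measurable_funM => //; exact: mf.
Qed.

Lemma graph_measurableM n (f g : T -> R) : graph_measurable n f ->
  graph_measurable n g -> graph_measurable n (fun w => f w * g w).
Proof. exact: measurable_funM. Qed.

Lemma graph_measurableB n (f g : T -> R) : graph_measurable n f ->
  graph_measurable n g -> graph_measurable n (fun w => f w - g w).
Proof. exact: measurable_funB. Qed.

Lemma graph_measurable_indegree n i k :
  graph_measurable n (fun w => (indegree V n i w == k)%:R).
Proof.
have mZ : graph_measurable n (fun w => (indegree V n i w)%:R).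
  rewrite /indegree; under eq_fun do rewrite natr_sum big_nat_cond.
  apply: graph_measurable_sum => l; rewrite andbT => ln.
  under eq_fun do rewrite natr_sum.
  by apply: graph_measurable_sum => j _; exact: graph_measurable_edge.
have mA : @measurable _ (g_sigma_algebraType (graph_generators n)) [set w | indegree V n i w = k].
  have /graph_measurableE := mZ => /(_ [set k%:R] (measurable_set1 _)).
  congr (graph_events _ _ _ _); apply/seteqP; split => w /= => [|->//].
  by move/eqP; rewrite eqr_nat => /eqP.
rewrite /graph_measurable (_ : (fun w => _) = \1_[set w | indegree V n i w = k]).
  exact: measurable_indic.
by apply/funext => w; rewrite indicE; congr (nat_of_bool _)%:R; apply/eqP/idP; rewrite inE.
Qed.

Definition choice_prob n (t : {ffun 'I_m -> 'I_n}) (w : T) : R :=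
  \prod_(j < m) (W (t j) w / total_weight W n w).

Lemma weight_ratio_ge0 n i w : 0 <= W i w / total_weight W n w.
Proof.
rewrite divr_ge0 ?(wrg_weight_ge0 G_wrg)//; apply: sumr_ge0 => l _.
exact: (wrg_weight_ge0 G_wrg).
Qed.

Lemma sum_weight_ratio n w : 0 < total_weight W n w ->
  \sum_(i < n) W i w / total_weight W n w = 1.
Proof.
by move=> S0; rewrite -mulr_suml -/(total_weight W n w) mulfV// gt_eqF.
Qed.

Lemma sum_weight_ratio_le1 n w : \sum_(i < n) W i w / total_weight W n w <= 1.
Proof.
rewrite -mulr_suml -/(total_weight W n w).
by have [->|S0] := eqVneq (total_weight W n w) 0; rewrite ?mul0r ?mulfV.
Qed.

Lemma choice_prob_ge0 n t w : 0 <= @choice_prob n t w.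
Proof. by apply: prodr_ge0 => j _; exact: weight_ratio_ge0. Qed.

Lemma sum_choice_prob_le1 n w : \sum_t @choice_prob n t w <= 1.
Proof.
rewrite (sum_choices m (fun i => W i w / total_weight W n w)).
by rewrite exprn_ile1 ?sum_weight_ratio_le1// sumr_ge0// => i _; exact: weight_ratio_ge0.
Qed.

Lemma choice_prob_le1 n t w : @choice_prob n t w <= 1.
Proof.
apply: le_trans (sum_choice_prob_le1 n w).
by rewrite (bigD1 t)//= lerDl; apply: sumr_ge0 => s _; exact: choice_prob_ge0.
Qed.

Lemma graph_measurable_total_weight n : graph_measurable n (total_weight W n).
Proof. by apply: graph_measurable_sum => i _; exact: graph_measurable_weight. Qed.

Lemma graph_measurable_choice_prob n t : graph_measurable n (@choice_prob n t).
Proof.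
apply: graph_measurable_prod => j; apply: measurable_funM.
  exact: graph_measurable_weight.
have mS := @graph_measurable_total_weight n.
(* the inverse of a non-negative real is the power of exponent -1 *)
rewrite (_ : (fun w => _) = fun w => total_weight W n w `^ (-1)).
  apply: (measurableT_comp (@measurable_powR _ (-1))); exact: mS.
apply/funext => w; rewrite powR_inv1//; apply: sumr_ge0 => l _.
exact: (wrg_weight_ge0 G_wrg).
Qed.

Definition chosen n (t : {ffun 'I_m -> 'I_n}) (w : T) : R := [forall j, V n j w == t j :> nat]%:R.

(** The conditional expectation given G_n of a function phi n of G_n and of the
    targets of the half-edges of vertex n. *)
Definition edge_mean (phi : nat -> ('I_m -> nat) -> T -> R) (n : nat) (w : T) : R :=
  \sum_(t : {ffun 'I_m -> 'I_n}) choice_prob t w * phi n (fun j => t j : nat) w.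

(** The martingale difference that goes with [edge_mean]; vertex 0 has no
    half-edges. *)
Definition edge_noise (phi : nat -> ('I_m -> nat) -> T -> R) (n : nat) (w : T) : R :=
  if n == 0%N then 0 else phi n (fun j => V n j w) w - edge_mean phi n w.

Lemma edge_noiseE phi n w : (0 < n)%N -> edge_noise phi n w =
  \sum_(t : {ffun 'I_m -> 'I_n}) phi n (fun j => t j : nat) w * (chosen t w - choice_prob t w).
Proof.
move=> n0; rewrite /edge_noise gtn_eqF// /edge_mean.
pose tV : {ffun 'I_m -> 'I_n} := [ffun j => Ordinal (wrg_target G_wrg j w n0)].
under [RHS]eq_bigr do rewrite mulrBr.
rewrite sumrB; congr (_ - _); last by apply: eq_bigr => t _; rewrite mulrC.
rewrite (bigD1 tV)//= [X in _ + X]big1 ?addr0 => [|t ttV].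
  have -> : chosen tV w = 1.
    by rewrite /chosen (_ : [forall _, _] = true)//; apply/forallP => j; rewrite ffunE.
  by rewrite mulr1; congr (phi n _ w); apply/funext => j; rewrite ffunE.
rewrite /chosen (_ : [forall _, _] = false) ?mulr0//.
apply/negbTE/negP => /forallP h; case/eqP: ttV; apply/ffunP => j.
by apply/val_inj; rewrite ffunE /= (eqP (h j)).
Qed.

Lemma chosen_event n (t : {ffun 'I_m -> 'I_n}) :
  @chosen n t = \1_[set w | forall j, V n j w = t j] :> (T -> R).
Proof.
apply/funext => w; rewrite indicE; congr (nat_of_bool _)%:R.
apply/forallP/idP => [h|]; first by rewrite inE /= => j; exact/eqP.
by rewrite inE /= => h j; apply/eqP.
Qed.

Lemma graph_measurable_chosen n t : (0 < n)%N -> graph_measurable n.+1 (@chosen n t).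
Proof.
move=> n0.
have -> : @chosen n t = (fun w => \prod_(j < m) (V n j w == t j :> nat)%:R).
  apply/funext => w; rewrite /chosen.
  have [/forallP h|/forallPn [j hj]] := boolP [forall j, V n j w == t j :> nat].
    by rewrite big1// => j _; rewrite h.
  by rewrite (bigD1 j)//= (negbTE hj) mul0r.
apply: graph_measurable_prod => j; apply: graph_measurable_edge.
by rewrite n0 ltnSn.
Qed.

(** This is the defining property of the conditional probabilities, extended
    from events to bounded functions. *)
Lemma chosen_orthogonal n t Y : (0 < n)%N -> graph_measurable n Y -> bounded_mfun Y ->
  Ex (fun w => (@chosen n t w - choice_prob t w) * Y w) = 0.
Proof.
move=> n0 /graph_measurableE mY bY.
have bc : bounded_mfun (@chosen n t).
  split; first exact: graph_measurable_measurable (graph_measurable_chosen t n0).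
  by exists 1 => w; rewrite /chosen; case: [forall _, _]; rewrite ?normr1 ?normr0.
have bp : bounded_mfun (@choice_prob n t).
  split; first exact: graph_measurable_measurable (graph_measurable_choice_prob t).
  by exists 1 => w; rewrite ger0_norm ?choice_prob_ge0 ?choice_prob_le1.
apply: orthogonal_to_function => //; first exact: bounded_mfunB.
move=> B /mY FA; have mA := graph_events_measurable FA; set A := Y @^-1` B in FA mA *.
have bA : bounded_mfun (\1_A : T -> R) by exact: bounded_mfun_indic.
under eq_fun do rewrite mulrBl.
rewrite ExB; [|exact: bounded_mfunM|exact: bounded_mfunM].
have [_ _ /(_ A FA)] := wrg_half_edges G_wrg t n0.
rewrite setIC.
set C := [set w | forall j, V n j w = t j].
have -> : (fun w => chosen t w * \1_A w) = \1_(C `&` A) :> (T -> R).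
  by rewrite chosen_event indicI.
have mC : measurable C.
  have /graph_measurableE/(_ [set 1] (measurable_set1 _)) := graph_measurable_chosen t n0.
  move/graph_events_measurable; congr measurable; apply/seteqP; split => w /=.
    rewrite /chosen; case: (boolP [forall _, _]) => [/forallP h _ j|_ /eqP].
      exact/eqP.
    by rewrite eq_sym oner_eq0.
  by move=> h; rewrite /chosen (_ : [forall _, _] = true)//; apply/forallP => j; apply/eqP.
rewrite Ex_indic; last exact: measurableI.
move=> ->; apply/eqP; rewrite subr_eq0; apply/eqP.
rewrite -/(Rintegral P A (@choice_prob n t)) Rintegral_mkcond; congr Ex.
apply/funext => w; rewrite patchE indicE; case: ifPn => _; by rewrite ?mulr1 ?mulr0.
Qed.

Section Noise.
Variables (phi : nat -> ('I_m -> nat) -> T -> R) (K : R).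
Hypothesis mphi : forall n s, (0 < n)%N -> (forall j, s j < n)%N ->
  graph_measurable n (phi n s).
Hypothesis phiK : forall n s w, `|phi n s w| <= K.

Let K0 : 0 <= K := le_trans (normr_ge0 _) (phiK 0 (fun=> 0%N) point).

Lemma edge_mean_le n w : `|edge_mean phi n w| <= K.
Proof.
apply: le_trans (ler_norm_sum _ _ _) _.
apply: (@le_trans _ _ (\sum_(t : {ffun 'I_m -> 'I_n}) choice_prob t w * K)).
  apply: ler_sum => t _; rewrite normrM (ger0_norm (choice_prob_ge0 _ _)).
  by rewrite ler_wpM2l// choice_prob_ge0.
by rewrite -mulr_suml ler_piMl// sum_choice_prob_le1.
Qed.

Lemma edge_noise_le n w : `|edge_noise phi n w| <= K + K.
Proof.
rewrite /edge_noise; case: ifP => _; first by rewrite normr0 addr_ge0.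
by apply: le_trans (ler_normB _ _) _; rewrite lerD// edge_mean_le.
Qed.

Lemma graph_measurable_edge_noise n : graph_measurable n.+1 (edge_noise phi n).
Proof.
have [->|n0] := posnP n; first exact: measurable_cst.
rewrite /graph_measurable (_ : edge_noise phi n = fun w => \sum_(t : {ffun 'I_m -> 'I_n})
    phi n (fun j => t j : nat) w * (chosen t w - choice_prob t w)); last first.
  by apply/funext => w; rewrite edge_noiseE.
apply: graph_measurable_sum => t _; apply: graph_measurableM.
  by apply: (@graph_measurable_le n) => //; exact: mphi.
apply: graph_measurableB; first exact: graph_measurable_chosen.
by apply: (@graph_measurable_le n) => //; exact: graph_measurable_choice_prob.
Qed.

(** The deviation is the sum over all choices t of phi n t, which is known given
    G_n, times the deviation of the indicator of the choice t. *)
Lemma edge_noise_orthogonal n Y : graph_measurable n Y -> bounded_mfun Y ->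
  Ex (fun w => Y w * edge_noise phi n w) = 0.
Proof.
have [->|n0] := posnP n.
  move=> _ _; rewrite /edge_noise eqxx; under eq_fun do rewrite mulr0.
  by rewrite Ex_cst.
move=> mY bY; under eq_fun do rewrite edge_noiseE// mulr_sumr.
have bYphi (t : {ffun 'I_m -> 'I_n}) : bounded_mfun (fun w => Y w * phi n (fun j => t j : nat) w).
  apply: bounded_mfunM => //; split; last by exists K.
  by apply: graph_measurable_measurable; exact: mphi.
have bct (t : {ffun 'I_m -> 'I_n}) : bounded_mfun (fun w => chosen t w - choice_prob t w).
  split; last first.
    exists 1 => w; have := choice_prob_ge0 t w; have := choice_prob_le1 t w.
    rewrite /chosen; case: [forall _, _]; rewrite ?sub0r ?normrN => h1 h0.
      by rewrite ger0_norm ?subr_ge0// gerBl.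
    by rewrite ger0_norm.
  apply: (@graph_measurable_measurable n.+1).
  apply: graph_measurableB; first exact: graph_measurable_chosen.
  by apply: (@graph_measurable_le n) => //; exact: graph_measurable_choice_prob.
rewrite Ex_sum => [|t _]; last first.
  by under eq_fun do rewrite mulrA; exact: bounded_mfunM.
rewrite big1// => t _; under eq_fun do rewrite mulrA mulrC.
apply: chosen_orthogonal => //; apply: graph_measurableM => //; exact: mphi.
Qed.

Lemma edge_noise_sublinear :
  {ae P, forall w, sublinear (fun n => \sum_(i < n) edge_noise phi i w)}.
Proof.
have mn n : measurable_fun setT (edge_noise phi n).
  exact: graph_measurable_measurable (@graph_measurable_edge_noise n).
apply: (bounded_orthogonal_sublinear (K := K + K)) => // [n w|i j ij].
  exact: edge_noise_le.
apply: edge_noise_orthogonal; last by split => //; exists (K + K) => w; exact: edge_noise_le.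
exact: graph_measurable_le ij (@graph_measurable_edge_noise i).
Qed.

End Noise.

End GraphMartingale.

(** * Sums over the vertices of a given in-degree *)

Section DegreeCounts.
Variables (T : Type) (R : realType) (m : nat).
Variables (W : nat -> T -> R) (V : nat -> 'I_m -> T -> nat).
Hypothesis target : forall n j w, (0 < n)%N -> (V n j w < n)%N.

Definition degree_sum (f : R -> R) (k n : nat) (w : T) : R :=
  \sum_(i < n) f (W i w) * (indegree V n i w == k)%:R.

Definition degree_sum_pred (f : R -> R) (k n : nat) (w : T) : R :=
  \sum_(i < n) f (W i w) * ((indegree V n i w).+1 == k)%:R.

Lemma degree_sum_pred0 f n w : degree_sum_pred f 0 n w = 0.
Proof. by rewrite /degree_sum_pred big1// => i _; rewrite mulr0. Qed.

Lemma degree_sum_predS f k n w : degree_sum_pred f k.+1 n w = degree_sum f k n w.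
Proof. by apply: eq_bigr => i _; rewrite eqSS. Qed.

(** The change of [degree_sum f k] when a single half-edge is attached to i. *)
Definition jump (f : R -> R) (k n i : nat) (w : T) : R :=
  f (W i w) * (((indegree V n i w).+1 == k)%:R - (indegree V n i w == k)%:R).

Lemma indegreeS n i w : (0 < n)%N ->
  indegree V n.+1 i w = (indegree V n i w + \sum_(j < m) (V n j w == i))%N.
Proof. by move=> n0; rewrite /indegree big_nat_recr. Qed.

Lemma indegree_young n i w : (n <= i.+1)%N -> indegree V n i w = 0%N.
Proof.
move=> ni; rewrite /indegree big_nat big1// => l /andP[l0 ln].
rewrite big1// => j _; apply/eqP; rewrite eqb0 ltn_eqF//.
by rewrite (leq_trans (target j w l0))// -ltnS (leq_trans ln ni).
Qed.

Lemma sum_target (a : nat -> R) n j w : (0 < n)%N ->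
  \sum_(i < n) a i * (V n j w == i)%:R = a (V n j w).
Proof.
move=> n0; rewrite (bigD1 (Ordinal (target j w n0)))//= eqxx mulr1 big1 ?addr0//.
move=> i iV; suff -> : (V n j w == i) = false by rewrite mulr0.
by apply/negbTE; apply: contra iV => /eqP h; apply/eqP/val_inj; rewrite /= -h.
Qed.

(** Attaching s half-edges to a vertex is s times the effect of attaching one if
    s is 0 or 1; otherwise the error 1 + s is at most 2 s (s - 1). *)
Lemma linearization_error (z s k : nat) :
  `| (z + s == k)%N%:R - (z == k)%:R - s%:R * ((z.+1 == k)%:R - (z == k)%:R) |
  <= (2 * (s * s.-1))%:R :> R.
Proof.
case: s => [|[|s]].
- by rewrite addn0 subrr mul0r subrr normr0.
- by rewrite addn1 mul1r subrr normr0.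
have n1 (a b : bool) : `|a%:R - b%:R| <= 1 :> R.
  by case: a b => -[]; rewrite ?subrr ?subr0 ?sub0r ?normrN ?normr1 ?normr0.
apply: le_trans (ler_normB _ _) _; rewrite normrM [`|s.+2%:R|]ger0_norm//.
apply: (@le_trans _ _ (1 + s.+2%:R * 1)).
  by rewrite lerD// ler_wpM2l.
by rewrite mulr1 addrC natr1 ler_nat /=; lia.
Qed.

(** The error term counts the pairs of half-edges of vertex n with a common
    target, s (s - 1) of them for a target hit s times. *)
Lemma degree_sum_increment f k n w : (0 < n)%N ->
  `| degree_sum f k n.+1 w - degree_sum f k n w
     - ((k == 0%N)%:R * f (W n w) + \sum_(j < m) jump f k n (V n j w) w) |
  <= 2 * \sum_(j < m) \sum_(l < m | l != j)
       `|f (W (V n j w) w)| * (V n j w == V n l w)%:R.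
Proof.
move=> n0.
pose s i := (\sum_(j < m) (V n j w == i))%N.
have sE i : (s i)%:R = \sum_(j < m) (V n j w == i)%:R :> R by rewrite natr_sum.
have jumpE : \sum_(j < m) jump f k n (V n j w) w = \sum_(i < n) (s i)%:R * jump f k n i w.
  rewrite (eq_bigr (fun j => \sum_(i < n) jump f k n i w * (V n j w == i)%:R)); last first.
    by move=> j _; rewrite (sum_target (fun i => jump f k n i w)).
  by rewrite exchange_big /=; apply: eq_bigr => i _; rewrite sE mulrC mulr_sumr.
have NS : degree_sum f k n.+1 w = \sum_(i < n) f (W i w) * (indegree V n i w + s i == k)%N%:R
    + (k == 0%N)%:R * f (W n w).
  rewrite /degree_sum big_ord_recr /= indegree_young// (eq_sym 0%N k) mulrC; congr (_ + _).
  by apply: eq_bigr => i _; rewrite indegreeS.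
have -> : degree_sum f k n.+1 w - degree_sum f k n w
     - ((k == 0%N)%:R * f (W n w) + \sum_(j < m) jump f k n (V n j w) w) =
   \sum_(i < n) f (W i w) * ((indegree V n i w + s i == k)%N%:R - (indegree V n i w == k)%:R
      - (s i)%:R * (((indegree V n i w).+1 == k)%:R - (indegree V n i w == k)%:R)).
  rewrite NS jumpE /degree_sum.
  transitivity (\sum_(i < n) f (W i w) * (indegree V n i w + s i == k)%N%:R -
     \sum_(i < n) f (W i w) * (indegree V n i w == k)%:R - \sum_(i < n) (s i)%:R * jump f k n i w).
    by ring.
  rewrite -!sumrB; apply: eq_bigr => i _; rewrite /jump; ring.
have sq i : (s i * (s i).-1)%:R =
    \sum_(j < m) \sum_(l < m | l != j) (V n j w == i)%:R * (V n l w == i)%:R :> R.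
  have -> : (s i * (s i).-1)%:R = (s i)%:R * (s i)%:R - (s i)%:R :> R.
    by case: (s i) => [|q] /=; rewrite ?mul0r ?subrr// natrM -[X in X%:R * q%:R]addn1 natrD; ring.
  rewrite {1 3}sE mulr_suml -sumrB; apply: eq_bigr => j _.
  rewrite sE (bigD1 j)//= mulrDr mulr_sumr.
  by case: (V n j w == i); rewrite ?mul1r ?mul0r ?subr0 ?add0r// addrC addKr.
apply: le_trans (ler_norm_sum _ _ _) _.
apply: (@le_trans _ _ (\sum_(i < n) `|f (W i w)| * (2 * (s i * (s i).-1))%:R)).
  by apply: ler_sum => i _; rewrite normrM ler_wpM2l// linearization_error.
rewrite (eq_bigr (fun i : 'I_n => 2 * \sum_(j < m) \sum_(l < m | l != j)
   `|f (W i w)| * (V n l w == i)%:R * (V n j w == i)%:R)); last first.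
  move=> i _; rewrite natrM sq mulrCA mulr_sumr; congr (_ * _).
  apply: eq_bigr => j _; rewrite mulr_sumr; apply: eq_bigr => l _.
  by rewrite -mulrA [X in _ = _ * X]mulrC.
rewrite -mulr_sumr ler_pM2l// exchange_big /=; apply: ler_sum => j _.
rewrite exchange_big /=; apply: ler_sum => l _.
by rewrite (sum_target (fun i => `|f (W i w)| * (V n l w == i)%:R))// eq_sym.
Qed.

(** Counting the half-edges by their targets or by their origins. *)
Lemma sum_indegree (f : R -> R) n w :
  \sum_(i < n) (indegree V n i w)%:R * f (W i w)
  = \sum_(i < n) (if i == 0%N :> nat then 0 else \sum_(j < m) f (W (V i j w) w)).
Proof.
elim: n => [|n IH]; first by rewrite !big_ord0.
rewrite big_ord_recr [RHS]big_ord_recr /= indegree_young// mul0r addr0.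
have [->|n0] := posnP n; first by rewrite !big_ord0 addr0.
rewrite -IH.
rewrite (eq_bigr (fun i : 'I_n => (indegree V n i w)%:R * f (W i w) +
   \sum_(j < m) f (W i w) * (V n j w == i)%:R)); last first.
  move=> i _; rewrite indegreeS// natrD mulrDl; congr (_ + _).
  by rewrite natr_sum mulr_suml; apply: eq_bigr => j _; rewrite mulrC.
rewrite big_split /=; congr (_ + _); rewrite exchange_big /=; apply: eq_bigr => j _.
by rewrite (sum_target (fun i => f (W i w))).
Qed.

Lemma degree_sum_le f k n w K : (forall x, `|f x| <= K) ->
  `|degree_sum f k n w| <= K * n%:R.
Proof.
move=> fK; apply: le_trans (ler_norm_sum _ _ _) _.
rewrite -[n in K * n%:R]card_ord -sum1_card natr_sum mulr_sumr.
apply: ler_sum => i _; rewrite mulr1 normrM.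
by case: (_ == k); rewrite ?normr1 ?mulr1// normr0 mulr0 (le_trans _ (fK 0)).
Qed.

Lemma degree_sum_pred_le f k n w K : (forall x, `|f x| <= K) ->
  `|degree_sum_pred f k n w| <= K * n%:R.
Proof.
case: k => [|k] fK; last by rewrite degree_sum_predS degree_sum_le.
by rewrite degree_sum_pred0 normr0 mulr_ge0// (le_trans _ (fK 0)).
Qed.

End DegreeCounts.

(** * Half-edges and the total weight *)

Section DegreeLimits.
Context (d : measure_display) (T : measurableType d) (R : realType).
Variables (P : probability T R) (m : nat) (X : {RV P >-> R}).
Variables (W : nat -> {RV P >-> R}) (V : nat -> 'I_m -> {RV P >-> nat}).
Hypothesis X_ge0 : forall w, 0 <= X w.
Hypothesis X_gt0 : P [set w | 0 < X w] = 1%E.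
Hypothesis G_wrg : weighted_recursive_graph X W V.
Hypothesis EX : ('E_P[X] < +oo)%E.
Local Notation Ex := (Rintegral P setT).

Let mu := fine 'E_P[X].
Let c := m%:R / mu.
Let W0 := wrg_weight_ge0 G_wrg.
Let iidW := wrg_weight_iid G_wrg.
Let mX : measurable_fun setT X. Proof. exact: measurable_funP. Qed.

Lemma positive_event_ae : {ae P, forall w, 0 < X w}.
Proof.
have mA : measurable [set w | 0 < X w].
  rewrite (_ : [set w | _] = X @^-1` `]0, +oo[%classic); last first.
    by apply/seteqP; split => w /=; rewrite in_itv /= andbT.
  by rewrite -[X in measurable X]setTI; apply: mX => //; exact: measurable_itv.
apply/negligibleP; first exact: measurableC.
by have := probability_setC P mA; rewrite X_gt0 subee.
Qed.

Lemma mean_gt0 : 0 < mu.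
Proof.
have iX := expectation_integrable X_ge0 EX.
rewrite lt_neqAle; apply/andP; split; last first.
  by rewrite /mu expectation_Ex; apply: Ex_ge0.
apply/eqP => mu0.
have I0 : (\int[P]_w `|(EFin \o X) w| = 0)%E.
  rewrite (eq_integral (EFin \o X)); last by move=> w _ /=; rewrite ger0_norm.
  move: mu0; rewrite /mu expectation_def => /esym mu0.
  rewrite -[RHS](_ : mu%:E = 0%E); last by rewrite /mu expectation_def mu0.
  rewrite /mu expectation_def fineK//; exact: (integrable_fin_num measurableT iX).
have mEX : measurable_fun setT (EFin \o X) by exact/measurable_EFinP.
have /(ae_eq_integral_abs P measurableT mEX) X0 := I0.
have : {ae P, forall w : T, False}.
  move: X0 positive_event_ae; apply: filterS2 => w /(_ I) /= [->].
  by rewrite ltxx.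
rewrite /almost_everywhere /= => -[A [mA A0 sub]].
have : (P setT <= P A)%E.
  apply: le_measure; rewrite ?inE// => w _; apply: sub => h; exact: h.
by rewrite A0 probability_setT lee_fin ler10.
Qed.

Lemma mean_weight_cvg :
  {ae P, forall w, (fun n => total_weight W n w / n%:R) @ \oo --> mu}.
Proof.
by apply: filterS (strong_law iidW X_ge0 EX W0) => w; exact: sublinear_cvg.
Qed.

Section OnePath.
Variable w : T.
Hypothesis Sw : (fun n => total_weight W n w / n%:R) @ \oo --> mu.

Lemma inv_mean_weight_cvg :
  (fun n => m%:R * (n%:R / total_weight W n w)) @ \oo --> c.
Proof.
apply: cvgM; first exact: cvg_cst.
rewrite (_ : (fun n => _) = (fun n => (total_weight W n w / n%:R)^-1)).
  exact: cvgV (lt0r_neq0 mean_gt0) Sw.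
by apply/funext => n; rewrite invf_div.
Qed.

Lemma near_total_weight_gt0 : \forall n \near \oo, 0 < total_weight W n w.
Proof.
have h : \forall n \near \oo, 0 < total_weight W n w / n%:R.
  exact: cvgr_gt _ Sw _ mean_gt0.
apply: filterS h => n; rewrite !ltNge.
by apply: contraNN => S0; rewrite mulr_le0_ge0.
Qed.

Lemma edge_mean_sum (g : nat -> nat -> T -> R) n : 0 < total_weight W n w ->
  edge_mean W (fun n s w => \sum_(j < m) g n (s j) w) n w
  = m%:R / total_weight W n w * \sum_(i < n) W i w * g n i w.
Proof.
move=> S0; rewrite /edge_mean; under eq_bigr do rewrite mulr_sumr.
rewrite exchange_big /= (eq_bigr (fun=> \sum_(i < n) W i w / total_weight W n w * g n i w)).
  rewrite sumr_const card_ord -[LHS]mulr_natl -[RHS]mulrA; congr (_ * _); rewrite mulr_sumr.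
  by apply: eq_bigr => i _; rewrite mulrCA mulrA.
move=> j _.
exact: (@sum_choices_one _ _ _ (fun i : 'I_n => W i w / total_weight W n w)
  (sum_weight_ratio S0) (fun i : 'I_n => g n i w)).
Qed.

(** The conditional mean is m / S_n times a sum, and m n / S_n tends to c; only
    the boundedness of the average z is available when the recursion is set up,
    its convergence being the aim. *)
Lemma edge_mean_asymptotics (g : nat -> nat -> T -> R) (z : nat -> R) (K : R) :
  (forall n, z n = (\sum_(i < n) W i w * g n i w) / n%:R) -> (forall n, `|z n| <= K) ->
  (fun n => edge_mean W (fun n s w => \sum_(j < m) g n (s j) w) n w - c * z n)
    @ \oo --> (0 : R).
Proof.
move=> zE zK.
have h : (fun n => (m%:R * (n%:R / total_weight W n w) - c) * K) @ \oo --> (0 : R).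
  rewrite -[X in _ --> X](mul0r K); apply: cvgM; last exact: cvg_cst.
  by rewrite -(subrr c); apply: cvgB; [exact: inv_mean_weight_cvg|exact: cvg_cst].
have K0 : 0 <= K := le_trans (normr_ge0 _) (zK 0%N).
apply/cvgrPdist_le => e e0; move/cvgrPdist_le: h => /(_ _ e0); apply: filter_app.
near=> n; rewrite !sub0r !normrN; apply: le_trans.
have n0 : (n%:R : R) != 0 by rewrite pnatr_eq0 -lt0n; near: n; exists 1%N.
have S0 : 0 < total_weight W n w by near: n; exact: near_total_weight_gt0.
rewrite edge_mean_sum//.
have -> : m%:R / total_weight W n w * (\sum_(i < n) W i w * g n i w) =
    m%:R * (n%:R / total_weight W n w) * z n.
  rewrite zE; set A := \sum_(i < n) _; field.
  by rewrite n0 gt_eqF.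
by rewrite -mulrBl !normrM ler_wpM2l// (ger0_norm K0).
Unshelve. all: by end_near. Qed.

End OnePath.


(** The ordered pairs of half-edges sharing a target of weight less than M. *)
Definition pairs (M : R) (n : nat) (s : 'I_m -> nat) (w : T) : R :=
  \sum_(j < m) \sum_(l < m | l != j) (W (s j) w < M)%R%:R * (s j == s l)%:R.

Lemma pairs_ge0 M n s w : 0 <= pairs M n s w.
Proof. by apply: sumr_ge0 => j _; apply: sumr_ge0 => l _; rewrite mulr_ge0. Qed.

(** Given G_n two half-edges share a target of weight less than M with
    probability at most n (M / S_n)^2, which tends to 0. *)
Lemma pairs_sublinear (M : R) : 0 < M ->
  {ae P, forall w, sublinear (fun n => \sum_(i < n) pairs M i (fun j => V i j w) w)}.
Proof.
move=> M0.
have mp n s : (0 < n)%N -> (forall j, s j < n)%N -> graph_measurable W V n (pairs M n s).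
  move=> n0 sn; apply: graph_measurable_sum => j _; apply: graph_measurable_sum => l _.
  apply: graph_measurableM; last exact: measurable_cst.
  rewrite /graph_measurable.
  have mB := @graph_measurable_weight _ _ _ P m W V n (s j) (sn j).
  rewrite (_ : (fun w => _) = \1_(W (s j) @^-1` `]-oo, M[%classic)).
    apply: measurable_indic; rewrite -[X in measurable X]setTI.
    by apply: mB => //; exact: measurable_itv.
  apply/funext => w; rewrite indicE; congr (nat_of_bool _)%:R.
  by apply/idP/idP; rewrite inE /= in_itv.
have bp n s w : `|pairs M n s w| <= \sum_(j < m) \sum_(l < m | l != j) 1.
  rewrite ger0_norm ?pairs_ge0//; apply: ler_sum => j _; apply: ler_sum => l _.
  by case: (_ < _)%R; case: (_ == _); rewrite ?mulr1 ?mulr0 ?mul0r.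
have := edge_noise_sublinear G_wrg mp bp.
move: mean_weight_cvg; apply: filterS2 => w Sw noise.
have mean0 : (fun n => edge_mean W (pairs M) n w) @ \oo --> (0 : R).
  have h : (fun n => (m%:R * (n%:R / total_weight W n w)) ^+ 2 * M ^+ 2 * n%:R^-1)
      @ \oo --> (0 : R).
    rewrite -[X in _ --> X](mulr0 (c ^+ 2 * M ^+ 2)); apply: cvgM; last first.
      apply/cvgrPdist_le => e e0; near=> n.
      rewrite sub0r normrN ger0_norm// invf_ple ?posrE//.
        by near: n; exact: nbhs_infty_ger.
      by rewrite ltr0n; near: n; exists 1%N.
    apply: cvgM; last exact: cvg_cst.
    by apply: cvgM; exact: inv_mean_weight_cvg.
  apply: (squeeze_cvgr _ (cvg_cst 0) h).
  near=> n; apply/andP; split.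
    by apply: sumr_ge0 => t _; rewrite mulr_ge0 ?pairs_ge0 ?(choice_prob_ge0 G_wrg).
  have n0 : (n%:R : R) != 0 by rewrite pnatr_eq0 -lt0n; near: n; exists 1%N.
  have S0 : 0 < total_weight W n w by near: n; exact: near_total_weight_gt0.
  rewrite /edge_mean /pairs.
  under eq_bigr do rewrite mulr_sumr.
  rewrite exchange_big /=.
  apply: (@le_trans _ _ (\sum_(j < m) \sum_(l < m) n%:R * (M / total_weight W n w) ^+ 2)).
    apply: ler_sum => j _; under eq_bigr do rewrite mulr_sumr.
    rewrite exchange_big /= big_mkcond /=; apply: ler_sum => l _.
    case: ifPn => [lj|_]; last by rewrite mulr_ge0// sqr_ge0.
    rewrite eq_sym in lj.
    rewrite (eq_bigr (fun t : {ffun 'I_m -> 'I_n} =>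
        (\prod_(l < m) (W (t l) w / total_weight W n w)) *
        ((W (t j) w < M)%R%:R * (t j == t l)%:R))); last by move=> t _.
    rewrite (@sum_choices_two _ _ _ (fun i : 'I_n => W i w / total_weight W n w)
      (sum_weight_ratio S0) (fun i : 'I_n => (W i w < M)%R%:R) j l lj).
    rewrite -[n in n%:R * _]card_ord -sum1_card natr_sum mulr_suml.
    apply: ler_sum => i _; rewrite mul1r.
    have [WM|_] := ltP (W i w) M; last by rewrite mulr0 sqr_ge0.
    rewrite mulr1; apply: lerXn2r.
    - by rewrite nnegrE divr_ge0// ltW.
    - by rewrite nnegrE divr_ge0// ltW.
    - by rewrite ler_wpM2r ?invr_ge0 ?ltW.
  rewrite !sumr_const !card_ord -[leLHS]mulr_natl -[X in _ * X <= _]mulr_natl.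
  set S := total_weight W n w in S0 *.
  suff -> : m%:R * (m%:R * (n%:R * (M / S) ^+ 2)) = (m%:R * (n%:R / S)) ^+ 2 * M ^+ 2 / n%:R by [].
  by field; rewrite n0 gt_eqF.
apply: (@sublinear_sum_eq _ (fun i => pairs M i (fun j => V i j w) w)
  (fun i => edge_noise W V (pairs M) i w + edge_mean W (pairs M) i w)).
  by move=> i i0; rewrite /edge_noise gtn_eqF// subrK.
apply: sublinear_eq (sublinearD noise (sublinear_mean mean0)) _ => n.
by rewrite big_split.
Unshelve. all: by end_near. Qed.

End DegreeLimits.

(** * Limits of the in-degree sums *)

Section DegreeDistribution.
Context (d : measure_display) (T : measurableType d) (R : realType).
Variables (P : probability T R) (m : nat) (X : {RV P >-> R}).
Variables (W : nat -> {RV P >-> R}) (V : nat -> 'I_m -> {RV P >-> nat}).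
Hypothesis m_gt0 : (0 < m)%N.
Hypothesis X_ge0 : forall w, 0 <= X w.
Hypothesis X_gt0 : P [set w | 0 < X w] = 1%E.
Hypothesis G_wrg : weighted_recursive_graph X W V.
Hypothesis EX : ('E_P[X] < +oo)%E.
Local Notation Ex := (Rintegral P setT).

Let mu := fine 'E_P[X].
Let c := m%:R / mu.
Let W0 := wrg_weight_ge0 G_wrg.
Let iidW := wrg_weight_iid G_wrg.
Let target := wrg_target G_wrg.
Let mX : measurable_fun setT X. Proof. exact: measurable_funP. Qed.

Definition supported (M : R) (f : R -> R) := forall x, ~~ (0 <= x < M) -> f x = 0.

Let xmul (f : R -> R) : R -> R := fun x => x * f x.

Lemma bounded_mfun_xmul M f : supported M f -> bounded_mfun f -> bounded_mfun (xmul f).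
Proof.
move=> sf [mf [K fK]]; split; first by apply: measurable_funM.
exists (`|M| * K) => x; rewrite /xmul normrM.
have [/andP[x0 xM]|xM] := boolP (0 <= x < M).
  apply: ler_pM => //; rewrite !ger0_norm// ?(ltW xM)//.
  exact: le_trans x0 (ltW xM).
by rewrite sf// normr0 mulr0 mulr_ge0// (le_trans _ (fK 0)).
Qed.

Lemma supported_xmul M f : supported M f -> supported M (xmul f).
Proof. by move=> sf x xM; rewrite /xmul sf// mulr0. Qed.

Lemma graph_measurable_jump f k n i : bounded_mfun f -> (i < n)%N ->
  graph_measurable W V n (jump W V f k n i).
Proof.
move=> [mf _] ni; apply: graph_measurableM.
  have mW := @graph_measurable_weight _ _ _ P m W V n i ni.
  exact: (measurableT_comp mf mW).
apply: graph_measurableB; last exact: graph_measurable_indegree.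
case: k => [|k]; first exact: measurable_cst.
exact: graph_measurable_indegree.
Qed.

(** The increment of the in-degree sum splits into the contribution of the new
    vertex, the conditional means of the jumps, their deviations and the effect
    of multiple attachments; the last two are negligible. *)
Lemma count_recursion f k M A : 0 < M -> bounded_mfun f -> supported M f ->
  {ae P, forall w, (fun n => degree_sum_pred W V (xmul f) k n w / n%:R) @ \oo --> A} ->
  {ae P, forall w, sublinear (fun n => degree_sum W V f k n w
    - \sum_(i < n) ((k == 0%N)%:R * Ex (fun u => f (X u))
        + c * (A - degree_sum W V (xmul f) k i w / i%:R)))}.
Proof.
move=> M0 bf sf hA; have [mf [K fK]] := bf.
have K0 : 0 <= K := le_trans (normr_ge0 _) (fK 0).
have [_ [L xfL]] := bounded_mfun_xmul sf bf.
pose g n i := jump W V f k n i.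
pose phi (n : nat) (s : 'I_m -> nat) (w : T) := \sum_(j < m) g n (s j) w.
have mphi n s : (0 < n)%N -> (forall j, s j < n)%N -> graph_measurable W V n (phi n s).
  by move=> n0 sn; apply: graph_measurable_sum => j _; exact: graph_measurable_jump.
have bphi n s w : `|phi n s w| <= \sum_(j < m) K.
  apply: le_trans (ler_norm_sum _ _ _) _; apply: ler_sum => j _.
  rewrite normrM -[leRHS]mulr1 ler_pM//.
  by case: (_ == _); case: (_ == _); rewrite ?subrr ?subr0 ?sub0r ?normrN ?normr1 ?normr0.
have lln_ae := bounded_strong_law iidW bf.
have pair_ae := pairs_sublinear X_ge0 X_gt0 G_wrg EX M0.
have noise_ae := edge_noise_sublinear G_wrg mphi bphi.
apply: filterS3 (filterI hA (mean_weight_cvg X_ge0 G_wrg EX)) noise_ae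
  (filterI pair_ae lln_ae) => w [Aw Sw] noise [pairw lln].
pose inc i := degree_sum W V f k i.+1 w - degree_sum W V f k i w.
pose J i := phi i (fun j => V i j w) w.
pose mean i := edge_mean W phi i w.
pose y i := degree_sum W V (xmul f) k i w / i%:R.
pose y' i := degree_sum_pred W V (xmul f) k i w / i%:R.
have s1 : sublinear (fun n => \sum_(i < n) (inc i - ((k == 0%N)%:R * f (W i w) + J i))).
  apply: (@sublinear_sum_le _ (fun i => inc i - ((k == 0%N)%:R * f (W i w) + J i))
    (fun i => 2 * K * pairs W M i (fun j => V i j w) w)).
  - by move=> i; rewrite mulr_ge0 ?pairs_ge0 ?mulr_ge0.
  - move=> i i0; apply: le_trans (degree_sum_increment W target f k w i0) _.
    rewrite -mulrA ler_pM2l// mulr_sumr; apply: ler_sum => j _.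
    rewrite mulr_sumr; apply: ler_sum => l _; rewrite mulrA ler_wpM2r//.
    have [WM|MW] := ltP (W (V i j w) w) M; first by rewrite mulr1.
    by rewrite mulr0 sf ?normr0// (W0 _ _) /= -leNgt.
  - apply: sublinear_eq (sublinearZ (2 * K) pairw) _ => n.
    by rewrite mulr_sumr.
have s2 : sublinear (fun n => \sum_(i < n) (J i - mean i)).
  apply: (@sublinear_sum_eq _ (fun i => J i - mean i) (fun i => edge_noise W V phi i w)) => // i i0.
  by rewrite /edge_noise gtn_eqF.
have nL (x : R) n : `|x| <= L * n%:R -> `|x / n%:R| <= L.
  case: n => [|n] h; first by rewrite invr0 mulr0 normr0 (le_trans _ (xfL 0)).
  by rewrite normrM normfV [X in _ / X]ger0_norm// ler_pdivrMr// ltr0n.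
have s3 : sublinear (fun n => \sum_(i < n) (mean i - c * (A - y i))).
  apply: (@sublinear_mean _ (fun i => mean i - c * (A - y i))).
  have h1 : (fun n => mean n - c * (y' n - y n)) @ \oo --> (0 : R).
    have zE n : y' n - y n = (\sum_(i < n) W i w * g n i w) / n%:R.
      rewrite /y /y' -mulrBl -sumrB; congr (_ / _); apply: eq_bigr => i _.
      by rewrite /g /jump /xmul -mulrBr mulrA.
    have zL n : `|y' n - y n| <= L + L.
      apply: le_trans (ler_normB _ _) _; apply: lerD; apply: nL.
        exact: degree_sum_pred_le.
      exact: degree_sum_le.
    exact: (edge_mean_asymptotics m X_ge0 X_gt0 EX Sw zE zL).
  have h2 : (fun n => c * (y' n - A)) @ \oo --> (0 : R).
    rewrite -[X in _ --> X](mulr0 c) -[X in c * X](subrr A).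
    by apply: cvgM; [exact: cvg_cst|apply: cvgB => //; exact: cvg_cst].
  rewrite -[X in _ --> X]addr0.
  rewrite (_ : (fun n => _) = (fun n => mean n - c * (y' n - y n) + c * (y' n - A))).
    exact: cvgD h1 h2.
  by apply/funext => n; ring.
have s4 := sublinearZ ((k == 0%N)%:R) lln.
apply: sublinear_eq (sublinearD (sublinearD (sublinearD s1 s2) s3) s4) _ => n.
have -> : degree_sum W V f k n w = \sum_(i < n) inc i.
  elim: n => [|n IH]; first by rewrite /degree_sum !big_ord0.
  by rewrite big_ord_recr /= -IH /inc addrC subrK.
have -> : (k == 0%N)%:R * (\sum_(i < n) f (W i w) - n%:R * Ex (fun u => f (X u))) =
    \sum_(i < n) ((k == 0%N)%:R * f (W i w) - (k == 0%N)%:R * Ex (fun u => f (X u))).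
  by rewrite sumrB sumr_const card_ord -mulr_sumr -[_ *+ n]mulr_natl; ring.
rewrite -!sumrB -!big_split /=; apply: eq_bigr => i _; rewrite /y; ring.
Qed.

Let b := mu / m%:R.
Let mu0 : 0 < mu. Proof. exact: mean_gt0 X_ge0 X_gt0 EX. Qed.
Let m0 : (0 : R) < m%:R. Proof. by rewrite ltr0n. Qed.
Let b0 : 0 < b. Proof. exact: divr_gt0. Qed.
Let cE : c = b^-1. Proof. by rewrite /b invf_div. Qed.

Lemma mixed_geometric_ge0 k x : 0 <= x -> 0 <= mixed_geometric b k x.
Proof.
move=> x0; have bx : 0 <= b + x by rewrite addr_ge0// ltW.
apply: mulr_ge0; first by apply: divr_ge0 => //; exact: ltW.
by apply: exprn_ge0; exact: divr_ge0.
Qed.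

Lemma mixed_geometric_le1 k x : 0 <= x -> mixed_geometric b k x <= 1.
Proof.
move=> x0; have bx : 0 < b + x by rewrite ltr_pwDl.
have xb0 : 0 <= x / (b + x) by apply: divr_ge0 => //; exact: ltW.
rewrite /mixed_geometric; apply: mulr_ile1.
- by apply: divr_ge0; exact: ltW.
- exact: exprn_ge0.
- by rewrite ler_pdivrMr// mul1r lerDl.
- by apply: exprn_ile1 => //; rewrite ler_pdivrMr// mul1r lerDr ltW.
Qed.

(** The stationary form of [count_recursion], pointwise in the weight x. *)
Lemma mixed_geometric_rec k x : 0 <= x ->
  mixed_geometric b k x + c * x * mixed_geometric b k x =
  (k == 0%N)%:R + (if k is k'.+1 then c * x * mixed_geometric b k' x else 0).
Proof.
move=> x0; have bx : b + x != 0 by rewrite gt_eqF// ltr_pwDl.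
have bn0 : b != 0 by rewrite gt_eqF.
rewrite cE /mixed_geometric; case: k => [|k] /=.
  by rewrite expr0 mulr1 addr0; field; rewrite bx.
by rewrite exprS; set e := _ ^+ k; field; rewrite bx.
Qed.

Lemma bounded_mfun_mixed_geometric k :
  bounded_mfun (fun x : R => mixed_geometric b k (Num.max 0 x)).
Proof.
split; last first.
  exists 1 => x; have x0 : 0 <= Num.max 0 x by rewrite le_max lexx.
  by rewrite ger0_norm ?mixed_geometric_ge0 ?mixed_geometric_le1.
have mmax : measurable_fun setT (fun x : R => Num.max 0 x).
  by apply: measurable_maxr; [exact: measurable_cst|exact: measurable_id].
have minv : measurable_fun setT (fun x : R => (b + Num.max 0 x)^-1).
  rewrite (_ : (fun x => _) = (fun x => (b + Num.max 0 x) `^ (-1))).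
    apply: (measurableT_comp (@measurable_powR _ (-1))).
    by apply: measurable_funD => //; exact: measurable_cst.
  by apply/funext => x; rewrite powR_inv1// addr_ge0 ?(ltW b0)// le_max lexx.
rewrite /mixed_geometric; apply: measurable_funM.
  by apply: measurable_funM => //; exact: measurable_cst.
by apply: measurable_funX; exact: measurable_funM.
Qed.

(** The almost sure limit of [degree_sum f k n / n]. *)
Definition limit_degree_sum (k : nat) (f : R -> R) : R :=
  Ex (fun u => mixed_geometric b k (X u) * f (X u)).

Let bgX k f : bounded_mfun f ->
  bounded_mfun (fun u => mixed_geometric b k (X u) * f (X u)).
Proof.
move=> bf.
have := bounded_mfun_comp mX (bounded_mfunM (bounded_mfun_mixed_geometric k) bf).
by congr bounded_mfun; apply/funext => u; rewrite (max_idPr (X_ge0 u)).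
Qed.

Lemma limit_degree_sum_rec k f : bounded_mfun f -> bounded_mfun (xmul f) ->
  limit_degree_sum k f + c * limit_degree_sum k (xmul f) =
  (k == 0%N)%:R * Ex (fun u => f (X u)) +
  c * (if k is k'.+1 then limit_degree_sum k' (xmul f) else 0).
Proof.
move=> bf bxf; rewrite /limit_degree_sum.
have bfX : bounded_mfun (fun u => f (X u)) by exact: bounded_mfun_comp.
rewrite -[in LHS]ExZ; last exact: bgX.
rewrite -ExD; [|exact: bgX|by apply: bounded_mfunZ; exact: bgX].
transitivity (Ex (fun u => ((k == 0%N)%:R +
    (if k is k'.+1 then c * X u * mixed_geometric b k' (X u) else 0)) * f (X u))).
  congr Ex; apply/funext => u; rewrite -mixed_geometric_rec// /xmul; ring.
case: k => [|k] /=.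
  by under eq_fun do rewrite addr0; rewrite ExZ// mulr0 addr0.
rewrite mul0r add0r -ExZ; last exact: bgX.
by congr Ex; apply/funext => u; rewrite /xmul; ring.
Qed.

Lemma limit_degree_sum_le k f K : bounded_mfun f -> (forall x, `|f x| <= K) ->
  `|limit_degree_sum k f| <= K.
Proof.
move=> bf fK; apply: Ex_norm_le; first exact: bgX.
move=> u; rewrite normrM -[leRHS]mul1r ler_pM//.
by rewrite ger0_norm ?mixed_geometric_ge0 ?mixed_geometric_le1.
Qed.

(** Multiplication by x is not a contraction, but c x = c M - c (M - x), where
    (M - x) / M is at most 1 on the support of f; so the recursions of the
    functions ((M - x) / M) ^ r f form a chain of contractions. *)
Lemma degree_limit_step k f M : 0 < M -> bounded_mfun f -> supported M f ->
  (forall g, bounded_mfun g -> supported M g ->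
     {ae P, forall w, (fun n => degree_sum_pred W V g k n w / n%:R) @ \oo
       --> (if k is k'.+1 then limit_degree_sum k' g else 0)}) ->
  {ae P, forall w, (fun n => degree_sum W V f k n w / n%:R) @ \oo
     --> limit_degree_sum k f}.
Proof.
move=> M0 bf sf IH; have [mf [K fK]] := bf.
pose fr r x := ((M - x) / M) ^+ r * f x.
have sfr r : supported M (fr r) by move=> x xM; rewrite /fr sf// mulr0.
have frK r x : `|fr r x| <= K.
  have [/andP[x0 xM]|xM] := boolP (0 <= x < M); last first.
    by rewrite sfr// normr0 (le_trans _ (fK 0)).
  have Mx0 : 0 <= (M - x) / M by rewrite divr_ge0 ?subr_ge0 ?ltW.
  rewrite /fr normrM -[leRHS]mul1r ler_pM// ger0_norm ?exprn_ge0// exprn_ile1//.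
  by rewrite ler_pdivrMr// mul1r gerBl.
have bfr r : bounded_mfun (fr r).
  split; last by exists K.
  apply: measurable_funM => //; apply: measurable_funX; apply: measurable_funM => //.
  by apply: measurable_funB => //; exact: measurable_cst.
have bxfr r := bounded_mfun_xmul (sfr r) (bfr r).
have xfrE r x : xmul (fr r) x = M * (fr r x - fr r.+1 x).
  rewrite /xmul /fr exprS; set e := _ ^+ r; field; rewrite gt_eqF//.
have rec r := count_recursion M0 (bfr r) (sfr r) (IH _ (bxfr r) (supported_xmul (sfr r))).
have := ae_foralln rec; apply: filterS => w {}rec.
pose x r n := degree_sum W V (fr r) k n w / n%:R - limit_degree_sum k (fr r).
suff : x 0%N @ \oo --> (0 : R).
  have -> : f = fr 0%N by apply/funext => z; rewrite /fr expr0 mul1r.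
  move=> h; rewrite -[X in _ --> X]add0r.
  rewrite (_ : (fun n => _) = (fun n => x 0%N n + limit_degree_sum k (fr 0%N))).
    by apply: cvgD h _; exact: cvg_cst.
  by apply/funext => n; rewrite subrK.
apply: (@chained_contraction _ (c * M) (K + K)).
- by rewrite mulr_gt0// divr_gt0.
- move=> r n; apply: le_trans (ler_normB _ _) _; apply: lerD; last exact: limit_degree_sum_le.
  case: n => [|n]; first by rewrite invr0 mulr0 normr0 (le_trans _ (fK 0)).
  rewrite normrM normfV [X in _ / X]ger0_norm// ler_pdivrMr ?ltr0n//.
  exact: degree_sum_le.
move=> r; apply: sublinear_eq (rec r) _ => n.
have nx : n%:R * x r n = degree_sum W V (fr r) k n w - n%:R * limit_degree_sum k (fr r).
  rewrite /x; case: n => [|n]; first by rewrite !mul0r /degree_sum big_ord0 subr0.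
  by rewrite mulrBr mulrCA mulfV ?mulr1// pnatr_eq0.
rewrite nx mulr_sumr -addrA; congr (_ + _).
rewrite -opprD; congr (- _).
have -> : n%:R * limit_degree_sum k (fr r) = \sum_(i < n) limit_degree_sum k (fr r).
  by rewrite sumr_const card_ord mulr_natl.
rewrite -big_split /=; apply: eq_bigr => i _.
have -> : degree_sum W V (xmul (fr r)) k i w =
    M * (degree_sum W V (fr r) k i w - degree_sum W V (fr r.+1) k i w).
  rewrite /degree_sum -sumrB mulr_sumr; apply: eq_bigr => l _.
  by rewrite xfrE; ring.
have -> : (k == 0%N)%:R * Ex (fun u => fr r (X u)) =
    limit_degree_sum k (fr r) + c * limit_degree_sum k (xmul (fr r)) -
    c * (if k is k'.+1 then limit_degree_sum k' (xmul (fr r)) else 0).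
  by rewrite limit_degree_sum_rec// addrK.
have -> : limit_degree_sum k (xmul (fr r)) =
    M * (limit_degree_sum k (fr r) - limit_degree_sum k (fr r.+1)).
  rewrite /limit_degree_sum -ExB; [|exact: bgX|exact: bgX].
  rewrite -ExZ; last by apply: bounded_mfunB; exact: bgX.
  by congr Ex; apply/funext => u; rewrite xfrE; ring.
by rewrite /x; move: (match k with 0%N => _ | _ => _ end) (i%:R : R) => A q; ring.
Qed.

Theorem degree_limit k f M : 0 < M -> bounded_mfun f -> supported M f ->
  {ae P, forall w, (fun n => degree_sum W V f k n w / n%:R) @ \oo
     --> limit_degree_sum k f}.
Proof.
elim: k f => [|k IH] f M0 bf sf; apply: (degree_limit_step M0) => // g bg sg.
  apply: aeW => w; under eq_fun do rewrite degree_sum_pred0 mul0r.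
  exact: cvg_cst.
apply: filterS (IH g M0 bg sg) => w.
rewrite (_ : (fun n => degree_sum_pred _ _ _ _ _ _ / _) =
  (fun n => degree_sum W V g k n w / n%:R))//.
Qed.

Theorem half_edge_limit f M : 0 < M -> bounded_mfun f -> supported M f ->
  {ae P, forall w, (fun n => (\sum_(i < n) (indegree V n i w)%:R * f (W i w)) / n%:R) @ \oo
     --> c * Ex (fun u => X u * f (X u))}.
Proof.
move=> M0 bf sf; have [mf [K fK]] := bf.
have bxf := bounded_mfun_xmul sf bf; have [_ [L xfL]] := bxf.
pose g (n i : nat) (w : T) := f (W i w).
pose phi (n : nat) (s : 'I_m -> nat) (w : T) := \sum_(j < m) g n (s j) w.
have mphi n s : (0 < n)%N -> (forall j, s j < n)%N -> graph_measurable W V n (phi n s).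
  move=> n0 sn; apply: graph_measurable_sum => j _.
  have mW := @graph_measurable_weight _ _ _ P m W V n (s j) (sn j).
  exact: (measurableT_comp mf mW).
have bphi n s w : `|phi n s w| <= \sum_(j < m) K.
  by apply: le_trans (ler_norm_sum _ _ _) _; apply: ler_sum => j _; exact: fK.
apply: filterS3 (edge_noise_sublinear G_wrg mphi bphi) (mean_weight_cvg X_ge0 G_wrg EX)
  (bounded_strong_law iidW bxf) => w noise Sw lln.
apply: sublinear_cvg.
set l := Ex (fun u => X u * f (X u)).
pose z n := (\sum_(i < n) W i w * g n i w) / n%:R.
have zl : z @ \oo --> l by exact: sublinear_cvg.
have mean0 : (fun n => edge_mean W phi n w - c * l) @ \oo --> (0 : R).
  have h1 : (fun n => edge_mean W phi n w - c * z n) @ \oo --> (0 : R).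
    suff zL : forall n, `|z n| <= L.
      exact: (edge_mean_asymptotics m X_ge0 X_gt0 EX Sw (fun=> erefl) zL).
    move=> n; rewrite /z; case: n => [|n]; first by rewrite invr0 mulr0 normr0 (le_trans _ (xfL 0)).
    rewrite normrM normfV [X in _ / X]ger0_norm// ler_pdivrMr ?ltr0n//.
    apply: le_trans (ler_norm_sum _ _ _) _.
    have -> : L * n.+1%:R = \sum_(i < n.+1) L by rewrite sumr_const card_ord mulr_natr.
    by apply: ler_sum => i _; exact: xfL.
  have h2 : (fun n => c * (z n - l)) @ \oo --> (0 : R).
    rewrite -[X in _ --> X](mulr0 c) -[X in c * X](subrr l).
    by apply: cvgM; [exact: cvg_cst|apply: cvgB => //; exact: cvg_cst].
  rewrite -[X in _ --> X]addr0.
  rewrite (_ : (fun n => _) = (fun n => edge_mean W phi n w - c * z n + c * (z n - l))).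
    exact: cvgD h1 h2.
  by apply/funext => n; ring.
have h : sublinear (fun n => \sum_(i < n)
    ((if i == 0%N :> nat then 0 else phi i (fun j => V i j w) w) - c * l)).
  apply: (@sublinear_sum_eq _ (fun i => (if i == 0%N :> nat then 0 else
    phi i (fun j => V i j w) w) - c * l) (fun i => edge_noise W V phi i w +
    (edge_mean W phi i w - c * l))).
    by move=> i i0; rewrite /edge_noise gtn_eqF// addrA subrK.
  by apply: sublinear_eq (sublinearD noise (sublinear_mean mean0)) _ => n; rewrite big_split.
apply: sublinear_eq h _ => n.
rewrite (@sum_indegree _ _ m (fun i => W i) (fun i j => V i j) target f n w).
by rewrite mulr_natl sumrB sumr_const card_ord.
Qed.

End DegreeDistribution.

(** * Weak convergence from the masses of intervals *)

Section DensityMeasure.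
Context (d : measure_display) (T : measurableType d) (R : realType).
Variables (mu : {measure set T -> \bar R}) (h : T -> \bar R).
Hypothesis ih : mu.-integrable setT h.
Hypothesis h0 : forall x, (0 <= h x)%E.

(** The proofs are arguments so that the structure of a finite measure can be
    attached to the set function. *)
Definition density_measure (ih' : mu.-integrable setT h) (h0' : forall x, (0 <= h x)%E) :=
  fun A : set T => (\int[mu]_(x in A) h x)%E.
Local Notation nu := (density_measure ih h0).

Let nu0 : nu set0 = 0%E. Proof. exact: integral_set0. Qed.
Let nu_ge0 A : (0 <= nu A)%E. Proof. by apply: integral_ge0 => x _. Qed.
Let nu_sigma_additive : semi_sigma_additive nu.
Proof. apply: semi_sigma_additive_nng_induced => //; exact: measurable_int ih. Qed.

HB.instance Definition _ := isMeasure.Build _ _ _ nu nu0 nu_ge0 nu_sigma_additive.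

Let nu_fin : fin_num_fun nu.
Proof.
by move=> A mA; apply: integrable_fin_num => //=; exact: integrableS ih.
Qed.

HB.instance Definition _ := Measure_isFinite.Build _ _ _ nu nu_fin.

Definition density_finite_measure : {finite_measure set T -> \bar R} := nu.

End DensityMeasure.

Section WeakConvergence.
Variable R : realType.
Implicit Types (f : R -> R) (nu : {measure set R -> \bar R}).

Local Notation D := (`[0, +oo[%classic : set R).

Let mD : measurable (D : set R). Proof. exact: measurable_itv. Qed.

(** Uniform continuity on a compact interval, with y allowed to leave it: the
    condition at x is open in x, so finitely many radii suffice. *)
Lemma oscillation f e (A : R) : {within D, continuous f} -> 0 < e -> 0 <= A ->
  \forall N \near \oo, forall x y : R, 0 <= x <= A -> 0 <= y ->
    `|x - y| <= N.+1%:R^-1 -> `|f x - f y| <= e.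
Proof.
move=> /subspace_continuousP cf e0 A0.
have := @segment_compact R 0 A; rewrite compact_near_coveringP => cov.
pose Q (N : nat) (x : R) := 0 <= x -> forall y : R, 0 <= y ->
    `|x - y| <= N.+1%:R^-1 -> `|f x - f y| <= e.
have : \forall N \near \oo, `[0, A]%classic `<=` Q N.
  apply: cov => x; rewrite /= in_itv /= => /andP[x0 _].
  have Dx : D x by rewrite /= in_itv /= x0.
  have e20 : 0 < e / 2 by lra.
  have /cvgrPdist_le /(_ _ e20) := cf x Dx.
  rewrite near_withinE => -[r /= r0 rf].
  have rf' y : 0 <= y -> `|x - y| < r -> `|f x - f y| <= e / 2.
    by move=> y0 xy; apply: rf => //=; rewrite in_itv /= y0.
  have r20 : 0 < r / 2 by lra.
  exists ([set x' | `|x - x'| < r / 2], [set N : nat | (N.+1%:R^-1 : R) < r / 2]).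
    split => /=; first by exists (r / 2).
    have [N _ HN] := @near_infty_natSinv_lt R (PosNum r20).
    by exists N.
  move=> [x' N] /= [xx' Nr] x'0 y y0 x'y.
  have h1 := rf' x' x'0 _; have h2 := rf' y y0 _.
  have -> : f x' - f y = (f x - f y) - (f x - f x') by lra.
  apply: le_trans (ler_normB _ _) _.
  have -> : e = e / 2 + e / 2 by lra.
  apply: lerD; [apply: h2|apply: h1]; last by apply: lt_trans xx' _; lra.
  have -> : x - y = (x - x') + (x' - y) by lra.
  apply: le_lt_trans (ler_normD _ _) _; rewrite [ltRHS]splitr.
  by apply: ltrD => //; exact: le_lt_trans x'y Nr.
apply: filterS => N HN x y /andP[x0 xA] y0 xy; apply: HN => //.
by rewrite /= in_itv /= x0.
Qed.

Section OneMeasure.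
Variable nu : {measure set R -> \bar R}.
Hypothesis nuD : (nu D < +oo)%E.

Let nu_fin (E : set R) : measurable E -> E `<=` D -> nu E \is a fin_num.
Proof.
move=> mE ED; rewrite ge0_fin_numE//; apply: le_lt_trans nuD.
by apply: le_measure; rewrite ?inE.
Qed.

Lemma integral_sub_cst_le f E (a e K : R) : measurable E -> E `<=` D ->
  measurable_fun D f -> (forall x, D x -> `|f x| <= K) ->
  (forall x, E x -> `|f x - a| <= e) ->
  `|\int[nu]_(x in E) f x - a * fine (nu E)| <= e * fine (nu E).
Proof.
move=> mE ED mf fK fa.
have nuE : (nu E < +oo)%E by rewrite -ge0_fin_numE//; exact: nu_fin.
have mfE : measurable_fun E f by exact: measurable_funS mf.
have ibnd (g : R -> R) (L : R) : measurable_fun E g -> (forall x, E x -> `|g x| <= L) ->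
    nu.-integrable E (EFin \o g).
  move=> mg gL; apply: measurable_bounded_integrable => //.
  exists L; split; first by rewrite num_real.
  by move=> x Lx y Ey; apply: le_trans (gL y Ey) (ltW Lx).
have if' : nu.-integrable E (EFin \o f) by apply: (ibnd _ K) => // x /ED; exact: fK.
have ic (z : R) : nu.-integrable E (EFin \o cst z).
  by apply: (ibnd _ `|z|) => //; exact: measurable_cst.
rewrite -(Rintegral_cst nu mE) -(RintegralB mE if' (ic a)).
rewrite -(Rintegral_cst nu mE).
have ifa : nu.-integrable E (EFin \o (fun x => f x - a)).
  by apply: (ibnd _ e) => //; apply: measurable_funB => //; exact: measurable_cst.
apply: le_trans (le_normr_Rintegral mE ifa) _.
apply: le_Rintegral => //; last exact: (ic e).
apply: (ibnd _ e) => [|x Ex]; last by rewrite normr_id; exact: fa.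
by apply: measurableT_comp => //; apply: measurable_funB => //; exact: measurable_cst.
Qed.

Definition mass_below (q : R) : R := fine (nu `[0, q[%classic).

(** The function f is replaced by its value at the left end of each interval of
    length 1/(N+1) up to J/(N+1), and by 0 beyond; both errors are read off from
    the masses, uniformly in the measure. *)
Lemma riemann_sum_le f (e K : R) (N J : nat) : 0 <= K ->
  {within D, continuous f} -> (forall x, D x -> `|f x| <= K) ->
  (forall x y : R, 0 <= x <= J%:R / N.+1%:R -> 0 <= y ->
    `|x - y| <= N.+1%:R^-1 -> `|f x - f y| <= e) ->
  `|\int[nu]_(x in D) f x - \sum_(j < J) f (j%:R / N.+1%:R) *
      (mass_below (j.+1%:R / N.+1%:R) - mass_below (j%:R / N.+1%:R))|
  <= e * mass_below (J%:R / N.+1%:R) + K * (fine (nu D) - mass_below (J%:R / N.+1%:R)).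
Proof.
move=> K0 cf fK osc.
have mf : measurable_fun D f by exact: subspace_continuous_measurable_fun.
have ifD : nu.-integrable D (EFin \o f).
  apply: measurable_bounded_integrable => //.
  exists K; split; first by rewrite num_real.
  by move=> x Kx y Dy; apply: le_trans (fK y Dy) (ltW Kx).
have N0 : (0 : R) < N.+1%:R by rewrite ltr0n.
pose I (j : nat) : set R := `[j%:R / N.+1%:R, j.+1%:R / N.+1%:R[%classic.
pose B (j : nat) : set R := `[0, j%:R / N.+1%:R[%classic.
have q0 (j : nat) : 0 <= j%:R / N.+1%:R :> R by rewrite divr_ge0.
have qS (j : nat) : j%:R / N.+1%:R <= j.+1%:R / N.+1%:R :> R.
  by rewrite ler_pM2r ?invr_gt0// ler_nat.
have mI j : measurable (I j) by exact: measurable_itv.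
have mB j : measurable (B j) by exact: measurable_itv.
have ID j : I j `<=` D.
  by move=> x; rewrite /I /= !in_itv /= => /andP[jx _]; rewrite andbT (le_trans (q0 j)).
have BD j : B j `<=` D by move=> x; rewrite /B /= !in_itv /= => /andP[->].
have BS j : B j.+1 = B j `|` I j.
  apply/seteqP; split => x; rewrite /B /I /= !in_itv /=.
    move=> /andP[x0 xj]; have [h|h] := ltP x (j%:R / N.+1%:R); [left|right].
      by rewrite x0.
    by rewrite xj.
  move=> [/andP[-> h]|/andP[h ->]] /=; first by rewrite (lt_le_trans h).
  by rewrite andbT (le_trans (q0 j)).
have disj j : [disjoint B j & I j].
  rewrite disj_set2E; apply/eqP/seteqP; split => x //=.
  rewrite /B /I /= !in_itv /= => -[/andP[_ h1] /andP[h2 _]].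
  by move: (lt_le_trans h1 h2); rewrite ltxx.
have nuBS j : fine (nu (I j)) = mass_below (j.+1%:R / N.+1%:R) - mass_below (j%:R / N.+1%:R).
  rewrite /mass_below -/(B j.+1) -/(B j) BS measureU//; last first.
    by apply/eqP; rewrite -disj_set2E.
  by rewrite fineD ?nu_fin// addrC addKr.
have body j : (j <= J)%N -> `|\int[nu]_(x in B j) f x - \sum_(i < j) f (i%:R / N.+1%:R) *
      (mass_below (i.+1%:R / N.+1%:R) - mass_below (i%:R / N.+1%:R))|
      <= e * mass_below (j%:R / N.+1%:R).
  elim: j => [|j IH] jJ.
    have B0 : B 0%N = set0.
      apply/seteqP; split => x //=; rewrite /B /= in_itv /= mul0r => /andP[h1 h2].
      by move: (le_lt_trans h1 h2); rewrite ltxx.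
    by rewrite B0 Rintegral_set0 big_ord0 subrr normr0 /mass_below -/(B 0%N) B0 measure0 mulr0.
  rewrite BS Rintegral_setU//; last by rewrite -BS; exact: integrableS ifD.
  rewrite big_ord_recr /= -nuBS.
  have -> : mass_below (j.+1%:R / N.+1%:R) = mass_below (j%:R / N.+1%:R) + fine (nu (I j)).
    by rewrite nuBS addrC subrK.
  rewrite opprD addrACA mulrDr; apply: le_trans (ler_normD _ _) _.
  apply: lerD; first by apply: IH; exact: ltnW.
  apply: (integral_sub_cst_le (K := K)) => // x; rewrite /I /= in_itv /= => /andP[jx xj].
  rewrite distrC; apply: osc; last 2 first.
  - exact: le_trans jx.
  - rewrite distrC ger0_norm ?subr_ge0//.
    by have := ltW xj; rewrite -(natr1 j) mulrDl mul1r lerBlDl.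
  by rewrite q0 ler_pM2r ?invr_gt0// ler_nat ltnW.
pose C : set R := `[J%:R / N.+1%:R, +oo[%classic.
have CD : C `<=` D by move=> x; rewrite /C /= !in_itv /= !andbT; exact: le_trans.
have mC : measurable C by exact: measurable_itv.
have DBC : D = B J `|` C.
  apply/seteqP; split => x; rewrite /B /C /= !in_itv /= ?andbT.
    by move=> x0; rewrite x0; have [h|h] := ltP x (J%:R / N.+1%:R); [left|right].
  by move=> [/andP[]|]//; exact: le_trans.
have disjC : [disjoint B J & C].
  rewrite disj_set2E; apply/eqP/seteqP; split => x //=.
  rewrite /B /C /= !in_itv /= andbT => -[/andP[_ h1] h2].
  by move: (lt_le_trans h1 h2); rewrite ltxx.
have nuC : fine (nu C) = fine (nu D) - mass_below (J%:R / N.+1%:R).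
  rewrite /mass_below -/(B J) [in RHS]DBC measureU//; last first.
    by apply/eqP; rewrite -disj_set2E.
  by rewrite fineD ?nu_fin// addrC addKr.
rewrite -nuC {1}DBC Rintegral_setU//; last by rewrite -DBC.
rewrite addrAC; apply: le_trans (ler_normD _ _) _; apply: lerD; first exact: body.
have := @integral_sub_cst_le f C 0 K K mC CD mf fK.
by rewrite mul0r subr0; apply => x Cx; rewrite subr0; apply: fK; exact: CD.
Qed.

End OneMeasure.

Lemma mass_below_cvg nu : (nu D < +oo)%E ->
  (fun j : nat => mass_below nu j%:R) @ \oo --> fine (nu D).
Proof.
move=> nuD.
have DE : D = \bigcup_(j : nat) `[0, j%:R[%classic.
  apply/seteqP; split => x.
    rewrite /= in_itv /= andbT => x0; exists (Num.truncn x).+1 => //=.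
    by rewrite in_itv /= x0 truncnS_gt.
  by move=> [j _] /=; rewrite !in_itv /= => /andP[->].
have : (fun j : nat => nu `[0, j%:R[%classic) @ \oo --> nu D.
  rewrite [in X in _ --> X]DE.
  have := @nondecreasing_cvg_mu _ _ _ nu (fun j : nat => `[0, j%:R[%classic : set R).
  apply.
  - by move=> i; exact: measurable_itv.
  - by rewrite -DE.
  - move=> i j ij; apply/subsetPset => x /=; rewrite !in_itv /= => /andP[-> h] /=.
    by rewrite (lt_le_trans h)// ler_nat.
have nuDE : nu D = (fine (nu D))%:E by rewrite fineK// ge0_fin_numE.
by rewrite nuDE => /fine_cvgP[].
Qed.

Let integral_fin nu f K : (nu D < +oo)%E -> {within D, continuous f} ->
  (forall x, D x -> `|f x| <= K) ->
  (\int[nu]_(x in D) (f x)%:E = (\int[nu]_(x in D) f x)%:E)%E.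
Proof.
move=> nuD cf fK; rewrite /Rintegral fineK//.
apply: integrable_fin_num => //.
apply: measurable_bounded_integrable => //.
  exact: subspace_continuous_measurable_fun.
exists K; split; first by rewrite num_real.
by move=> x Kx y Dy; apply: le_trans (fK y Dy) (ltW Kx).
Qed.

(** Convergence of the masses of the intervals [0, q) with q rational and of the
    total mass is enough: f is uniformly continuous on a compact interval
    carrying almost all the mass of the limit. *)
Theorem weak_star_cvg_masses (M : nat -> {measure set R -> \bar R})
    (L : {measure set R -> \bar R}) :
  (forall n, M n D < +oo)%E -> (L D < +oo)%E ->
  (forall j N : nat, mass_below (M n) (j%:R / N.+1%:R) @[n --> \oo]
     --> mass_below L (j%:R / N.+1%:R)) ->
  (fun n => fine (M n D)) @ \oo --> fine (L D) ->
  weak_star_cvg M L.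
Proof.
move=> MD LD Mq Mt f cf [K' fK'].
pose K := Num.max 0 K'.
have K0 : 0 <= K by rewrite /K le_max lexx.
have fK x : D x -> `|f x| <= K.
  rewrite /= in_itv /= andbT => x0; apply: le_trans (fK' x x0) _.
  by rewrite /K le_max lexx orbT.
rewrite (integral_fin LD cf fK).
rewrite (_ : (fun n => _) = (fun n => (\int[M n]_(x in D) f x)%:E)); last first.
  by apply/funext => n; rewrite (integral_fin (MD n) cf fK).
apply: cvg_EFin; first by apply: nearW.
apply/cvgrPdist_le => e e0.
pose t := fine (L D).
have t0 : 0 <= t by rewrite fine_ge0.
have mfin nu (q : R) : (nu D < +oo)%E -> nu `[0, q[%classic \is a fin_num.
  move=> nuD; rewrite ge0_fin_numE//; apply: le_lt_trans nuD.
  apply: le_measure; rewrite ?inE//.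
  by move=> x /=; rewrite !in_itv /= => /andP[->].
have Lbelow := mass_below_cvg LD.
pose e1 := e / 8 / (K + 1).
have e10 : 0 < e1 by rewrite /e1 divr_gt0// ?divr_gt0//; lra.
have [J HJ] : exists J : nat, t - mass_below L J%:R <= e1.
  move/cvgrPdist_le: Lbelow => /(_ _ e10) [J _ /(_ J (leqnn J))] HJ.
  by exists J; exact: le_trans (ler_norm _) HJ.
pose e2 := e / 8 / (t + 1).
have e20 : 0 < e2 by rewrite /e2 divr_gt0// ?divr_gt0//; lra.
have [N _ /(_ N (leqnn N)) HN] := oscillation cf e20 (ler0n R J).
pose A := (J * N.+1)%N.
have AE : A%:R / N.+1%:R = J%:R :> R by rewrite /A natrM mulfK// pnatr_eq0.
have approx nu : (nu D < +oo)%E -> `|\int[nu]_(x in D) f x - \sum_(j < A) f (j%:R / N.+1%:R) *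
      (mass_below nu (j.+1%:R / N.+1%:R) - mass_below nu (j%:R / N.+1%:R))|
    <= e2 * mass_below nu J%:R + K * (fine (nu D) - mass_below nu J%:R).
  move=> nuD; rewrite -AE; apply: riemann_sum_le => // x y; rewrite AE; exact: HN.
pose G nu := e2 * mass_below nu J%:R + K * (fine (nu D) - mass_below nu J%:R).
pose s nu := \sum_(j < A) f (j%:R / N.+1%:R) *
      (mass_below nu (j.+1%:R / N.+1%:R) - mass_below nu (j%:R / N.+1%:R)).
have cG : (fun n => G (M n)) @ \oo --> G L.
  apply: cvgD; first by apply: cvgM; [exact: cvg_cst|rewrite -AE; exact: Mq].
  apply: cvgM; first exact: cvg_cst.
  by apply: cvgB => //; rewrite -AE; exact: Mq.
have cs : (fun n => s (M n)) @ \oo --> s L.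
  apply: cvg_big; first exact: add_continuous.
  move=> j _; apply: cvgM; first exact: cvg_cst.
  by apply: cvgB; exact: Mq.
have GL : G L <= e / 4.
  have h1 : mass_below L J%:R <= t.
    rewrite /mass_below /t fine_le//; first exact: mfin.
      by rewrite ge0_fin_numE.
    apply: le_measure; rewrite ?inE//.
    by move=> x /=; rewrite !in_itv /= => /andP[->].
  have h2 : e2 * mass_below L J%:R <= e / 8.
    apply: (@le_trans _ _ (e2 * (t + 1))); first by apply: ler_wpM2l; lra.
    by rewrite /e2 divfK// gt_eqF//; lra.
  have h3 : K * (t - mass_below L J%:R) <= e / 8.
    apply: (@le_trans _ _ ((K + 1) * e1)).
      by apply: ler_pM; rewrite ?subr_ge0//; lra.
    by rewrite /e1 mulrC divfK// gt_eqF//; lra.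
  by rewrite /G -/t; lra.
have e80 : 0 < e / 8 by lra.
move/cvgrPdist_le: cG => /(_ _ e80) cG; move/cvgrPdist_le: cs => /(_ _ e80) cs.
move: cG cs; apply: filterS2 => n hG hs.
have a1 := approx L LD; have a2 := approx (M n) (MD n).
rewrite -/(G _) -/(s _) in a1; rewrite -/(G _) -/(s _) in a2.
have hG' : G (M n) <= G L + e / 8 by move: hG; rewrite ler_norml => /andP[]; lra.
have -> : \int[L]_(x in D) f x - \int[M n]_(x in D) f x =
  (\int[L]_(x in D) f x - s L) - (\int[M n]_(x in D) f x - s (M n)) + (s L - s (M n)).
  by ring.
apply: le_trans (ler_normD _ _) _; have := ler_normB (\int[L]_(x in D) f x - s L)
  (\int[M n]_(x in D) f x - s (M n)).
lra.
Qed.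

End WeakConvergence.

(** * Limit measures for weights of finite mean *)

Section LimitMeasures.
Context (d : measure_display) (T : measurableType d) (R : realType).
Variables (P : probability T R) (X : {RV P >-> R}).
Local Notation Ex := (Rintegral P setT).
Local Notation D := (`[0, +oo[%classic : set R).

Lemma density_existence (g : R -> R) : measurable_fun D g ->
  (forall x, 0 <= x -> 0 <= g x) -> (forall w, 0 <= X w) ->
  P.-integrable setT (EFin \o (fun w => g (X w))) ->
  exists L : {finite_measure set R -> \bar R},
    has_density (distribution P X) L g /\
    forall A, measurable A -> fine (L A) = Ex (fun u => g (X u) * \1_A (X u)).
Proof.
move=> mg g0 X0 ig.
have mD : measurable D by exact: measurable_itv.
pose h x := ((g \_ D) x)%:E.
have h0 x : (0 <= h x)%E.
  rewrite /h lee_fin patchE; case: ifPn => //; rewrite inE /= in_itv /= andbT.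
  exact: g0.
have mh : measurable_fun setT h.
  by apply/measurable_EFinP; apply/(measurable_restrictT _ mD).
have hX w : h (X w) = (g (X w))%:E.
  by rewrite /h patchE ifT// inE /= in_itv /= X0.
have ih : (distribution P X).-integrable setT h.
  apply/integrableP; split => //.
  rewrite (eq_integral h) => [|x _]; last by rewrite gee0_abs.
  rewrite ge0_integral_distribution//.
  have /integrableP[_] := ig; apply: le_lt_trans.
  rewrite le_eqVlt; apply/orP; left; apply/eqP.
  apply: eq_integral => w _ /=.
  by rewrite hX ger0_norm ?g0.
exists (density_finite_measure ih h0); split => [A mA|A mA].
  rewrite /density_finite_measure /= /density_measure integral_mkcondr.
  by apply: eq_integral => x _; rewrite /h restrict_EFin.
rewrite /density_finite_measure /= /density_measure integral_mkcond.
rewrite ge0_integral_distribution; last 2 first.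
- by apply/(measurable_restrictT _ mA); exact: measurable_funTS.
- by move=> x; rewrite patchE; case: ifP.
rewrite /Rintegral; congr fine; apply: eq_integral => w _ /=.
by rewrite patchE indicE; case: ifP => _; rewrite ?mulr1 ?mulr0 ?hX.
Qed.

End LimitMeasures.

Lemma empirical_measureE (R : realType) (n : nat) (a : nat -> nat) (x : nat -> R) (A : set R) :
  (mscale (n%:R^-1)%:nng (msum (fun i => mscale ((a i)%:R)%:nng (\d_(x i))) n)
    : {measure set R -> \bar R}) A
  = ((\sum_(i < n) (a i)%:R * \1_A (x i)) / n%:R)%:E.
Proof.
rewrite /mscale /= /msum /= mulrC EFinM; congr (_ * _)%E.
by rewrite -sumEFin; apply: eq_bigr => i _; rewrite /mscale /= /dirac EFinM.
Qed.

Section FiniteMean.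
Context (d : measure_display) (T : measurableType d) (R : realType).
Variables (P : probability T R) (m : nat) (X : {RV P >-> R}).
Variables (W : nat -> {RV P >-> R}) (V : nat -> 'I_m -> {RV P >-> nat}).
Hypothesis m_gt0 : (0 < m)%N.
Hypothesis X_ge0 : forall w, 0 <= X w.
Hypothesis X_gt0 : P [set w | 0 < X w] = 1%E.
Hypothesis G_wrg : weighted_recursive_graph X W V.
Hypothesis EX : ('E_P[X] < +oo)%E.
Local Notation Ex := (Rintegral P setT).
Local Notation D := (`[0, +oo[%classic : set R).

Let mu := fine 'E_P[X].
Let b := mu / m%:R.
Let mu0 : 0 < mu. Proof. exact: mean_gt0 X_ge0 X_gt0 EX. Qed.
Let m0 : (0 : R) < m%:R. Proof. by rewrite ltr0n. Qed.
Let W0 := wrg_weight_ge0 G_wrg.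
Let iidW := wrg_weight_iid G_wrg.
Let target := wrg_target G_wrg.
Let mX : measurable_fun setT X. Proof. exact: measurable_funP. Qed.
Let mD : measurable (D : set R). Proof. exact: measurable_itv. Qed.

Let below (q : R) : R -> R := \1_(`[0, q[%classic).

Let below_bounded q : bounded_mfun (below q).
Proof. by apply: bounded_mfun_indic; exact: measurable_itv. Qed.

Let below_supported q M : q <= M -> supported M (below q).
Proof.
move=> qM x xM; rewrite /below indicE memNset//= in_itv /=.
by apply: contraNnot xM => /andP[-> xq]; rewrite (lt_le_trans xq).
Qed.

Let XD u : \1_D (X u) = 1 :> R.
Proof. by rewrite indicE mem_set//= in_itv /= X_ge0. Qed.

Let WD i u : \1_D (W i u) = 1 :> R.
Proof. by rewrite indicE mem_set//= in_itv /= W0. Qed.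

(** The total mass of [Gamma_n] is the number m (n - 1) of half-edges over n. *)
Lemma exists_edge_limit : exists Gam : {finite_measure set R -> \bar R},
  has_density (distribution P X) Gam (fun x => x * m%:R / mu) /\
  {ae P, forall w, weak_star_cvg (fun n => Gamma_n W V n w) Gam}.
Proof.
have [] := @density_existence _ _ _ P X (fun x => x * m%:R / mu).
- apply: measurable_funTS; apply: measurable_funM; last exact: measurable_cst.
  by apply: measurable_funM => //; exact: measurable_cst.
- by move=> x x0; rewrite divr_ge0 ?mulr_ge0// ltW.
- exact: X_ge0.
- have := integrableZl measurableT (m%:R / mu) (expectation_integrable X_ge0 EX).
  by apply: eq_integrable => // w _ /=; rewrite -EFinM mulrC mulrA.
move=> Gam [dGam massGam]; exists Gam; split => //.
have massE n w (A : set R) :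
    fine (Gamma_n W V n w A) = (\sum_(i < n) (indegree V n i w)%:R * \1_A (W i w)) / n%:R.
  by rewrite /Gamma_n empirical_measureE.
have iX := expectation_integrable X_ge0 EX.
have below_cvg (j N : nat) : {ae P, forall w, mass_below (Gamma_n W V n w) (j%:R / N.+1%:R)
    @[n --> \oo] --> mass_below Gam (j%:R / N.+1%:R)}.
  have q0 : (0 : R) < j%:R / N.+1%:R + 1 by rewrite ltr_wpDl.
  have := half_edge_limit X_ge0 X_gt0 G_wrg EX q0 (below_bounded (j%:R / N.+1%:R))
    (below_supported (ler_wpDr ler01 (lexx _))).
  apply: filterS => w.
  rewrite /mass_below massGam; last exact: measurable_itv.
  rewrite (_ : (fun n => fine _) = (fun n => (\sum_(i < n) (indegree V n i w)%:R *
    below (j%:R / N.+1%:R) (W i w)) / n%:R)); last first.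
    by apply/funext => n; rewrite massE.
  have bxb := bounded_mfun_xmul (below_supported (lexx (j%:R / N.+1%:R))) (below_bounded _).
  rewrite -ExZ; last exact: bounded_mfun_comp mX bxb.
  rewrite (_ : Ex (fun u => m%:R / fine _ * _) =
    Ex (fun u => X u * m%:R / mu * \1_(`[0, j%:R / N.+1%:R[%classic) (X u)))//.
  by congr Rintegral; apply/funext => u; rewrite /below /mu; ring.
have := ae_foralln (fun j => ae_foralln (below_cvg j)).
apply: filterS => w cvgw.
apply: weak_star_cvg_masses => //.
- by move=> n; rewrite /Gamma_n empirical_measureE ltry.
- by rewrite -ge0_fin_numE// fin_num_measure.
- rewrite massGam// (_ : Ex _ = m%:R); last first.
    rewrite (_ : (fun u => _) = (fun u => (m%:R / mu) * X u)); last first.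
      by apply/funext => u; rewrite XD mulr1 -mulrA mulrC.
    by rewrite RintegralZl// -(expectation_Ex X) -/mu divfK// gt_eqF.
  rewrite (_ : (fun n => _) = (fun n => (\sum_(i < n) (indegree V n i w)%:R * 1) / n%:R)).
    apply: sublinear_cvg.
    have h : sublinear (fun n => \sum_(i < n)
        ((if i == 0%N :> nat then 0 else \sum_(j < m) 1) - m%:R : R)).
      apply: (@sublinear_sum_eq _ (fun i : nat =>
        (if i == 0%N :> nat then 0 else \sum_(j < m) 1) - m%:R) (fun=> 0)).
        by move=> i i0; rewrite gtn_eqF// sumr_const card_ord subrr.
      by apply: sublinear_eq (sublinear_cst 0) _ => n; rewrite big1.
    apply: sublinear_eq h _ => n.
    rewrite (@sum_indegree _ _ m (fun i => W i) (fun i j => V i j) target (fun=> 1) n w).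
    have -> : n%:R * m%:R = \sum_(i < n) m%:R :> R by rewrite sumr_const card_ord mulr_natl.
    by rewrite -sumrB.
  by apply/funext => n; rewrite massE//; congr (_ / _); apply: eq_bigr => i _; rewrite WD.
Qed.


Lemma exists_degree_limit k : exists Gamk : {finite_measure set R -> \bar R},
  has_density (distribution P X) Gamk (mixed_geometric b k) /\
  {ae P, forall w, weak_star_cvg (fun n => Gamma_nk W V k n w) Gamk /\
     (fun n => Gamma_nk W V k n w D) @ \oo --> Gamk D}.
Proof.
have bg := bounded_mfun_mixed_geometric m_gt0 X_ge0 X_gt0 EX k.
have [] := @density_existence _ _ _ P X (mixed_geometric b k).
- apply: (@eq_measurable_fun _ _ _ _ D (fun x : R => mixed_geometric b k (Num.max 0 x))).
    by move=> x; rewrite inE /= in_itv /= andbT => x0; rewrite (max_idPr x0).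
  exact: measurable_funTS bg.1.
- by move=> x x0; exact: (mixed_geometric_ge0 m_gt0 X_ge0 X_gt0 EX).
- exact: X_ge0.
- have := bounded_mfun_integrable P (bounded_mfun_comp mX bg).
  by apply: eq_integrable => // w _ /=; rewrite (max_idPr (X_ge0 w)).
move=> Gamk [dGam massGam]; exists Gamk; split => //.
have massE n w (A : set R) : fine (Gamma_nk W V k n w A) =
    (\sum_(i < n) (indegree V n i w == k)%:R * \1_A (W i w)) / n%:R.
  by rewrite /Gamma_nk empirical_measureE.
have GfinD : (Gamk D < +oo)%E by rewrite -ge0_fin_numE// fin_num_measure.
have massB q n w : mass_below (Gamma_nk W V k n w) q = degree_sum W V (below q) k n w / n%:R.
  by rewrite /mass_below massE; congr (_ / _); apply: eq_bigr => i _; rewrite mulrC.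
have below_cvg q : 0 <= q -> {ae P, forall w, mass_below (Gamma_nk W V k n w) q
    @[n --> \oo] --> mass_below Gamk q}.
  move=> q0; have q1 : 0 < q + 1 by rewrite ltr_wpDl.
  have := degree_limit m_gt0 X_ge0 X_gt0 G_wrg EX k q1 (below_bounded q)
    (below_supported (ler_wpDr ler01 (lexx _))).
  apply: filterS => w.
  rewrite [in X in _ -> X]/mass_below massGam; last exact: measurable_itv.
  by under [in X in _ -> X]eq_fun do rewrite -/(mass_below _ _) massB.
have below_cvg2 (j N : nat) := below_cvg (j%:R / N.+1%:R) (divr_ge0 (ler0n _ _) (ler0n _ _)).
have lln (j : nat) := bounded_strong_law iidW (below_bounded j%:R).
apply: filterS3 (ae_foralln (fun j => ae_foralln (below_cvg2 j)))
  (ae_foralln (fun j : nat => below_cvg j%:R (ler0n _ _))) (ae_foralln lln)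
  => w cvgw cvgj llnw.
have total : (fun n => fine (Gamma_nk W V k n w D)) @ \oo --> fine (Gamk D).
  (* no mass is lost at infinity: for J large the proportion of the vertices of
     weight at least J is eventually small, by the law of large numbers *)
  apply/cvgrPdist_le => e e0; have e40 : 0 < e / 4 by lra.
  have [J [GJ FJ]] : exists J : nat,
      `|fine (Gamk D) - mass_below Gamk J%:R| <= e / 4 /\
      `|1 - Ex (fun u => below J%:R (X u))| <= e / 4.
    have /cvgrPdist_le /(_ _ e40) h1 := mass_below_cvg GfinD.
    pose nu : {measure set R -> \bar R} := distribution P X.
    have nuE A : nu A = P (X @^-1` A) by [].
    have nuD : nu D = 1%E.
      rewrite nuE (_ : X @^-1` D = setT) ?probability_setT//.
      by apply/seteqP; split => // u _; rewrite /= in_itv /= X_ge0.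
    have nuDfin : (nu D < +oo)%E by rewrite nuD ltry.
    have /cvgrPdist_le /(_ _ e40) h2 := mass_below_cvg nuDfin.
    have [J [hJ1 hJ2]] := filter_ex (filterI h1 h2); exists J; split => //.
    move: hJ2; rewrite nuD /mass_below nuE -Ex_indic//.
    by rewrite -[X in measurable X]setTI; apply: mX => //; exact: measurable_itv.
  have /cvgrPdist_le /(_ _ e40) h1 := cvgj J.
  have /sublinearP /(_ _ e40) h2 := llnw J.
  near=> n.
  have n0 : (0 : R) < n%:R by rewrite ltr0n; near: n; exists 1%N.
  have h1n : `|mass_below Gamk J%:R - mass_below (Gamma_nk W V k n w) J%:R| <= e / 4.
    by near: n.
  have h2n : `|\sum_(i < n) below J%:R (W i w) - n%:R * Ex (fun u => below J%:R (X u))|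
      <= e / 4 * n%:R by near: n.
  have below01 x : 0 <= below J%:R x <= 1.
    by rewrite /below indicE; case: (_ \in _); rewrite ?lexx ?ler01.
  pose r := (\sum_(i < n) (indegree V n i w == k)%:R * (1 - below J%:R (W i w))) / n%:R.
  have rE : fine (Gamma_nk W V k n w D) = mass_below (Gamma_nk W V k n w) J%:R + r.
    rewrite massE massB /r -mulrDl /degree_sum -big_split /=; congr (_ / _).
    by apply: eq_bigr => i _; rewrite WD; ring.
  have r0 : 0 <= r.
    rewrite divr_ge0 ?(ltW n0)//; apply: sumr_ge0 => i _.
    by rewrite mulr_ge0 ?subr_ge0//; case/andP: (below01 (W i w)).
  have r1 : r <= e / 2.
    rewrite ler_pdivrMr//.
    apply: (@le_trans _ _ (\sum_(i < n) (1 - below J%:R (W i w)))).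
      apply: ler_sum => i _; rewrite ler_piMl ?subr_ge0//.
        by case/andP: (below01 (W i w)).
      by case: (_ == k).
    rewrite sumrB sumr_const card_ord.
    have h3 : n%:R * (1 - Ex (fun u => below J%:R (X u))) <= n%:R * (e / 4).
      by rewrite ler_pM2l//; exact: le_trans (ler_norm _) FJ.
    move: h2n; rewrite ler_norml => /andP[h2n _].
    move: h2n h3; set S := \sum_(i < n) _; set F := Ex _ => h2n h3.
    have : 1 *+ n = n%:R :> R by [].
    lra.
  rewrite rE.
  have -> : fine (Gamk D) - (mass_below (Gamma_nk W V k n w) J%:R + r) =
     (fine (Gamk D) - mass_below Gamk J%:R) +
     (mass_below Gamk J%:R - mass_below (Gamma_nk W V k n w) J%:R) - r by ring.
  apply: le_trans (ler_normB _ _) _; rewrite (ger0_norm r0).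
  have := ler_normD (fine (Gamk D) - mass_below Gamk J%:R)
     (mass_below Gamk J%:R - mass_below (Gamma_nk W V k n w) J%:R).
  lra.
split; last first.
  have GD : Gamk D = (fine (Gamk D))%:E by rewrite fineK// ge0_fin_numE.
  rewrite GD (_ : (fun n => _) = (fun n => (fine (Gamma_nk W V k n w D))%:E)).
    by apply: cvg_EFin => //; apply: nearW.
  by apply/funext => n; rewrite /Gamma_nk empirical_measureE.
apply: weak_star_cvg_masses => // n.
by rewrite /Gamma_nk empirical_measureE ltry.
Unshelve. all: by end_near. Qed.

Theorem finite_mean_limits :
  let p := fun k : nat => (\int[distribution P X]_(x in `[0%R, +oo[)
      (mixed_geometric b k x)%:E)%E in
    exists (Gam : {finite_measure set R -> \bar R})
           (Gamk : nat -> {finite_measure set R -> \bar R}),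
      [/\ has_density (distribution P X) Gam (fun x => x * m%:R / mu),
          forall k, has_density (distribution P X) (Gamk k) (mixed_geometric b k)
        & {ae P, forall w,
            weak_star_cvg (fun n => Gamma_n W V n w) Gam /\
            forall k : nat,
              weak_star_cvg (fun n => Gamma_nk W V k n w) (Gamk k) /\
              (fun n => p_n W V k n w) @ \oo --> p k}].
Proof.
move=> p; have [Gam [dGam cGam]] := exists_edge_limit.
have [Gamk dGamk] := choice exists_degree_limit.
exists Gam, Gamk; split => // [k|]; first by case: (dGamk k).
have := ae_foralln (fun k => (dGamk k).2).
move: cGam; apply: filterS2 => w cG cGk; split => // k.
have [wk tk] := cGk k; split => //.
rewrite /p_n /p (_ : (\int[_]_(_ in _) _)%E = Gamk k D)//.
by rewrite (dGamk k).1// setIid.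
Qed.

End FiniteMean.

(** * Regularly varying tails *)

Section RegularlyVaryingTail.
Variable R : realType.

Lemma powR_exp (x r : R) : 0 < x -> x `^ r = expR (r * ln x).
Proof. by move=> x0; rewrite /powR gt_eqF. Qed.

Lemma powRD_gt0 (x r s : R) : 0 < x -> x `^ (r + s) = x `^ r * x `^ s.
Proof. by move=> x0; rewrite !powR_exp// -expRD mulrDl. Qed.

(** Growth rates need only be compared at x and 2 x: halving brings every x into
    [x0, 2 x0]. *)
Lemma doubling_ind (Q : R -> Prop) (x0 : R) : 0 < x0 ->
  (forall x, x0 <= x <= 2 * x0 -> Q x) ->
  (forall x, x0 <= x -> Q x -> Q (2 * x)) ->
  forall x, x0 <= x -> Q x.
Proof.
move=> x00 base step x x0x.
have [n xn] : exists n, x <= 2 ^+ n * x0.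
  exists (Num.truncn (x / x0)).+1; rewrite -ler_pdivrMr//.
  apply: (@le_trans _ _ (Num.truncn (x / x0)).+1%:R); first by rewrite ltW// truncnS_gt.
  by rewrite -natrX ler_nat ltnW// ltn_expl.
elim: n x x0x xn => [|n IH] x x0x xn.
  by apply: base; rewrite x0x (le_trans xn)// expr0 mul1r; lra.
have [x2|x2] := leP x (2 * x0); first by apply: base; rewrite x0x.
have -> : x = 2 * (x / 2) by field.
apply: step; first by rewrite ler_pdivlMr// mulrC ltW.
apply: IH; first by rewrite ler_pdivlMr// mulrC ltW.
by rewrite ler_pdivrMr// mulrAC -exprSr.
Qed.

Variables (a : R) (F ell : R -> R).
Hypothesis a0 : 0 < a.
Hypothesis F01 : forall x, 0 <= F x <= 1.
Hypothesis Fdecr : forall x y, x <= y -> F y <= F x.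
Hypothesis FE : forall x, 0 < x -> F x = ell x * x `^ (- a).
Hypothesis ell0 : forall x, 0 < x -> 0 <= ell x.
Hypothesis sv : (fun x => ell (2 * x) / ell x) @ +oo --> (1 : R).

(** F (2 x) / F x tends to 2^(-a), and the factor 2^(e) absorbs the error. *)
Lemma tail_doubling (e : R) : 0 < e -> exists2 x0 : R, 0 < x0 & forall x, x0 <= x ->
  [/\ 0 < F x, 2 `^ (- a - e) * F x <= F (2 * x) & F (2 * x) <= 2 `^ (- a + e) * F x].
Proof.
move=> e0.
have two_pos : (0 : R) < 2 by [].
pose lo : R := 2 `^ (- e); pose hi : R := 2 `^ e.
have ln2 : 0 < ln (2 : R) by rewrite ln_gt0// ltr1n.
have lo1 : lo < 1.
  by rewrite /lo powR_exp// -[ltRHS]expR0 ltr_expR mulNr oppr_lt0 mulr_gt0.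
have lo0 : 0 < lo by rewrite /lo powR_gt0.
have hi1 : 1 < hi.
  by rewrite /hi powR_exp// -[ltLHS]expR0 ltr_expR mulr_gt0.
have [A [_ HA]] : \forall x \near +oo, lo < ell (2 * x) / ell x < hi.
  by near=> x; apply/andP; split; near: x;
    [exact: cvgr_gt _ sv _ lo1|exact: cvgr_lt _ sv _ hi1].
exists (Num.max 1 (A + 1)); first by rewrite lt_max ltr01.
move=> x; rewrite ge_max => /andP[x1 xA].
have x0 : 0 < x by apply: lt_le_trans x1.
have /andP[r1 r2] : lo < ell (2 * x) / ell x < hi by apply: HA; lra.
have ellx : 0 < ell x.
  rewrite lt_neqAle ell0// andbT; apply: contraTneq r1 => <-.
  by rewrite invr0 mulr0 -leNgt ltW.
have p0 : 0 < x `^ (- a) by rewrite powR_gt0.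
have Fx : 0 < F x by rewrite FE// mulr_gt0.
have F2 : F (2 * x) = ell (2 * x) / ell x * (2 `^ (- a) * F x).
  by rewrite !FE ?mulr_gt0// powRM// ?(ltW x0)//; field; rewrite gt_eqF.
have pa : 0 < 2 `^ (- a) * F x by rewrite mulr_gt0// powR_gt0.
have powD (u : R) : 2 `^ (- a + u) * F x = 2 `^ u * (2 `^ (- a) * F x).
  by rewrite powRD_gt0//; ring.
split => //; rewrite powD F2 ler_wpM2r// ltW//.
Unshelve. all: by end_near. Qed.

Lemma tail_upper (e : R) : 0 < e -> exists C x0 : R, [/\ 0 < C, 0 < x0 &
  forall x, x0 <= x -> F x <= C * x `^ (- a + e)].
Proof.
move=> e0; have [x0 x00 dbl] := tail_doubling e0.
pose b := - a + e.
pose C := Num.max (x0 `^ (- b)) ((2 * x0) `^ (- b)).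
have C0 : 0 < C by rewrite lt_max powR_gt0.
exists C, x0; split => //; apply: doubling_ind => // x.
  move=> /andP[x0x x2]; have xp : 0 < x by apply: lt_le_trans x0x.
  apply: le_trans (_ : 1 <= _); first by case/andP: (F01 x).
  have -> : 1 = x `^ (- b) * x `^ b.
    by rewrite -powRD_gt0// addNr powRr0.
  rewrite ler_wpM2r ?powR_ge0// /C le_max.
  have [b0|b0] := leP 0 (- b).
    by apply/orP; right; rewrite ge0_ler_powR// nnegrE ltW// mulr_gt0.
  apply/orP; left; rewrite !powR_exp// ler_expR ler_wnM2l// ?(ltW b0)//.
  by rewrite ler_ln.
move=> x0x h; have [_ _] := dbl x x0x; have xp : 0 < x by apply: lt_le_trans x0x.
move=> /le_trans; apply; rewrite -/b powRM// ?(ltW xp)// mulrCA ler_wpM2l//.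
Qed.

Lemma tail_lower (e : R) : 0 < e -> exists c x0 : R, [/\ 0 < c, 0 < x0 &
  forall x, x0 <= x -> c * x `^ (- a - e) <= F x].
Proof.
move=> e0; have [x0 x00 dbl] := tail_doubling e0.
pose b := - a - e.
have x20 : x0 <= 2 * x0 by lra.
have [F2 _ _] := dbl _ x20.
pose c := F (2 * x0) * x0 `^ (- b).
exists c, x0; split => //; first by rewrite mulr_gt0// powR_gt0.
apply: doubling_ind => // x.
  move=> /andP[x0x x2]; have xp : 0 < x by apply: lt_le_trans x0x.
  apply: le_trans (Fdecr x2); rewrite /c -mulrA ler_piMr ?(ltW F2)//.
  rewrite -/b powR_exp// powR_exp// -expRD -[leRHS]expR0 ler_expR.
  have bneg : b <= 0 by rewrite /b subr_le0 (le_trans _ (ltW e0))// oppr_le0 ltW.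
  by rewrite mulNr addrC -mulrBr mulr_le0_ge0// subr_ge0 ler_ln.
move=> x0x h; have [_ h2 _] := dbl x x0x; have xp : 0 < x by apply: lt_le_trans x0x.
apply: le_trans h2; rewrite -/b powRM// ?(ltW xp)// mulrCA ler_wpM2l//.
Qed.

(** For H x = E[X; X <= x] the growth over [x, 2 x] is at most 2 x P(X >= x), of
    the order of x^(1-a+e); as 1 - a + e > 0 these contributions sum up like a
    geometric series. *)
Lemma truncated_growth (H : R -> R) (e : R) : 0 < e -> 0 < 1 - a + e ->
  (forall x y, x <= y -> H x <= H y) -> (forall x, 0 < x -> H (2 * x) <= H x + 2 * x * F x) ->
  exists C x0 : R, [/\ 0 < C, 0 < x0 &
  forall x, x0 <= x -> H x <= C * x `^ (1 - a + e)].
Proof.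
move=> e0 b0 Hincr Hdbl; have [C [x0 [C0 x00 Fup]]] := tail_upper e0.
set b := 1 - a + e in b0 *.
have two_pos : (0 : R) < 2 by [].
have ln2 : 0 < ln (2 : R) by rewrite ln_gt0// ltr1n.
have b2 : 1 < 2 `^ b by rewrite powR_exp// -[ltLHS]expR0 ltr_expR mulr_gt0.
pose C1 := Num.max (2 * C / (2 `^ b - 1)) (`|H (2 * x0)| * x0 `^ (- b)).
have C10 : 0 < C1.
  rewrite lt_max; apply/orP; left.
  by apply: divr_gt0; [exact: mulr_gt0|rewrite subr_gt0].
exists C1, x0; split => //; apply: doubling_ind => // x.
  move=> /andP[x0x x2]; have xp : 0 < x by apply: lt_le_trans x0x.
  apply: le_trans (Hincr _ _ x2) _; apply: le_trans (ler_norm _) _.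
  apply: (@le_trans _ _ (`|H (2 * x0)| * x0 `^ (- b) * x `^ b)).
    rewrite -mulrA ler_peMr// powR_exp// powR_exp// -expRD -[leLHS]expR0 ler_expR.
    by rewrite mulNr addrC -mulrBr mulr_ge0 ?(ltW b0)// subr_ge0 ler_ln.
  by rewrite ler_wpM2r ?powR_ge0// /C1 le_max lexx orbT.
move=> x0x h; have xp : 0 < x by apply: lt_le_trans x0x.
apply: le_trans (Hdbl x xp) _; rewrite powRM// ?(ltW xp)//.
have h2 : 2 * x * F x <= 2 * C * x `^ b.
  have -> : x `^ b = x * x `^ (- a + e).
    by rewrite /b -addrA powRD_gt0// powRr1// ltW.
  by rewrite -!mulrA ler_pM2l// mulrCA ler_pM2l// Fup.
have h3 : 2 * C <= C1 * (2 `^ b - 1).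
  by rewrite -ler_pdivrMr ?subr_gt0// /C1 le_max lexx.
have h4 := ler_wpM2r (powR_ge0 x b) h3.
lra.
Qed.

(** This is ln u <= u - 1 at u = t / s. *)
Lemma expRN_le_powR (t s : R) : 0 < t -> 0 < s -> expR (- t) <= s `^ s * t `^ (- s).
Proof.
move=> t0 s0; rewrite !powR_exp// -expRD ler_expR.
have : ln (t / s) <= t / s - 1.
  have := @le_ln1Dx R (t / s - 1); rewrite [1 + _]addrC subrK; apply.
  by rewrite ltrBrDl subrr divr_gt0.
rewrite ln_div ?posrE// => h.
have : s * (ln t - ln s) <= s * (t / s - 1) by rewrite ler_pM2l.
rewrite [X in _ <= X]mulrBr mulrCA mulfV ?gt_eqF// mulr1; lra.
Qed.

End RegularlyVaryingTail.

(** * Isolated vertices *)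

Section UniformVertex.
Context (d : measure_display) (T : measurableType d) (R : realType).
Variables (P : probability T R) (m : nat) (X : {RV P >-> R}).
Variables (W : nat -> {RV P >-> R}) (V : nat -> 'I_m -> {RV P >-> nat}).
Variable U : nat -> {RV P >-> nat}.
Hypothesis X_ge0 : forall w, 0 <= X w.
Hypothesis G_wrg : weighted_recursive_graph X W V.
Hypothesis unifU : uniform_vertex W V U.
Local Notation Ex := (Rintegral P setT).

Let W0 := wrg_weight_ge0 G_wrg.
Let iidW := wrg_weight_iid G_wrg.
Let target := wrg_target G_wrg.
Let mX : measurable_fun setT X. Proof. exact: measurable_funP. Qed.
Let mW i : measurable_fun setT (W i). Proof. exact: measurable_funP. Qed.

Definition light (x : R) : R -> R := \1_(`]-oo, x]%classic).

Definition light_targets (x : R) (n : nat) (s : 'I_m -> nat) (w : T) : R :=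
  \sum_(j < m) light x (W (s j) w).

Let light_bounded x : bounded_mfun (light x).
Proof. by apply: bounded_mfun_indic; exact: measurable_itv. Qed.

Let light01 x y : 0 <= light x y <= 1.
Proof. by rewrite /light indicE; case: (_ \in _); rewrite ?lexx ?ler01. Qed.

Let light_targets_measurable x n s : (0 < n)%N -> (forall j, s j < n)%N ->
  graph_measurable W V n (light_targets x n s).
Proof.
move=> n0 sn; apply: graph_measurable_sum => j _.
have mWsj := @graph_measurable_weight _ _ _ P m W V n (s j) (sn j).
exact: (measurableT_comp (light_bounded x).1 mWsj).
Qed.

Let light_targets_le x n s w : `|light_targets x n s w| <= m%:R.
Proof.
apply: le_trans (ler_norm_sum _ _ _) _.
have -> : m%:R = \sum_(j < m) 1 :> R by rewrite sumr_const card_ord.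
by apply: ler_sum => j _; have /andP[l0 l1] := light01 x (W (s j) w); rewrite ger0_norm.
Qed.

Let edge_mean_bounded x n : (0 < n)%N -> bounded_mfun (edge_mean W (light_targets x) n).
Proof.
move=> n0; split; last first.
  by exists m%:R => w; exact: (edge_mean_le G_wrg (@light_targets_le x)).
apply: (@graph_measurable_measurable _ _ _ P m W V n).
apply: graph_measurable_sum => t _; apply: graph_measurableM.
  exact: (graph_measurable_choice_prob G_wrg t).
exact: light_targets_measurable.
Qed.

Let edge_noise_bounded x n : bounded_mfun (edge_noise W V (light_targets x) n).
Proof.
have mp := @light_targets_measurable x.
split; last first.
  by exists (m%:R + m%:R) => w; exact: (edge_noise_le G_wrg (@light_targets_le x)).
apply: (@graph_measurable_measurable _ _ _ P m W V n.+1).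
exact: (graph_measurable_edge_noise G_wrg mp).
Qed.

Lemma Ex_light_targets x n : (0 < n)%N ->
  bounded_mfun (fun w => light_targets x n (fun j => V n j w) w) /\
  Ex (fun w => light_targets x n (fun j => V n j w) w) = Ex (edge_mean W (light_targets x) n).
Proof.
move=> n0.
have E : (fun w => light_targets x n (fun j => V n j w) w) =
    (fun w => edge_noise W V (light_targets x) n w + edge_mean W (light_targets x) n w).
  by apply/funext => w; rewrite /edge_noise gtn_eqF// subrK.
have bn := edge_noise_bounded x n; have bm := edge_mean_bounded x n0.
rewrite E; split; first exact: bounded_mfunD.
rewrite ExD// -[RHS]add0r; congr (_ + _).
have mp := @light_targets_measurable x.
have m1 : graph_measurable W V n (fun=> 1) by exact: measurable_cst.
have := edge_noise_orthogonal G_wrg mp (@light_targets_le x) m1 (bounded_mfun_cst T 1).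
by under eq_fun do rewrite mul1r.
Qed.

Let measurable_vertex n i : measurable [set w | U n w = i].
Proof.
rewrite (_ : [set w | _] = U n @^-1` [set i])//.
by rewrite -[X in measurable X]setTI; exact: measurable_funP.
Qed.

Let positive_degree n i w : R := 1 - (indegree V n i w == 0%N)%:R.

Let measurable_positive_degree n i :
  graph_measurable W V n (positive_degree n i).
Proof.
apply: graph_measurableB; first exact: measurable_cst.
exact: graph_measurable_indegree.
Qed.

Let positive_degree_bounded n i : bounded_mfun (positive_degree n i).
Proof.
split; first exact: graph_measurable_measurable (@measurable_positive_degree n i).
by exists 1 => w; rewrite /positive_degree; case: (_ == _);
  rewrite ?subrr ?subr0 ?normr0 ?normr1.
Qed.

Let Ex_uniform n (i : 'I_n) : (0 < n)%N ->
  Ex (fun w => \1_[set w | U n w = i] w * positive_degree n i w)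
  = n%:R^-1 * Ex (positive_degree n i).
Proof.
move=> n0; pose A := [set w | positive_degree n i w = 1].
have FA : graph_events W V n A.
  have /graph_measurableE := @measurable_positive_degree n i.
  by move=> /(_ [set 1] (measurable_set1 _)).
have mA := graph_events_measurable FA.
have dE : positive_degree n i = \1_A :> (T -> R).
  apply/funext => w; rewrite indicE /A.
  have [h|h] := eqVneq (indegree V n i w) 0%N.
    by rewrite memNset /= /positive_degree h ?subrr// => /eqP; rewrite eq_sym oner_eq0.
  by rewrite mem_set /= /positive_degree (negbTE h) ?subr0.
have -> : (fun w => \1_[set w | U n w = i] w * positive_degree n i w) =
   \1_(A `&` [set w | U n w = i]) :> (T -> R).
  by rewrite dE setIC indicI.
rewrite dE !Ex_indic//; last by apply: measurableI => //; exact: measurable_vertex.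
have [_ h] := unifU n0; rewrite h//.
by rewrite fineM ?fin_num_measure//= mulrC.
Qed.

Lemma measurable_isolated n : (0 < n)%N ->
  measurable [set w | indegree V n (U n w) w = 0%N].
Proof.
move=> n0; set E := [set w | _].
have Un w : (U n w < n)%N by have [h _] := unifU n0; exact: h.
have EE : \1_E = (fun w => 1 -
    \sum_(i < n) \1_[set w | U n w = i] w * positive_degree n i w) :> (T -> R).
  apply/funext => w; rewrite (bigD1 (Ordinal (Un w)))//= [X in _ - (_ + X)]big1 => [|i iU].
    rewrite addr0 [X in X * _](_ : _ = 1) ?mul1r; last by rewrite indicE mem_set.
    rewrite opprB addrC subrK indicE; congr (nat_of_bool _)%:R.
    by apply/idP/eqP; rewrite inE.
  rewrite indicE memNset ?mul0r//= => h; move/eqP: iU; apply.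
  by apply/val_inj; rewrite /= h.
suff : measurable_fun setT (\1_E : T -> R) by move/measurable_indicP.
rewrite EE; apply: (bounded_mfunB (bounded_mfun_cst T 1) _).1.
apply: bounded_mfun_sum => i _.
by apply: bounded_mfunM => //; apply: bounded_mfun_indic; exact: measurable_vertex.
Qed.

(** A vertex with positive in-degree is either heavy or the target of a
    half-edge; summing over the vertices, the second case counts the half-edges
    whose target is light. *)
Lemma isolated_vertex_bound (x : R) (n : nat) : (0 < n)%N ->
  1 - (Ex (fun w => 1 - light x (X w)) +
       n%:R^-1 * \sum_(k < n) (if k == 0%N :> nat then 0 else Ex (edge_mean W (light_targets x) k)))
  <= fine (P [set w | indegree V n (U n w) w = 0%N]).
Proof.
move=> n0; set E := [set w | _].
have Un w : (U n w < n)%N by have [h _] := unifU n0; exact: h.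
have EE : (fun w => 1 - \1_E w) =
    (fun w => \sum_(i < n) \1_[set w | U n w = i] w * positive_degree n i w) :> (T -> R).
  apply/funext => w; rewrite (bigD1 (Ordinal (Un w)))//= [X in _ = _ + X]big1 => [|i iU].
    rewrite addr0 [X in _ = X * _](_ : _ = 1) ?mul1r; last by rewrite indicE mem_set.
    congr (1 - _); rewrite indicE; congr (nat_of_bool _)%:R.
    by apply/idP/eqP; rewrite inE.
  rewrite indicE memNset ?mul0r//= => h; move/eqP: iU; apply.
  by apply/val_inj; rewrite /= h.
have bI (i : 'I_n) : bounded_mfun (fun w => \1_[set w | U n w = i] w * positive_degree n i w).
  by apply: bounded_mfunM => //; apply: bounded_mfun_indic; exact: measurable_vertex.
have bE : bounded_mfun (fun w => 1 - \1_E w : R).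
  by rewrite EE; apply: bounded_mfun_sum => i _.
have mE : measurable E by exact: measurable_isolated.
have PE : fine (P E) = 1 - Ex (fun w => 1 - \1_E w).
  rewrite ExB; [|exact: bounded_mfun_cst|exact: bounded_mfun_indic].
  by rewrite Ex_cst Ex_indic// opprB addrC subrK.
rewrite PE lerD2l lerN2 EE Ex_sum => [|i _]; last exact: bI.
rewrite (eq_bigr (fun i : 'I_n => n%:R^-1 * Ex (positive_degree n i))); last first.
  by move=> i _; exact: Ex_uniform.
rewrite -mulr_sumr -Ex_sum => [|i _]; last exact: positive_degree_bounded.
have n0' : (0 : R) < n%:R by rewrite ltr0n.
have bheavy : bounded_mfun (fun y => 1 - light x y).
  by apply: bounded_mfunB => //; exact: bounded_mfun_cst.
pose G w := \sum_(i < n) (1 - light x (W i w)) + \sum_(k < n)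
  (if k == 0%N :> nat then 0 else light_targets x k (fun j => V k j w) w).
have bG1 : bounded_mfun (fun w => \sum_(i < n) (1 - light x (W i w))).
  apply: bounded_mfun_sum => i _.
  exact: (bounded_mfun_comp (mW i) bheavy).
have bt (k : nat) : bounded_mfun (fun w =>
    if k == 0%N :> nat then 0 else light_targets x k (fun j => V k j w) w).
  by case: k => [|k]; [exact: bounded_mfun_cst|exact: (Ex_light_targets x (ltn0Sn k)).1].
have bG2 : bounded_mfun (fun w => \sum_(k < n)
    (if k == 0%N :> nat then 0 else light_targets x k (fun j => V k j w) w)).
  by apply: bounded_mfun_sum => k _; exact: bt.
have le1 : Ex (fun w => \sum_(i < n) positive_degree n i w) <= Ex G.
  apply: Ex_le; [|exact: bounded_mfunD|].
    by apply: bounded_mfun_sum => i _; exact: positive_degree_bounded.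
  move=> w; rewrite /G.
  rewrite -(@sum_indegree _ _ m (fun i => W i) (fun i j => V i j) target (light x) n w).
  rewrite -big_split /=; apply: ler_sum => i _; rewrite /positive_degree.
  have /andP[l0 l1] := light01 x (W i w).
  have [->|h] := eqVneq (indegree V n i w) 0%N.
    by rewrite subrr mul0r addr0 subr_ge0.
  rewrite subr0.
  have h1 : 1 <= (indegree V n i w)%:R :> R by rewrite ler1n lt0n.
  have := ler_wpM2r l0 h1; rewrite mul1r; lra.
apply: le_trans (_ : n%:R^-1 * Ex G <= _); first by rewrite ler_pM2l// invr_gt0.
rewrite /G ExD// mulrDr Ex_sum => [|i _]; last first.
  exact: (bounded_mfun_comp (mW i) bheavy).
rewrite Ex_sum => [|k _]; last exact: bt.
rewrite le_eqVlt; apply/orP; left; apply/eqP; congr (_ + _).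
  rewrite (eq_bigr (fun=> Ex (fun w => 1 - light x (X w)))) => [|i _]; last first.
    exact: (iid_copies_Ex iidW i bheavy).
  by rewrite sumr_const card_ord -[Ex _ *+ n]mulr_natl mulrA mulVf ?mul1r// gt_eqF.
congr (_ * _); apply: eq_bigr => k _; have [k0|k0] := posnP k; first exact: Ex_cst.
exact: (Ex_light_targets x k0).2.
Qed.

Lemma Ex_edge_mean_le (x : R) (n : nat) : (0 < n)%N ->
  Ex (edge_mean W (light_targets x) n) <= m%:R.
Proof.
move=> n0; apply: le_trans (ler_norm _) _.
apply: Ex_norm_le; first exact: edge_mean_bounded.
exact: (edge_mean_le G_wrg (@light_targets_le x)).
Qed.

(** Given the weights, a half-edge attaches to a light vertex with probability
    the share of the light vertices in the total weight, which exceeds y as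
    soon as one weight does. *)
Lemma light_target_bound (x y : R) (n : nat) : (0 < n)%N -> 0 < y ->
  Ex (edge_mean W (light_targets x) n) <=
  m%:R * (1 - fine (P [set w | y <= X w])) ^+ n +
  m%:R * (n%:R * Ex (fun w => X w * light x (X w)) / y).
Proof.
move=> n0 y0.
pose A := [set w | forall i, i \in iota 0 n -> `]-oo, y[%classic (W i w)].
have mAi i : measurable [set w | `]-oo, y[%classic (W i w)].
  rewrite -[X in measurable X]setTI.
  by apply: (mW i) => //; exact: measurable_itv.
have PA : fine (P A) = (1 - fine (P [set w | y <= X w])) ^+ n.
  have [hX hind] := iidW.
  have -> := hind (iota 0 n) (fun=> `]-oo, y[%classic) (iota_uniq _ _)
    (fun=> measurable_itv _).
  have my : measurable [set w | y <= X w].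
    rewrite (_ : [set w | _] = X @^-1` `[y, +oo[%classic); last first.
      by apply/seteqP; split => w /=; rewrite in_itv /= andbT.
    by rewrite -[X in measurable X]setTI; apply: mX => //; exact: measurable_itv.
  have PWi i : P [set w | `]-oo, y[%classic (W i w)] = (1 - fine (P [set w | y <= X w]))%:E.
    have /= := hX i `]-oo, y[%classic (measurable_itv _).
    rewrite /distribution /= /pushforward => h.
    rewrite [LHS]h (_ : X @^-1` _ = ~` [set w | y <= X w]); last first.
      by apply/seteqP; split => w /=; rewrite in_itv /= ltNge => /negP.
    by rewrite probability_setC// EFinB fineK// fin_num_measure.
  rewrite (eq_bigr (fun=> (1 - fine (P [set w | y <= X w]))%:E)) => [|i _]; last exact: PWi.
  rewrite big_const_seq count_predT size_iota.
  have -> r : iter n (mule r%:E) 1%E = (r ^+ n)%:E :> \bar R.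
    by elim: (n) => [|k /= ->]; rewrite ?expr0// exprS EFinM.
  by [].
pose tr z := Num.max 0 z * light x z.
have trW i w : W i w * light x (W i w) = tr (W i w) by rewrite /tr (max_idPr (W0 i w)).
have tr0 z : 0 <= tr z.
  by rewrite mulr_ge0 ?le_max ?lexx//; case/andP: (light01 x z).
have btr : bounded_mfun tr.
  split.
    apply: measurable_funM; last exact: (light_bounded x).1.
    by apply: measurable_maxr; [exact: measurable_cst|exact: measurable_id].
  exists `|x| => z; rewrite ger0_norm// /tr /light indicE.
  have [zx|zx] := boolP (z <= x); last first.
    by rewrite memNset ?mulr0//= in_itv /=; exact/negP.
  rewrite mem_set /= ?in_itv//= mulr1 ge_max normr_ge0 (le_trans zx)//.
  exact: ler_norm.
have AE : \1_A = (fun w => \prod_(i < n) \1_(`]-oo, y[%classic) (W i w)) :> (T -> R).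
  apply/funext => w; rewrite indicE; have [Aw|Aw] := boolP (w \in A).
    rewrite big1// => i _; rewrite indicE mem_set//.
    by move: Aw; rewrite inE => /(_ i); apply; rewrite mem_iota /=.
  have [i hi] : exists i : 'I_n, ~ `]-oo, y[%classic (W i w).
    apply: contrapT => /forallNP h; move/negP: Aw; apply; rewrite inE => i.
    rewrite mem_iota /= add0n => ni.
    by have := h (Ordinal ni); rewrite notK.
  by rewrite (bigD1 i)//= indicE memNset// mul0r.
have bA : bounded_mfun (\1_A : T -> R).
  rewrite AE; apply: bounded_mfun_prod => i _.
  apply: (@bounded_mfun_comp _ _ _ _ _ (W i) (\1_(`]-oo, y[%classic))).
    exact: mW.
  by apply: bounded_mfun_indic; exact: measurable_itv.
have mA : measurable A by apply/measurable_indicP; exact: bA.1.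
have bS : bounded_mfun (fun w => \sum_(i < n) tr (W i w)).
  by apply: bounded_mfun_sum => i _; exact: bounded_mfun_comp.
have ptw w : edge_mean W (light_targets x) n w <=
    m%:R * \1_A w + m%:R / y * \sum_(i < n) tr (W i w).
  have R0 : 0 <= m%:R / y * \sum_(i < n) tr (W i w).
    by rewrite mulr_ge0 ?divr_ge0 ?(ltW y0)// sumr_ge0.
  have [Aw|Aw] := boolP (w \in A).
    rewrite indicE Aw mulr1 ler_wpDr//; apply: le_trans (ler_norm _) _.
    exact: (edge_mean_le G_wrg (@light_targets_le x)).
  rewrite indicE (negbTE Aw) mulr0 add0r.
  have Sy : y <= total_weight W n w.
    have [i yi] : exists i : 'I_n, y <= W i w.
      apply: contrapT => /forallNP h; move/negP: Aw; apply; rewrite inE => i.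
      rewrite mem_iota /= add0n in_itv /= => ni.
      by rewrite ltNge; apply/negP; exact: (h (Ordinal ni)).
    apply: le_trans yi _; rewrite /total_weight (bigD1 i)//= lerDl.
    by apply: sumr_ge0 => l _; exact: W0.
  have S0 := lt_le_trans y0 Sy.
  rewrite (@edge_mean_sum _ _ _ P m W w (fun _ i w => light x (W i w)) n S0).
  apply: ler_pM.
  - by rewrite divr_ge0// ltW.
  - by apply: sumr_ge0 => i _; rewrite trW.
  - by rewrite ler_wpM2l// lef_pV2 ?posrE.
  - by apply: ler_sum => i _; rewrite trW.
apply: le_trans (_ : Ex (fun w => m%:R * \1_A w + m%:R / y * \sum_(i < n) tr (W i w)) <= _).
  apply: Ex_le => //; first exact: edge_mean_bounded.
  by apply: bounded_mfunD; exact: bounded_mfunZ.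
rewrite ExD; [|exact: bounded_mfunZ|exact: bounded_mfunZ].
rewrite !ExZ// Ex_indic// PA lerD2l Ex_sum => [|i _]; last exact: bounded_mfun_comp.
rewrite (eq_bigr (fun=> Ex (fun w => X w * light x (X w)))) => [|i _]; last first.
  rewrite (iid_copies_Ex iidW i btr); congr Rintegral; apply/funext => w.
  by rewrite /tr (max_idPr (X_ge0 w)).
rewrite sumr_const card_ord -[Ex _ *+ n]mulr_natl le_eqVlt; apply/orP; left; apply/eqP.
by field; rewrite gt_eqF.
Qed.

End UniformVertex.

(** * The rate of convergence *)

Section Rate.
Variable R : realType.

Lemma near_powR_ge (s M : R) : 0 < s -> \forall n \near \oo, M <= n%:R `^ s.
Proof.
move=> s0; near=> n.
pose A := (`|M| + 1) `^ s^-1.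
have A0 : 0 <= A by exact: powR_ge0.
have An : A <= n%:R by near: n; exact: nbhs_infty_ger.
apply: (@le_trans _ _ (A `^ s)).
  rewrite -powRrM mulVf ?gt_eqF// powRr1 ?addr_ge0//.
  by apply: le_trans (ler_norm _) _; rewrite lerDl.
by rewrite ge0_ler_powR ?nnegrE// ltW.
Unshelve. all: by end_near. Qed.

Lemma sum_before (n : nat) (K : R) : 0 <= K ->
  \sum_(k < n) (k%:R < K)%R%:R <= K + 1.
Proof.
move=> K0; pose q := (Num.truncn K).+1.
have Kq : K < q%:R by exact: truncnS_gt.
have qK : q%:R <= K + 1.
  by rewrite /q -natr1 lerD2r; have /andP[] := truncn_itv K0.
apply: le_trans qK; apply: (@le_trans _ _ (\sum_(k < n) (k < q)%N%:R)).
  apply: ler_sum => k _; have [kK|_] := ltP k%:R K; last by [].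
  by rewrite (_ : (k < q)%N = true)// -(ltr_nat R) (lt_trans kK).
rewrite -natr_sum ler_nat.
suff -> : (\sum_(k < n) (k < q) = minn n q)%N by exact: geq_minr.
elim: n => [|n IH]; first by rewrite big_ord0 min0n.
by rewrite big_ord_recr /= IH; lia.
Qed.

Variables (a eps : R) (m : nat) (F G H : R -> R) (p : nat -> R).
Variable b : R -> nat -> R.
Hypothesis a01 : 0 < a < 1.
Hypothesis eps0 : 0 < eps.
Hypothesis F01 : forall x, 0 <= F x <= 1.
Hypothesis Fup : forall e, 0 < e -> exists C x0 : R, [/\ 0 < C, 0 < x0 &
  forall x, x0 <= x -> F x <= C * x `^ (- a + e)].
Hypothesis Flow : forall e, 0 < e -> exists c x0 : R, [/\ 0 < c, 0 < x0 &
  forall x, x0 <= x -> c * x `^ (- a - e) <= F x].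
Hypothesis Hup : forall e, 0 < e -> exists C x0 : R, [/\ 0 < C, 0 < x0 &
  forall x, x0 <= x -> H x <= C * x `^ (1 - a + e)].
Hypothesis GF : forall x, G x <= F x.
Hypothesis pE : forall n x, (0 < n)%N ->
  p n <= G x + n%:R^-1 * \sum_(k < n) (if k == 0%N :> nat then 0 else b x k).
Hypothesis b_le : forall x k, (0 < k)%N -> b x k <= m%:R.
Hypothesis b_split : forall x y k, (0 < k)%N -> 0 < y ->
  b x k <= m%:R * (1 - F y) ^+ k + m%:R * (k%:R * H x / y).

Let a0 : 0 < a. Proof. by case/andP: a01. Qed.
Let a1 : a < 1. Proof. by case/andP: a01. Qed.

Lemma one_sub_exp (u : R) (k : nat) : 0 <= u <= 1 -> (1 - u) ^+ k <= expR (- (k%:R * u)).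
Proof.
move=> /andP[u0 u1]; rewrite -mulrN expRM_natl.
apply: lerXn2r; rewrite ?nnegrE ?subr_ge0 ?expR_ge0//.
exact: expR_ge1Dx.
Qed.

(** Here F is the tail of X, H its truncated mean, G the tail beyond the cut-off,
    p n the probability that the uniform vertex is not isolated and b x k the
    expected number of half-edges of vertex k with a target of weight at most x.
    The vertices before K = n^(1/(2-a)) contribute K / n = n^(-rho), the heavy
    ones x^(-a) = n^(-rho), and for k >= K the bound b_split is of the order of
    k^(1-1/a) x^(1-a), which is largest at k = K, where it is n^(-rho) again. *)
Lemma isolated_rate : exists2 C : R, 0 < C & \forall n \near \oo,
  p n <= C * n%:R `^ (- ((1 - a) / (2 - a)) + eps).
Proof.
have [apos alt1] : 0 < a /\ a < 1 by split; [exact: a0|exact: a1].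
have epos := eps0.
pose rho := (1 - a) / (2 - a).
have a2 : 0 < 2 - a by lra.
have rhoE : rho * (2 - a) = 1 - a by rewrite /rho divfK// gt_eqF.
have rho0 : 0 < rho by rewrite /rho divr_gt0//; lra.
have rho1 : rho < 1 by rewrite /rho ltr_pdivrMr//; lra.
(* the loss in the exponent of y; the second bound keeps 1 - 1/a + eta < 0 *)
pose eta := Num.min (eps / 2) ((1 - a) / (2 * a)).
have eta0 : 0 < eta.
  by rewrite lt_min !divr_gt0//; [lra|rewrite mulr_gt0].
have eta_eps : eta <= eps / 2 by rewrite /eta ge_min lexx.
have eta_a : eta * (2 * a) <= 1 - a.
  by rewrite -ler_pdivlMr ?mulr_gt0// /eta ge_min lexx orbT.
(* with this loss for the tail, k P(X >= y) is at least of the order of k^om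
   for y = k^(1/a - eta), where om = (eta a)^2 > 0 *)
pose e := eta * a ^+ 2.
have e0 : 0 < e by rewrite mulr_gt0// exprn_gt0.
have [Cu [xu [Cu0 xu0 HCu]]] := Fup e0.
have [cl [xl [cl0 xl0 Hcl]]] := Flow e0.
have [Ch [xh [Ch0 xh0 HCh]]] := Hup e0.
pose om := (eta * a) ^+ 2.
have om0 : 0 < om by rewrite exprn_gt0// mulr_gt0.
pose v := a^-1 - eta.
have ainv : a^-1 * a = 1 by rewrite mulVf// gt_eqF.
have v0 : 0 < v.
  rewrite -(pmulr_lgt0 _ a0) /v mulrBl ainv; nra.
have omE : 1 + v * (- a - e) = om by rewrite /v /e /om; field; rewrite gt_eqF.
(* the exponential of - k^om is compared with the power - 1 of k *)
pose s := om^-1.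
have s0 : 0 < s by rewrite invr_gt0.
pose B1 := s `^ s * cl `^ (- s).
have B10 : 0 <= B1 by rewrite mulr_ge0// powR_ge0.
pose C := Cu + m%:R * 2 + m%:R * (B1 + Ch).
have C0 : 0 < C by rewrite /C -addrA ltr_pwDl// addr_ge0// mulr_ge0// addr_ge0// ltW.
exists C => //; near=> n.
have n1 : (1 : R) <= n%:R by rewrite ler1n; near: n; exists 1%N.
have n0 : (0 < n)%N by rewrite -(ltr_nat R) (lt_le_trans ltr01 n1).
have nr0 : (0 : R) < n%:R by rewrite ltr0n.
pose K := n%:R `^ ((2 - a)^-1).
pose x := n%:R `^ (rho / a).
have xbig : Num.max xu xh <= n%:R `^ (rho / a).
  by near: n; apply: near_powR_ge; rewrite divr_gt0.
have ybig : xl <= n%:R `^ ((2 - a)^-1 * v).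
  by near: n; apply: near_powR_ge; rewrite mulr_gt0// invr_gt0.
have x0 : 0 < x by rewrite powR_gt0.
have K0 : 0 < K by rewrite powR_gt0.
have K1 : 1 <= K by rewrite /K -[leLHS](powRr0 n%:R) ler_powR// invr_ge0 ltW.
move: xbig; rewrite -/x ge_max => /andP[xux xhx].
set r := n%:R `^ (- rho + eps).
have r0 : 0 < r by rewrite powR_gt0.
have heavy : G x <= Cu * r.
  apply: le_trans (GF x) _; apply: le_trans (HCu x xux) _.
  rewrite ler_pM2l// /x -powRrM ler_powR//.
  have -> : rho / a * (- a + e) = - rho + rho * (eta * a).
    by rewrite /e; field; rewrite gt_eqF.
  rewrite lerD2l; have h1 : eta * a <= eta by rewrite ler_piMr// ltW.
  have h2 : rho * (eta * a) <= eta * a by rewrite ler_piMl ?mulr_ge0 ?ltW.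
  lra.
have late k : (0 < k)%N -> K <= k%:R -> b x k <= m%:R * (B1 + Ch) * r.
  move=> k0 Kk; have kr0 : (0 : R) < k%:R by rewrite ltr0n.
  pose y := k%:R `^ v.
  have y0 : 0 < y by rewrite powR_gt0.
  have xly : xl <= y.
    apply: le_trans ybig _; rewrite powRrM -/K.
    by rewrite ge0_ler_powR ?nnegrE// ltW.
  apply: le_trans (b_split x k0 y0) _.
  rewrite -mulrDr -[leRHS]mulrA ler_wpM2l// mulrDl; apply: lerD.
    apply: le_trans (one_sub_exp k (F01 y)) _.
    have kF : cl * k%:R `^ om <= k%:R * F y.
      apply: le_trans (_ : k%:R * (cl * y `^ (- a - e)) <= _); last first.
        by rewrite ler_pM2l// Hcl.
      by rewrite mulrCA ler_pM2l// -omE powRD_gt0// powRr1// powRrM.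
    apply: (@le_trans _ _ (expR (- (cl * k%:R `^ om)))); first by rewrite ler_expR lerN2.
    have t0 : 0 < cl * k%:R `^ om by rewrite mulr_gt0// powR_gt0.
    apply: le_trans (expRN_le_powR t0 s0) _.
    rewrite powRM ?powR_ge0 ?(ltW cl0)// mulrA -/B1 ler_wpM2l//.
    rewrite -powRrM mulrN mulfV ?gt_eqF//.
    apply: (@le_trans _ _ (K `^ (-1))).
      by rewrite !powRN !powRr1 ?(ltW kr0) ?(ltW K0)// lef_pV2 ?posrE.
    rewrite /K -powRrM ler_powR// mulrN mulr1.
    have : (2 - a)^-1 = rho + a * (2 - a)^-1.
      by rewrite /rho; field; rewrite gt_eqF.
    have : 0 <= a * (2 - a)^-1 by rewrite divr_ge0 ?ltW.
    lra.
  have hH : H x <= Ch * x `^ (1 - a + e) by exact: HCh.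
  apply: (@le_trans _ _ (k%:R * (Ch * x `^ (1 - a + e)) / y)).
    by rewrite ler_pM2r ?invr_gt0// ler_pM2l.
  pose g := 1 - v.
  have g0 : g <= 0.
    by rewrite -(pmulr_lle0 _ a0) /g /v mulrBl mulrBl ainv; nra.
  have -> : k%:R * (Ch * x `^ (1 - a + e)) / y = Ch * (x `^ (1 - a + e) * k%:R `^ g).
    have -> : k%:R `^ g = k%:R / y by rewrite /g powRD_gt0// powRr1 ?(ltW kr0)// powRN.
    by move: (k%:R : R) => q; ring.
  rewrite ler_pM2l//.
  apply: (@le_trans _ _ (x `^ (1 - a + e) * K `^ g)).
    rewrite ler_wpM2l ?powR_ge0// !powR_exp// ler_expR ler_wnM2l//.
    by rewrite ler_ln.
  rewrite /x /K -!powRrM -powRD_gt0// ler_powR//.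
  rewrite -(ler_pM2r a0) -(ler_pM2r a2).
  have -> : (rho / a * (1 - a + e) + (2 - a)^-1 * g) * a * (2 - a) =
     (1 - a) * (1 - a + eta * a ^+ 2) + (a - 1 + eta * a).
    by rewrite /rho /g /v /e; field; rewrite !gt_eqF.
  have -> : (- rho + eps) * a * (2 - a) = - ((1 - a) * a) + eps * (a * (2 - a)).
    by rewrite -rhoE; ring.
  have h1 : eta * a * ((1 - a) * a + 1) <= eps * (a * (2 - a)).
    have -> : eta * a * ((1 - a) * a + 1) = a * (eta * ((1 - a) * a + 1)) by ring.
    have -> : eps * (a * (2 - a)) = a * (eps * (2 - a)) by ring.
    rewrite ler_pM2l//.
    apply: (@le_trans _ _ (eta * 2)); first by rewrite ler_pM2l//; nra.
    apply: (@le_trans _ _ eps); first by lra.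
    by rewrite ler_peMr ?(ltW eps0)//; lra.
  have -> : (1 - a) * (1 - a + eta * a ^+ 2) + (a - 1 + eta * a) =
     - ((1 - a) * a) + eta * a * ((1 - a) * a + 1) by ring.
  by rewrite lerD2l.
have bound (k : 'I_n) : (if k == 0%N :> nat then 0 else b x k) <=
    m%:R * (k%:R < K)%R%:R + m%:R * (B1 + Ch) * r.
  have R0 : 0 <= m%:R * (B1 + Ch) * r.
    by apply: mulr_ge0 (ltW r0); apply: mulr_ge0 => //; apply: addr_ge0 => //; exact: ltW.
  case: ifPn => [_|k0]; first by rewrite addr_ge0// mulr_ge0.
  rewrite -lt0n in k0.
  have [kK|Kk] := ltP k%:R K; first by rewrite mulr1 ler_wpDr// b_le.
  by rewrite mulr0 add0r late.
apply: le_trans (pE x n0) _.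
rewrite /C 2!mulrDl -addrA; apply: lerD heavy _.
apply: (@le_trans _ _ (n%:R^-1 * (m%:R * (K + 1) + n%:R * (m%:R * (B1 + Ch) * r)))).
  rewrite ler_pM2l ?invr_gt0//; apply: le_trans (ler_sum _ (fun k _ => bound k)) _.
  rewrite big_split /= -mulr_sumr; apply: lerD.
    by rewrite ler_wpM2l// sum_before// ltW.
  by move: (m%:R * (B1 + Ch) * r) => z; rewrite sumr_const card_ord mulr_natl.
rewrite mulrDr mulKf ?gt_eqF// lerD2r.
have Kr : n%:R^-1 * K <= r.
  rewrite -[n%:R^-1]powR_inv1 ?(ltW nr0)// /K -powRD_gt0// /r ler_powR//.
  have -> : -1 + (2 - a)^-1 = - rho by rewrite /rho; field; rewrite gt_eqF.
  by rewrite lerDl ltW.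
have h : n%:R^-1 * (K + 1) <= 2 * r.
  apply: (@le_trans _ _ (n%:R^-1 * (2 * K))); first by rewrite ler_pM2l ?invr_gt0//; lra.
  by rewrite mulrCA ler_pM2l.
by rewrite mulrCA -mulrA ler_wpM2l.
Unshelve. all: by end_near. Qed.

End Rate.

(** * Power-law weights *)

Section PowerLaw.
Context (d : measure_display) (T : measurableType d) (R : realType).
Variables (P : probability T R) (m : nat) (X : {RV P >-> R}).
Variables (W : nat -> {RV P >-> R}) (V : nat -> 'I_m -> {RV P >-> nat}).
Variable U : nat -> {RV P >-> nat}.
Hypothesis X_ge0 : forall w, 0 <= X w.
Hypothesis G_wrg : weighted_recursive_graph X W V.
Hypothesis unifU : uniform_vertex W V U.
Local Notation Ex := (Rintegral P setT).
Let mX : measurable_fun setT X. Proof. exact: measurable_funP. Qed.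

Let F (x : R) : R := fine (P [set w | x <= X w]).
Let H (x : R) : R := Ex (fun w => X w * light x (X w)).

Let mtail x : measurable [set w | x <= X w].
Proof.
rewrite (_ : [set w | _] = X @^-1` `[x, +oo[%classic); last first.
  by apply/seteqP; split => w /=; rewrite in_itv /= andbT.
by rewrite -[X in measurable X]setTI; apply: mX => //; exact: measurable_itv.
Qed.

Let F_Ex x : F x = Ex (\1_[set w | x <= X w]).
Proof. by rewrite Ex_indic. Qed.

Let btail x : bounded_mfun (\1_[set w | x <= X w] : T -> R).
Proof. exact: bounded_mfun_indic. Qed.

Let F01 x : 0 <= F x <= 1.
Proof.
by rewrite /F fine_ge0//= -lee_fin fineK ?fin_num_measure// probability_le1.
Qed.

Let Fdecr x y : x <= y -> F y <= F x.
Proof.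
move=> xy; rewrite !F_Ex; apply: Ex_le => // w; rewrite !indicE ler_nat.
have [h|_] := boolP (w \in [set w | y <= X w]); last by [].
by rewrite mem_set//=; move: h; rewrite inE /=; exact: le_trans.
Qed.

Let bH x : bounded_mfun (fun w => X w * light x (X w)).
Proof.
split.
  apply: measurable_funM => //.
  by apply: (measurableT_comp _ mX); apply: measurable_indic; exact: measurable_itv.
exists `|x| => w; rewrite /light indicE normrM ger0_norm//.
have [zx|zx] := boolP (X w <= x); last first.
  by rewrite memNset ?normr0 ?mulr0//= in_itv /=; exact/negP.
by rewrite mem_set /= ?in_itv//= normr1 mulr1 (le_trans zx)// ler_norm.
Qed.

Let lightE (x z : R) : light x z = (z <= x)%R%:R.
Proof.
rewrite /light indicE; congr (nat_of_bool _)%:R.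
by apply/idP/idP; rewrite inE /= in_itv.
Qed.

Let tailE x w : \1_[set w | x <= X w] w = (x <= X w)%R%:R :> R.
Proof. by rewrite indicE; congr (nat_of_bool _)%:R; apply/idP/idP; rewrite inE. Qed.

Let Hincr x y : x <= y -> H x <= H y.
Proof.
move=> xy; apply: Ex_le => // w; rewrite ler_wpM2l// !lightE ler_nat.
by have [h|_] := boolP (X w <= x); rewrite ?(le_trans h xy).
Qed.

Let Hdbl x : 0 < x -> H (2 * x) <= H x + 2 * x * F x.
Proof.
move=> x0; rewrite F_Ex /H -ExZ// -ExD//; last exact: bounded_mfunZ.
apply: Ex_le => //; first by apply: bounded_mfunD => //; exact: bounded_mfunZ.
move=> w; rewrite !lightE tailE; have Xw := X_ge0 w.
have [h1|h1] := leP (X w) x.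
  have -> : X w <= 2 * x by lra.
  by rewrite lerDl mulr_ge0 ?mulr_ge0 ?(ltW x0).
rewrite (ltW h1) !mulr1 mulr0 add0r.
by have [h2|_] := leP (X w) (2 * x); rewrite ?mulr1 ?mulr0 ?mulr_ge0 ?(ltW x0).
Qed.

(** The exponent (1-a)/(2-a) of [isolated_rate] is at least the smaller of 1-a
    and a divided by 1+a: for a >= 1/2 because 2-a <= 1+a, and for a <= 1/2
    because a (2-a) <= (1-a) (1+a). *)
Lemma power_law_isolated (alpha : R) (ell : R -> R) (eps : R) :
  1 < alpha < 2 -> (forall x, 0 < x -> 0 <= ell x) -> slowly_varying ell ->
  (forall x, 0 < x ->
     P [set w | x <= X w] = (ell x * x `^ (- (alpha - 1)))%:E) ->
  0 < eps ->
  exists2 C : R, 0 < C &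
    \forall n \near \oo,
      ((1 - C * n%:R `^ (- (Num.min (2 - alpha) (alpha - 1) / alpha) + eps))%:E
       <= P [set w | indegree V n (U n w) w = 0%N])%E.
Proof.
move=> /andP[al1 al2] ell0 [_ sv] tail eps0.
pose a := alpha - 1.
have a0 : 0 < a by rewrite /a; lra.
have a1 : a < 1 by rewrite /a; lra.
have a01 : 0 < a < 1 by rewrite a0.
have two_pos : (0 : R) < 2 by [].
have FE x : 0 < x -> F x = ell x * x `^ (- a) by move=> x0; rewrite /F tail.
have sv2 := sv 2 two_pos.
have Fup e (e0 : 0 < e) := tail_upper F01 FE ell0 sv2 e0.
have Flow e (e0 : 0 < e) := tail_lower a0 Fdecr FE ell0 sv2 e0.
have Hup e (e0 : 0 < e) : exists C x0 : R, [/\ 0 < C, 0 < x0 &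
    forall x, x0 <= x -> H x <= C * x `^ (1 - a + e)].
  by apply: (truncated_growth F01 FE ell0 sv2) => //; lra.
have GF x : Ex (fun w => 1 - light x (X w)) <= F x.
  rewrite F_Ex; apply: Ex_le => //.
    apply: bounded_mfunB; first exact: bounded_mfun_cst.
    apply: (bounded_mfun_comp mX); apply: bounded_mfun_indic; exact: measurable_itv.
  move=> w; rewrite lightE tailE; case: (leP (X w) x) => h; last by rewrite (ltW h) subr0.
  by rewrite subrr.
have pE n x : (0 < n)%N -> 1 - fine (P [set w | indegree V n (U n w) w = 0%N]) <=
    Ex (fun w => 1 - light x (X w)) + n%:R^-1 * \sum_(k < n)
      (if k == 0%N :> nat then 0 else Ex (edge_mean W (@light_targets _ _ _ P m W x) k)).
  move=> n0; have := isolated_vertex_bound G_wrg unifU x n0.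
  by rewrite !lerBlDr addrC.
have b_le x k : (0 < k)%N -> Ex (edge_mean W (@light_targets _ _ _ P m W x) k) <= m%:R.
  by move=> k0; exact: (Ex_edge_mean_le G_wrg x k0).
have b_split x y k : (0 < k)%N -> 0 < y -> Ex (edge_mean W (@light_targets _ _ _ P m W x) k) <=
    m%:R * (1 - F y) ^+ k + m%:R * (k%:R * H x / y).
  by move=> k0 y0; exact: (light_target_bound X_ge0 G_wrg x k0 y0).
have [C C0 HC] := isolated_rate a01 eps0 F01 Fup Flow Hup GF pE b_le b_split.
exists C => //; near=> n.
have n0 : (1 : R) <= n%:R by rewrite ler1n; near: n; exists 1%N.
rewrite -[leRHS]fineK ?fin_num_measure//; last first.
  apply: (measurable_isolated unifU); rewrite -(ltr_nat R); exact: lt_le_trans n0.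
rewrite lee_fin lerBlDr -lerBlDl.
apply: le_trans (_ : C * n%:R `^ (- ((1 - a) / (2 - a)) + eps) <= _); first by near: n.
rewrite ler_pM2l// ler_powR// lerD2r lerN2 ler_pdivlMr; last by lra.
have al0 : 0 < alpha by lra.
rewrite mulrAC ler_pdivrMr//.
have aE : alpha = 1 + a by rewrite /a; lra.
have [h|h] := leP (2 - alpha) (alpha - 1); rewrite aE in h *; nra.
Unshelve. all: by end_near. Qed.

End PowerLaw.

(** * Degree distributions of the weighted recursive graph *)

Theorem theorem2p5 (d : measure_display) (T : measurableType d) (R : realType)
    (P : probability T R) (m : nat) (X : {RV P >-> R})
    (W : nat -> {RV P >-> R}) (V : nat -> 'I_m -> {RV P >-> nat})
    (m_gt0 : (0 < m)%N)
    (X_ge0 : forall w, 0 <= X w)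
    (X_gt0 : P [set w | 0 < X w] = 1%E)
    (G_wrg : weighted_recursive_graph X W V) :
  ((('E_P[X] < +oo)%E ->
    let b := fine 'E_P[X] / m%:R in
    let p := fun k : nat => (\int[distribution P X]_(x in `[0%R, +oo[)
      (mixed_geometric b k x)%:E)%E in
    exists (Gam : {finite_measure set R -> \bar R})
           (Gamk : nat -> {finite_measure set R -> \bar R}),
      [/\ has_density (distribution P X) Gam
            (fun x => x * m%:R / fine 'E_P[X]),
          forall k, has_density (distribution P X) (Gamk k)
            (mixed_geometric b k)
        & {ae P, forall w,
            weak_star_cvg (fun n => Gamma_n W V n w) Gam /\
            forall k : nat,
              weak_star_cvg (fun n => Gamma_nk W V k n w) (Gamk k) /\
              (fun n => p_n W V k n w) @ \oo --> p k}])
  /\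
   (forall (alpha : R) (ell : R -> R) (x_l : R) (U : nat -> {RV P >-> nat})
      (eps : R),
      1 < alpha < 2 ->
      (forall x, 0 < x -> 0 <= ell x) ->
      slowly_varying ell ->
      (forall x, 0 < x ->
         P [set w | x <= X w] = (ell x * x `^ (- (alpha - 1)))%:E) ->
      0 < x_l ->
      distribution P X `]x_l, +oo[%classic = 1%E ->
      uniform_vertex W V U ->
      0 < eps ->
      exists2 C : R, 0 < C &
        \forall n \near \oo,
          ((1 - C * n%:R `^ (- (Num.min (2 - alpha) (alpha - 1) / alpha)
                             + eps))%:E
           <= P [set w | indegree V n (U n w) w = 0%N])%E)).
Proof.
split.
  by move=> EX b p; exact: (finite_mean_limits m_gt0 X_ge0 X_gt0 G_wrg EX).
move=> alpha ell x_l U eps al ell0 sv tail _ _ unifU eps0.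
exact: (power_law_isolated X_ge0 G_wrg unifU al ell0 sv tail eps0).
Qed.
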